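(* Let $\mathcal W$ be an infinite computably enumerable set of rational primes and fix a computable enumeration $q_1,q_2,\ldots$ of $\mathcal W$. Then there exists a set $\mathcal S\subseteq\mathcal W$ such that $\mathcal W-\mathcal S$ has relative upper density $1$ in $\mathcal W$ and $\operatorname{HTP}(\mathbb{Z}[\mathcal W^{-1}])\ge_T\operatorname{HTP}(\mathbb{Z}[\mathcal S^{-1}])$. In particular, $\mathcal S$ has relative lower density $0$ in $\mathcal W$.
   Context: For a set $\mathcal S$ of rational primes, $\mathbb{Z}[\mathcal S^{-1}]$ is the subring of $\mathbb{Q}$ obtained by inverting the primes in $\mathcal S$. Given the enumeration $q_1,q_2,\ldots$ of $\mathcal W$ (listed in order of enumeration, not necessarily increasing), the relative upper density of $\mathcal T\subseteq\mathcal W$ in $\mathcal W$ is $\limsup_{n\to\infty}|\mathcal T\cap\{q_1,\ldots,q_n\}|/n$, and the relative lower density is the corresponding $\liminf$. For a subring $R\subseteq\mathbb{Q}$, $\operatorname{HTP}(R)$ is the set of (indices, under a fixed computable enumeration, of) polynomials with integer coefficients in finitely many variables that have a zero with all coordinates in $R$. $\le_T$ denotes Turing reducibility. *)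

(* Defs.v *)
From Stdlib Require List.
From mathcomp Require Import all_boot all_order all_algebra.
From mathcomp Require Import finmap mpoly.
From mathcomp Require Import boolp classical_sets functions cardinality.
From mathcomp Require Import reals topology normedtype sequences.

Set Implicit Arguments.
Unset Strict Implicit.
Unset Printing Implicit Defensive.

Import Order.TTheory GRing.Theory Num.Theory.
Local Open Scope classical_set_scope.
Local Open Scope ring_scope.

(* Kleene's mu-recursive functions with an extra oracle symbol.  Programs act
   on finite argument lists without arity discipline: missing arguments read
   as 0 and superfluous ones are ignored. *)
Inductive prog : Type :=
| PZero
| PSucc
| PProj of nat
| POracle
| PComp of prog & seq prog
| PPrec of prog & prog
| PMu of prog.

(* [sem A p xs y]: with oracle A, program p halts on arguments xs with output
   y.  In [PPrec] the recursion argument comes first and r is the course of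
   values; in [PMu] the values below the least zero must all be defined. *)
Fixpoint sem (A : set nat) (p : prog) (xs : seq nat) (y : nat) : Prop :=
  match p with
  | PZero => y = 0%N
  | PSucc => y = (head 0%N xs).+1
  | PProj i => y = nth 0%N xs i
  | POracle => y = nat_of_bool `[< A (head 0%N xs) >]
  | PComp f gs => exists ys : seq nat,
      List.Forall2 (fun (P : nat -> Prop) (z : nat) => P z)
        [seq sem A g xs | g <- gs] ys
      /\ sem A f ys y
  | PPrec f g => exists r : nat -> nat,
      [/\ sem A f (behead xs) (r 0%N),
          forall i : nat, (i < head 0%N xs)%N ->
            sem A g [:: i, r i & behead xs] (r i.+1)
        & y = r (head 0%N xs)]
  | PMu f => sem A f (y :: xs) 0%N
      /\ forall z : nat, (z < y)%N -> exists k : nat, sem A f (z :: xs) k.+1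
  end.

Definition turing_reducible (A B : set nat) : Prop :=
  exists p : prog, forall x : nat, sem B p [:: x] (nat_of_bool `[< A x >]).

Definition computable_fun (f : nat -> nat) : Prop :=
  exists p : prog, forall x : nat, sem set0 p [:: x] (f x).

Definition computably_enumerable (A : set nat) : Prop :=
  exists p : prog, A = [set x | exists y : nat, sem set0 p [:: x] y].

(* q lists W without repetition; the n-th element q_n is [q n.-1]. *)
Definition computable_enumeration (q : nat -> nat) (W : set nat) : Prop :=
  [/\ computable_fun q, injective q & range q = W].

Definition rel_freq (R : realType) (q : nat -> nat) (T : set nat) : R^nat :=
  fun n => (#|` fset_set (T `&` q @` `I_n) |)%fset%:R / n%:R.

Definition rel_upper_density (R : realType) (q : nat -> nat) (T : set nat) : R :=
  limn_sup (rel_freq R q T).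

Definition rel_lower_density (R : realType) (q : nat -> nat) (T : set nat) : R :=
  limn_inf (rel_freq R q T).

(* Z[S^-1], as the localization of Z at the products of elements of S. *)
Definition Zinv (S : set nat) : set rat :=
  [set x | exists (a : int) (s : seq nat),
     (forall p : nat, p \in s -> S p) /\ x = a%:~R / (\prod_(p <- s) p)%N%:R].

Definition int_of_nat (k : nat) : int := if odd k then Negz k./2 else Posz k./2.

(* The index e encodes, through the bijection [CodeSeq.decode] between nat and
   seq nat, a list whose head is the number of variables n and whose other
   entries each encode a monomial, again as a list: its coefficient followed
   by its exponents. *)
Definition index_nvars (e : nat) : nat := head 0%N (CodeSeq.decode e).

Definition index_monomial (n t : nat) : {mpoly int[n]} :=
  let s := CodeSeq.decode t in
  int_of_nat (head 0%N s) *: 'X_[[multinom nth 0%N (behead s) i | i < n]].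

Definition index_poly (e : nat) : {mpoly int[index_nvars e]} :=
  \sum_(t <- behead (CodeSeq.decode e)) index_monomial (index_nvars e) t.

Lemma int_of_nat_surj (a : int) : exists k : nat, int_of_nat k = a.
Proof.
case: a => m; first by exists m.*2; rewrite /int_of_nat odd_double doubleK.
by exists m.*2.+1; rewrite /int_of_nat /= odd_double /= uphalf_double.
Qed.

Lemma index_poly_surj (n : nat) (P : {mpoly int[n]}) :
  exists e : nat, existT (fun m : nat => {mpoly int[m]}) _ (index_poly e)
    = existT (fun m : nat => {mpoly int[m]}) n P.
Proof.
have mono (m : 'X_{1..n}) : exists t : nat, index_monomial n t = P@_m *: 'X_[m].
  have [k kE] := int_of_nat_surj P@_m.
  exists (CodeSeq.code (k :: m)); rewrite /index_monomial CodeSeq.codeK /= kE.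
  congr (_ *: 'X_[_]); apply/mnmP => i.
  by rewrite mnmE (mnm_nth 0).
have [c cE] : exists c : 'X_{1..n} -> nat,
    forall m, index_monomial n (c m) = P@_m *: 'X_[m].
  by exists (fun m => projT1 (cid (mono m))) => m; case: cid.
exists (CodeSeq.code (n :: [seq c m | m <- msupp P])).
rewrite /index_poly /index_nvars CodeSeq.codeK /= big_map.
by congr existT; rewrite [RHS]mpolyE; apply: eq_bigr => m _; rewrite cE.
Qed.

Definition HTP (R : set rat) : set nat :=
  [set e | exists v : 'I_(index_nvars e) -> rat,
     (forall i, R (v i)) /\ (map_mpoly intr (index_poly e)).@[v] = 0].

(* Main.v *)
(* Let A be a finite nonempty set of odd primes of W with product P, and let d be
   a prime, congruent to 1 modulo 4 and a nonresidue modulo every p in A.  If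
   1 - 4 P d u^2 = y1^2 - P y2^2 - d y3^2 is solvable in Q, then u is p-integral
   for all p in A, by descent modulo p.  Conversely it is solvable for every
   integer u: for a prime r with suitable quadratic symbols, Legendre's theorem
   on a x^2 + b y^2 = c z^2 makes r a value, up to squares, of both z^2 - P x^2
   and d z^2 - n y^2, where n is the squarefree part of 4 P d u^2 - 1.  A number
   of Z[W^-1] thus lies in Z[(W - A)^-1] if and only if it is u / (1 + P w) for
   some such u and w, so HTP(Z[(W - A)^-1]) reduces to HTP(Z[W^-1]), uniformly
   in A.  The prime r comes from Mertens' estimates for quadratic characters.

   At stage e, ask whether the polynomial of index e has a zero in
   Z[(W - A)^-1], A being the set of primes excluded so far.  If it has one,
   find one and protect the finitely many primes in its denominators.  Then
   exclude q_i for all i in an interval [N, (e + 2) N) beyond all the primes seen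
   so far.  The answer to stage e is also the answer for the surviving primes,
   and the long intervals of excluded primes yield the densities. *)
From Stdlib Require List.
Require Import Defs.
From mathcomp Require Import all_boot all_order all_fingroup all_algebra.
From mathcomp Require Import all_solvable all_field.
From mathcomp Require Import finmap mpoly.
From mathcomp Require Import zify ring lra.
From mathcomp Require Import boolp classical_sets cardinality.
From mathcomp Require Import reals exp topology normedtype sequences.

Set Implicit Arguments.
Unset Strict Implicit.
Unset Printing Implicit Defensive.

Import Order.TTheory GRing.Theory Num.Theory.
Local Open Scope ring_scope.

(** * Legendre's theorem on diagonal ternary forms *)

(** The form y1^2 - P y2^2 - d y3^2 + P d (2 u)^2 is the reduced norm of the quaternion algebra (P,
    d). At a prime p of A it is anisotropic because p divides P exactly once and d is a nonresidue,
    whence elements of norm 1 are p-integral. The factor 4 keeps 4 P d u^2 - 1 odd, so that only odd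
    primes carry symbol conditions; taking d and r congruent to 1 modulo 4 makes reciprocity
    symmetric and -1 a square modulo both. The theory of ternary forms gives rational solutions with
    uncontrolled denominators, whereas the unknowns of the reduction must lie in Z[W^-1] for an
    arbitrary W. The equations are therefore homogenized by a variable t, so that integer solutions
    exist; the zero vector, which homogeneity lets in, is ruled out by adding Bezout coefficients as
    unknowns. One prime with prescribed quadratic symbols is all that is wanted, so real characters
    suffice: L(1, chi) stays away from 0 because the convolution of 1 and chi is nonnegative and at
    least 1 at squares. *)

Lemma ceil_sqrt (N : nat) : (forall z : nat, (z ^ 2 != N)%N) ->
  exists X : nat, (N < X ^ 2)%N /\ forall x : nat, (x < X)%N -> (x ^ 2 < N)%N.
Proof.
move=> nsq; have ex : exists X : nat, (N < X ^ 2)%N by exists N.+1; nia.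
case: (ex_minnP ex) => X NX minX; exists X; split=> // x xX.
have := minX x; rewrite ltnNge; have := nsq x.
case: (ltngtP (x ^ 2) N)%N => // H _ /(_ isT); lia.
Qed.

Lemma modz_eq_dvdz (d x y : int) : (x %% d = y %% d)%Z -> (d %| x - y)%Z.
Proof. by move=> e; rewrite -eqz_mod_dvd; apply/eqP. Qed.

Lemma residue_ord (a : nat) (x : int) : (0 < a)%N ->
  exists i : 'I_a, (x %% a)%Z == i%:Z.
Proof.
move=> a0; have h0 : (0 <= x %% a)%Z by rewrite modz_ge0; lia.
have h1 : (x %% a < a)%Z by rewrite ltz_mod; lia.
have h : (`|x %% a|%Z < a)%N by lia.
by exists (Ordinal h) => /=; lia.
Qed.

(* A point of the box produced by the pigeonhole principle makes
   [a x^2 + b y^2 - c z^2] a multiple of [a b c] strictly between [- a b c] and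
   [2 a b c]; the value [a b c] is converted into 0 by an algebraic identity. *)
Lemma legendre_conic (a b c : nat) (ka kb kc : int) :
  (0 < a)%N -> (0 < b)%N -> (0 < c)%N ->
  coprime a b -> coprime a c -> coprime b c ->
  (forall z : nat, (z ^ 2 != a * b)%N) -> (forall z : nat, (z ^ 2 != a * c)%N) ->
  (forall z : nat, (z ^ 2 != b * c)%N) ->
  (a %| b%:Z * ka ^+ 2 - c%:Z)%Z -> (b %| a%:Z * kb ^+ 2 - c%:Z)%Z ->
  (c %| a%:Z * kc ^+ 2 + b%:Z)%Z ->
  exists x y z : int, z != 0 /\ a%:Z * x ^+ 2 + b%:Z * y ^+ 2 = c%:Z * z ^+ 2.
Proof.
move=> a0 b0 c0 cab cac cbc nab nac nbc da db dc.
have [X [X1 X2]] := ceil_sqrt nbc; have [Y [Y1 Y2]] := ceil_sqrt nac.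
have [Z [Z1 Z2]] := ceil_sqrt nab.
have XYZ : (a * b * c < X * Y * Z)%N.
  rewrite -ltn_sqr; apply: leq_trans (_ : (b * c).+1 * (a * c).+1 * (a * b).+1 <= _)%N; last first.
    by rewrite !expnMn; apply: leq_mul => //; apply: leq_mul.
  rewrite (_ : ((a * b * c) ^ 2 = b * c * (a * c) * (a * b))%N); last by ring.
  by apply: ltn_mul => //; apply: ltn_mul.
have fa x := residue_ord x a0; have fb x := residue_ord x b0.
have fc x := residue_ord x c0.
(* Two points with the same image differ by a vector (x, y, z) with a | y - ka z, b | x - kb z and c
   | x - kc y; each congruence makes the form vanish modulo one coefficient. *)
pose f (t : 'I_X * 'I_Y * 'I_Z) : 'I_a * 'I_b * 'I_c :=
  (xchoose (fa (t.1.2%:Z - ka * t.2%:Z)), xchoose (fb (t.1.1%:Z - kb * t.2%:Z)),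
   xchoose (fc (t.1.1%:Z - kc * t.1.2%:Z))).
have /injectivePn [t [u tu ftu]] : ~~ injectiveb f.
  apply/injectiveP => /leq_card; rewrite !card_prod !card_ord; lia.
move: ftu; rewrite /f => -[].
move=> /(congr1 (fun i : 'I_a => i%:Z)); rewrite -!(eqP (xchooseP (fa _))) => ea.
move=> /(congr1 (fun i : 'I_b => i%:Z)); rewrite -!(eqP (xchooseP (fb _))) => eb.
move=> /(congr1 (fun i : 'I_c => i%:Z)); rewrite -!(eqP (xchooseP (fc _))) => ec.
have {}ea := modz_eq_dvdz ea; have {}eb := modz_eq_dvdz eb; have {}ec := modz_eq_dvdz ec.
case: t u tu ea eb ec => [[x1 y1] z1] [[x2 y2] z2] /= tu ea eb ec.
pose x := x1%:Z - x2%:Z; pose y := y1%:Z - y2%:Z; pose z := z1%:Z - z2%:Z.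
have xyz : (x != 0) || (y != 0) || (z != 0).
  apply: contraNT tu; rewrite !negb_or !negbK /x /y /z !subr_eq0.
  by move=> /andP[/andP[/eqP[/val_inj->] /eqP[/val_inj->]] /eqP[/val_inj->]].
have sqb (N M : nat) (i j : 'I_M) : (forall s : nat, (s < M)%N -> (s ^ 2 < N)%N) ->
    (i%:Z - j%:Z) ^+ 2 < N%:Z :> int.
  have d : (`|i%:Z - j%:Z|%N < M)%N by have := ltn_ord i; have := ltn_ord j; clear; lia.
  move=> H.
  by have := H _ d; rewrite -abszX -ltz_nat gez0_abs // sqr_ge0.
have xb : x ^+ 2 < (b * c)%N%:Z by apply: sqb.
have yb : y ^+ 2 < (a * c)%N%:Z by apply: sqb.
have zb : z ^+ 2 < (a * b)%N%:Z by apply: sqb.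
pose v := a%:Z * x ^+ 2 + b%:Z * y ^+ 2 - c%:Z * z ^+ 2.
have va : (a %| v)%Z.
  have -> : v = a%:Z * x ^+ 2 + (b%:Z * (y + ka * z)) * (y1%:Z - ka * z1 - (y2%:Z - ka * z2))
     + z ^+ 2 * (b%:Z * ka ^+ 2 - c%:Z) by rewrite /v /x /y /z; ring.
  by rewrite !rpredD ?(dvdz_mulr _ (dvdzz _)) ?(dvdz_mull _ ea) ?(dvdz_mull _ da).
have vb : (b %| v)%Z.
  have -> : v = b%:Z * y ^+ 2 + (a%:Z * (x + kb * z)) * (x1%:Z - kb * z1 - (x2%:Z - kb * z2))
     + z ^+ 2 * (a%:Z * kb ^+ 2 - c%:Z) by rewrite /v /x /y /z; ring.
  by rewrite !rpredD ?(dvdz_mulr _ (dvdzz _)) ?(dvdz_mull _ eb) ?(dvdz_mull _ db).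
have vc : (c %| v)%Z.
  have -> : v = - (c%:Z * z ^+ 2) + (a%:Z * (x + kc * y)) * (x1%:Z - kc * y1 - (x2%:Z - kc * y2))
     + y ^+ 2 * (a%:Z * kc ^+ 2 + b%:Z) by rewrite /v /x /y /z; ring.
  by rewrite !rpredD ?rpredN ?(dvdz_mulr _ (dvdzz _)) ?(dvdz_mull _ ec) ?(dvdz_mull _ dc).
have /dvdzP[k vk] : ((a * b * c)%N %| v)%Z.
  move: va vb vc; rewrite !dvdzE !absz_nat => va vb vc.
  by rewrite !Gauss_dvd ?coprimeMl ?cac ?va ?vb.
have ax : a%:Z * x ^+ 2 < (a * b * c)%N%:Z.
  by rewrite -mulnA PoszM ltr_pM2l // ltz_nat.
have by_ : b%:Z * y ^+ 2 < (a * b * c)%N%:Z.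
  by rewrite (mulnC a) -mulnA PoszM ltr_pM2l // ltz_nat.
have cz : c%:Z * z ^+ 2 < (a * b * c)%N%:Z.
  by rewrite mulnC PoszM ltr_pM2l // ltz_nat.
have ax0 : 0 <= a%:Z * x ^+ 2 by rewrite mulr_ge0 ?sqr_ge0.
have by0 : 0 <= b%:Z * y ^+ 2 by rewrite mulr_ge0 ?sqr_ge0.
have cz0 : 0 <= c%:Z * z ^+ 2 by rewrite mulr_ge0 ?sqr_ge0.
have vlt : v < 2 * (a * b * c)%N%:Z by rewrite /v; lra.
have vgt : - (a * b * c)%N%:Z < v by rewrite /v; lra.
have : k = 0 \/ k = 1.
  have abc : 0 < (a * b * c)%N%:Z by rewrite ltz_nat !muln_gt0 a0 b0.
  rewrite vk ltr_pM2r // in vlt; rewrite vk -[X in X < _]mulN1r ltr_pM2r // in vgt.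
  by move: vlt vgt; clear; lia.
case=> k01; rewrite {}k01 ?mul0r ?mul1r in vk.
- exists x, y, z; split; last by apply/eqP; rewrite -subr_eq0 -vk.
  apply: contraTneq xyz => z0; move: vk; rewrite /v z0 => e.
  have ax1 : a%:Z * x ^+ 2 = 0 by rewrite expr0n mulr0 subr0 in e; lra.
  have by1 : b%:Z * y ^+ 2 = 0 by rewrite expr0n mulr0 subr0 in e; lra.
  move/eqP: ax1; rewrite mulf_eq0 sqrf_eq0 => /orP[|->]; first by move: a0; clear; lia.
  by move/eqP: by1; rewrite mulf_eq0 sqrf_eq0 => /orP[|->]; first by move: b0; clear; lia.
(* Here a x^2 + b y^2 = c (z^2 + a b), and a (x z + b y)^2 + b (y z - a x)^2 = (a x^2 + b y^2) (z^2
   + a b). *)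
- exists (x * z + b%:Z * y), (y * z - a%:Z * x), (z ^+ 2 + a%:Z * b%:Z); split.
    by rewrite gt_eqF // ltr_wpDl ?sqr_ge0 // mulr_gt0.
  have e : a%:Z * x ^+ 2 + b%:Z * y ^+ 2 = c%:Z * (z ^+ 2 + a%:Z * b%:Z).
    by rewrite -[LHS](subrK (c%:Z * z ^+ 2)) -/v vk !PoszM; ring.
  transitivity ((a%:Z * x ^+ 2 + b%:Z * y ^+ 2) * (z ^+ 2 + a%:Z * b%:Z)); first by ring.
  by rewrite e; ring.
Qed.

(** * The Legendre symbol and quadratic reciprocity *)

(** Euler's criterion is taken as the definition; integer values allow symbols at different primes
    to be compared. *)
Definition legendre (q n : nat) : int :=
  let a := (n%:R : 'F_q) ^+ q.-1./2 in
  if a == 0 then 0 else if a == 1 then 1 else -1.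

Lemma Fp_nat_eq0 (q n : nat) : prime q -> ((n%:R : 'F_q) == 0) = (q %| n)%N.
Proof. by move=> qp; rewrite -(dvdn_pcharf (pchar_Fp qp)). Qed.

Lemma Fp_int_eq0 (q : nat) (z : int) : prime q -> ((z%:~R : 'F_q) == 0) = (q%:Z %| z)%Z.
Proof.
move=> qp; case: (intP z) => [|n|n]; rewrite ?mulrNz ?oppr_eq0 ?dvdz0 ?eqxx //.
  by rewrite -pmulrn Fp_nat_eq0.
by rewrite dvdzE abszN -pmulrn Fp_nat_eq0.
Qed.

Lemma half_pred_odd (q : nat) : odd q -> q.-1./2.*2 = q.-1.
Proof. by case: q => // q /= oq; rewrite even_halfK. Qed.

Lemma half_pred_gt0 (q : nat) : prime q -> odd q -> (0 < q.-1./2)%N.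
Proof. by case: q => [|[|[|q]]]. Qed.

Lemma Fp_half_pow (q : nat) (a : 'F_q) : prime q -> odd q ->
  [|| a ^+ q.-1./2 == 0, a ^+ q.-1./2 == 1 | a ^+ q.-1./2 == -1].
Proof.
move=> qp oq; have [->|a0] := eqVneq a 0.
  by rewrite expr0n; case: q.-1./2 => [|k]; rewrite ?mulr1n ?mulr0n /= ?eqxx ?orbT //; rewrite eqxx orbT.
rewrite -eqf_sqr expr1n -exprM muln2 half_pred_odd // orbC.
have := finField_genPoly 'F_q; have : a ^+ q = a.
  by rewrite -[X in a ^+ X](card_Fp qp); exact: expf_card.
rewrite -[X in a ^+ X]prednK ?prime_gt0 // exprS => /(congr1 ( *%R a^-1)).
by rewrite mulKf // mulVf // => ->; rewrite eqxx.
Qed.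

Lemma legendreE (q n : nat) : prime q -> odd q ->
  (legendre q n)%:~R = (n%:R : 'F_q) ^+ q.-1./2.
Proof.
move=> qp oq; have := Fp_half_pow n%:R qp oq; rewrite /legendre.
by case: eqP => [->//|_]; case: eqP => [->//|_] /= /eqP ->.
Qed.

Lemma legendre_val (q n : nat) : [\/ legendre q n = 0, legendre q n = 1 | legendre q n = -1].
Proof.
by rewrite /legendre; case: eqP => _; [exact: Or31 | case: eqP => _; [exact: Or32 | exact: Or33]].
Qed.

(** 0, 1 and -1 remain distinct in odd characteristic, so an identity between symbols may be checked
    after mapping it into a field. *)
Lemma sign_inj (q : nat) (F : fieldType) (x y : int) : q \in [pchar F] -> odd q ->
  [\/ x = 0, x = 1 | x = -1] -> [\/ y = 0, y = 1 | y = -1] ->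
  x%:~R = y%:~R :> F -> x = y.
Proof.
move=> qF oq vx vy /eqP; rewrite -subr_eq0 -rmorphB /= => e.
have [qp q0] := andP qF.
have n2 : (2%:R : F) != 0.
  rewrite -(dvdn_pcharf qF); apply: contraL oq; rewrite dvdn_prime2 //.
  by move=> /eqP ->.
have n1 : (1 : F) != 0 := oner_neq0 F.
move: e; case: vx => ->; case: vy => -> //=.
- by rewrite sub0r mulrNz oppr_eq0 (negPf n1).
- by rewrite sub0r opprK (negPf n1).
- by rewrite subr0 (negPf n1).
- by rewrite opprK (negPf n2).
- by rewrite subr0 mulrNz oppr_eq0 (negPf n1).
- by rewrite -opprD mulrNz oppr_eq0 (negPf n2).
Qed.

Lemma Fp_sign_inj (q : nat) (x y : int) : prime q -> odd q ->
  [\/ x = 0, x = 1 | x = -1] -> [\/ y = 0, y = 1 | y = -1] ->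
  x%:~R = y%:~R :> 'F_q -> x = y.
Proof. by move=> qp oq; apply: (sign_inj (pchar_Fp qp)). Qed.

Lemma sign_valM (x y : int) : [\/ x = 0, x = 1 | x = -1] -> [\/ y = 0, y = 1 | y = -1] ->
  [\/ x * y = 0, x * y = 1 | x * y = -1].
Proof. by case=> ->; case=> ->; rewrite ?mul0r ?mulr0 ?mul1r ?mulr1 ?mulrNN; auto using Or31, Or32, Or33. Qed.

Lemma legendreM (q m n : nat) : prime q -> odd q ->
  legendre q (m * n) = legendre q m * legendre q n.
Proof.
move=> qp oq; apply: (@Fp_sign_inj q) => //; first exact: legendre_val.
  by apply: sign_valM; apply: legendre_val.
by rewrite rmorphM /= !legendreE // natrM exprMn.
Qed.

Lemma legendre_mod (q m n : nat) : prime q -> m = n %[mod q] -> legendre q m = legendre q n.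
Proof. by move=> qp e; rewrite /legendre -(Fp_nat_mod qp m) e Fp_nat_mod. Qed.

Lemma legendre_eq0 (q n : nat) : prime q -> odd q -> (legendre q n == 0) = (q %| n)%N.
Proof.
move=> qp oq; have q1 := half_pred_gt0 qp oq.
rewrite -Fp_nat_eq0 // /legendre expf_eq0 q1 /=.
by do 2?case: ifP.
Qed.

Lemma legendre_sq (q n : nat) : prime q -> odd q -> ~~ (q %| n)%N -> legendre q (n * n) = 1.
Proof.
move=> qp oq; rewrite -legendre_eq0 // legendreM //.
by case: (legendre_val q n) => ->.
Qed.

Lemma legendre1 (q : nat) : prime q -> odd q -> legendre q 1 = 1.
Proof.
by move=> qp oq; rewrite (@legendre_sq q 1) // dvdn1 gtn_eqF ?prime_gt1.
Qed.

(** The unit group is cyclic of order q - 1, so an element killed by (q - 1) / 2 is an even power of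
    a generator. *)
Lemma Fp_half_pow1 (q : nat) (a : 'F_q) : prime q -> odd q ->
  a ^+ q.-1./2 = 1 -> exists k : 'F_q, a = k ^+ 2.
Proof.
move=> qp oq ah; have [g gP] := cyclicP (field_unit_group_cyclic [set: {unit 'F_q}]).
have a0 : a \is a GRing.unit.
  rewrite unitfE; apply/eqP => a0; move/eqP: ah.
  by rewrite a0 expr0n gtn_eqF ?half_pred_gt0 // eq_sym oner_eq0.
pose u := FinRing.unit 'F_q a0; have : u \in [set: {unit 'F_q}] by rewrite inE.
rewrite gP => /cycleP[k uk].
have ordg : #[g]%g = q.-1 by rewrite orderE -gP card_finField_unit card_Fp.
have : (u ^+ q.-1./2 = 1)%g by apply/val_inj; rewrite FinRing.val_unitX /= ah.
rewrite uk -expgM => /eqP; rewrite -order_dvdn ordg -{1}(half_pred_odd oq) -mul2n dvdn_pmul2r ?half_pred_gt0 //.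
move=> /dvdnP[j kj]; exists (val (g ^+ j)%g).
by rewrite -FinRing.val_unitX -expgM -kj -uk.
Qed.

(** The polynomial X^((q - 1) / 2) - 1 has too few roots to kill all q - 1 units. *)
Lemma Fp_nonresidue (q : nat) : prime q -> odd q -> exists n : nat, legendre q n = -1.
Proof.
move=> qp oq; have q2 := prime_gt1 qp.
have [a ha] : exists a : 'F_q, (a != 0) && (a ^+ q.-1./2 != 1).
  apply/existsP; rewrite -[X in is_true X]negbK negb_exists; apply/negP => /forallP H.
  have h0 := half_pred_gt0 qp oq.
  pose s := [seq x <- enum 'F_q | x != 0].
  have : (size s < size ('X^(q.-1./2) - 1%:P : {poly 'F_q})%R)%N.
    apply: max_poly_roots; first by rewrite -size_poly_gt0 size_XnsubC.
      apply/allP => x; rewrite mem_filter => /andP[x0 _].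
      rewrite rootE !hornerE subr_eq0; by move: (H x); rewrite x0 /= negbK.
    by rewrite filter_uniq ?enum_uniq.
  have -> : size s = q.-1.
    have := cardC1 (0 : 'F_q); rewrite card_Fp // cardE => <-.
    by rewrite /s enumT.
  by rewrite size_XnsubC // -[X in (X < _)%N](half_pred_odd oq); lia.
exists (val a); rewrite /legendre.
have -> : ((val a)%:R : 'F_q) = a by rewrite natr_Zp.
move: ha => /andP[a0 /negPf ->].
by rewrite expf_eq0 (negPf a0) andbF.
Qed.

Lemma pchar_int_eq0 (q : nat) (F : fieldType) (z : int) : q \in [pchar F] ->
  (q%:Z %| z)%Z -> z%:~R = 0 :> F.
Proof.
move=> qF /dvdzP[k ->]; rewrite intrM -[(Posz q)%:~R]/(q%:R : F).
by rewrite (pcharf0 qF) mulr0.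
Qed.

Lemma legendre_lift (q n : nat) (F : fieldType) : prime q -> odd q -> q \in [pchar F] ->
  (legendre q n)%:~R = n%:R ^+ q.-1./2 :> F.
Proof.
move=> qp oq qF; apply/eqP; rewrite -subr_eq0 -[n%:R]/((n%:Z)%:~R : F) -rmorphXn -rmorphB /=.
apply/eqP; apply: (pchar_int_eq0 qF).
by rewrite -Fp_int_eq0 // rmorphB rmorphXn /= legendreE // -pmulrn subrr.
Qed.

(** By Fermat r divides q^(r-1) - 1, the order of the cyclic unit group of the field with q^(r-1)
    elements. *)
Lemma root_of_unity_pchar (q r : nat) : prime q -> prime r -> q != r ->
  exists (F : finFieldType) (z : F), [/\ q \in [pchar F], z ^+ r = 1 & z != 1].
Proof.
move=> qp rp qr; have r1 : (0 < r.-1)%N by have := prime_gt1 rp; case: r {rp qr} => [|[]].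
have [F Fq cF] := PrimePowerField qp r1.
have [g gP] := cyclicP (field_unit_group_cyclic [set: {unit F}]).
have rd : (r %| #[g]%g)%N.
  rewrite orderE -gP card_finField_unit cF -subn1 -eqn_mod_dvd ?expn_gt0 ?prime_gt0 //.
  rewrite -totient_prime //; apply/eqP; rewrite Euler_exp_totient // prime_coprime //.
  by rewrite dvdn_prime2.
pose u := (g ^+ (#[g] %/ r))%g; exists F, (val u); split=> //.
  by rewrite -FinRing.val_unitX /u -expgM divnK // expg_order.
have : (u != 1)%g.
  apply/eqP => u1; have gr : (#[g]%g %| #[g]%g %/ r)%N by rewrite order_dvdn -/u u1.
  have g0 := order_gt0 g; have r2 := prime_gt1 rp.
  have : (#[g]%g <= #[g]%g %/ r)%N.
    by apply: dvdn_leq gr; rewrite divn_gt0 ?(dvdn_leq g0 rd) ?prime_gt0.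
  by rewrite leqNgt ltn_Pdiv.
by apply: contra => /eqP e; apply/eqP/val_inj.
Qed.

Lemma legendreN1 (r : nat) : prime r -> (r %% 4 = 1)%N -> legendre r r.-1 = 1.
Proof.
move=> rp r4; have or : odd r by lia.
apply: (@Fp_sign_inj r) => //; [exact: legendre_val | exact: Or32 |].
rewrite legendreE //; have -> : (r.-1%:R : 'F_r) = -1.
  by apply/eqP; rewrite -subr_eq0 opprK natr1 prednK ?prime_gt0 // Fp_nat_eq0.
by rewrite -signr_odd (_ : odd _ = false) //; lia.
Qed.

(** * Quadratic Gauss sums over a field with a nontrivial r-th root of unity *)

Section GaussSum.
Variables (r : nat) (F : fieldType) (z : F).
Hypotheses (rp : prime r) (ro : odd r) (zr : z ^+ r = 1) (z1 : z != 1).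

Let e (i : 'F_r) : F := z ^+ i.
Let chi (i : 'F_r) : F := (legendre r i)%:~R.

Lemma Fp_valM (i j : 'F_r) : (i * j)%R = (i * j)%N %[mod r].
Proof. by rewrite /=; move: (nat_of_ord i) (nat_of_ord j) => a b; rewrite Fp_cast // modn_mod. Qed.

Lemma Fp_valD (i j : 'F_r) : (i + j)%R = (i + j)%N %[mod r].
Proof. by rewrite /=; move: (nat_of_ord i) (nat_of_ord j) => a b; rewrite Fp_cast // modn_mod. Qed.

Lemma gauss_eD i j : e (i + j) = e i * e j.
Proof. by rewrite /e -exprD -(expr_mod _ zr) Fp_valD (expr_mod _ zr). Qed.

Lemma gauss_eM i j : e (i * j) = e i ^+ j.
Proof. by rewrite /e -exprM -(expr_mod _ zr) Fp_valM (expr_mod _ zr). Qed.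

Lemma gauss_chiM i j : chi (i * j) = chi i * chi j.
Proof. by rewrite /chi (legendre_mod rp (Fp_valM i j)) legendreM // intrM. Qed.

Lemma gauss_chi0 : chi 0 = 0.
Proof. by rewrite /chi; have := legendre_eq0 0 rp ro; rewrite dvdn0 => /eqP ->. Qed.

Lemma gauss_chi_sq i : i != 0 -> chi i * chi i = 1.
Proof.
move=> i0; rewrite -intrM -legendreM // legendre_sq //.
by rewrite -Fp_nat_eq0 // natr_Zp.
Qed.

Lemma gauss_sum_e c : \sum_i e (i * c) = if c == 0 then r%:R else 0.
Proof.
case: eqP => [->|/eqP c0].
  under eq_bigr do rewrite mulr0 /e expr0.
  by rewrite sumr_const card_Fp.
have -> : \sum_i e (i * c) = \sum_i e i.
  by rewrite [RHS](reindex_inj (mulIf c0)).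
apply/eqP; have : (\sum_i e i) * (e 1 - 1) == 0.
  rewrite mulrBr mulr1 subr_eq0 {2}(reindex_inj (addIr 1)) /= mulr_suml.
  by apply/eqP/eq_bigr => i _; rewrite gauss_eD.
rewrite mulf_eq0 => /orP[//|]; rewrite /e subr_eq0 => /eqP e1.
by case/negP: z1; rewrite -e1 /= modn_small ?expr1.
Qed.

(** Multiplication by a nonresidue changes the sign of the sum. The argument runs in the integers,
    where S = - S gives S = 0, and is then mapped to F. *)
Lemma gauss_sum_chi : \sum_i chi i = 0.
Proof.
have [n nP] := Fp_nonresidue rp ro.
have n0 : n%:R != 0 :> 'F_r by rewrite Fp_nat_eq0 // -legendre_eq0 // nP.
rewrite /chi -rmorph_sum /=; have [] : \sum_(i : 'F_r) legendre r i = 0; last by move=> ->.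
have : \sum_(i : 'F_r) legendre r i = - \sum_(i : 'F_r) legendre r i; last by lia.
rewrite {1}(reindex_inj (mulIf n0)) /= -mulN1r mulr_sumr; apply: eq_bigr => i _.
rewrite (legendre_mod rp (Fp_valM i n%:R)) legendreM // mulrC.
by rewrite (@legendre_mod r (n%:R : 'F_r) n) ?nP //= val_Fp_nat // modn_mod.
Qed.

Definition gauss_sum : F := \sum_i chi i * e i.

(** Writing the second index as i k leaves chi(k) e(i (1 + k)). Orthogonality retains only k = -1,
    which contributes r chi(-1) = r; the terms for i = 0, put back to complete the inner sums, add
    up to the sum of chi, which is 0. *)
Lemma gauss_sum_sqr : (r %% 4 = 1)%N -> gauss_sum ^+ 2 = r%:R.
Proof.
move=> r4; have -> : gauss_sum ^+ 2 = \sum_(i | i != 0) \sum_k chi k * e (i * (1 + k)).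
  rewrite expr2 {1}/gauss_sum mulr_suml (bigD1 0) //= gauss_chi0 !mul0r add0r.
  apply: eq_bigr => i i0; rewrite /gauss_sum (reindex_inj (mulfI i0)) /= mulr_sumr.
  apply: eq_bigr => k _; rewrite gauss_chiM mulrDr mulr1 gauss_eD.
  by rewrite -[RHS]mul1r -(gauss_chi_sq i0); ring.
rewrite exchange_big /=.
have -> : r%:R = \sum_k chi k * (\sum_i e (i * (1 + k)) - 1).
  under [RHS]eq_bigr do rewrite mulrBr mulr1.
  rewrite big_split /= sumrN gauss_sum_chi subr0 (bigD1 (-1)) //= subrr gauss_sum_e eqxx.
  rewrite big1 => [|k kN1]; last first.
    by rewrite gauss_sum_e addrC -[1]opprK subr_eq0 (negPf kN1) mulr0.
  rewrite addr0 /chi (@legendre_mod r _ r.-1) ?legendreN1 ?mul1r //.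
  suff -> : -1 = r.-1%:R :> 'F_r by rewrite val_Fp_nat // modn_mod.
  by apply/eqP; rewrite eq_sym -subr_eq0 opprK natr1 prednK ?prime_gt0 // Fp_nat_eq0.
apply: eq_bigr => k _; rewrite -mulr_sumr; congr (_ * _).
have e0 : e 0 = 1 by rewrite /e expr0.
by rewrite [in RHS](bigD1 0) //= mul0r e0 addrAC subrr add0r.
Qed.

Lemma gauss_sum_frob (q : nat) : q \in [pchar F] -> odd q -> ~~ (r %| q)%N ->
  gauss_sum ^+ q = (legendre r q)%:~R * gauss_sum.
Proof.
move=> qF oq rq; have q0 : (q%:R : 'F_r) != 0 by rewrite Fp_nat_eq0.
have -> : gauss_sum ^+ q = \sum_i (chi i * e i) ^+ q.
  by have := rmorph_sum (pFrobenius_aut qF) (index_enum 'F_r) predT (fun i => chi i * e i).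
have chiq : chi q%:R = (legendre r q)%:~R.
  by rewrite /chi (@legendre_mod r (q%:R : 'F_r) q) //= val_Fp_nat // modn_mod.
rewrite /gauss_sum [in RHS](reindex_inj (mulIf q0)) /= mulr_sumr; apply: eq_bigr => i _.
rewrite gauss_chiM -chiq mulrA mulrCA gauss_chi_sq // mulr1 exprMn.
congr (_ * _).
  rewrite /chi; case: (legendre_val r i) => ->; rewrite ?expr1n // ?expr0n.
    by rewrite gtn_eqF ?odd_gt0.
  by rewrite -signr_odd oq.
by rewrite gauss_eM -(expr_mod _ (_ : (e i) ^+ r = 1)) ?val_Fp_nat // ?modn_mod ?expr_mod // /e -exprM mulnC exprM zr expr1n.
Qed.
End GaussSum.

(* For r = 1 mod 4, the Gauss sum squares to r; raising it to the power q by
   Frobenius multiplies it by (q / r), and by Euler's criterion by (r / q). *)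
Lemma quadratic_reciprocity (q r : nat) : prime q -> prime r -> odd q -> (r %% 4 = 1)%N ->
  q != r -> legendre r q = legendre q r.
Proof.
move=> qp rp oq r4 qr; have ro : odd r by lia.
have [F [z [qF zr z1]]] := root_of_unity_pchar qp rp qr.
have rq : ~~ (r %| q)%N by rewrite dvdn_prime2 // eq_sym.
apply: (sign_inj qF oq (legendre_val _ _) (legendre_val _ _)).
have g2 := gauss_sum_sqr rp ro zr z1 r4.
have g0 : gauss_sum r z != 0.
  rewrite -sqrf_eq0 g2 -(dvdn_pcharf qF) dvdn_prime2 //.
apply: (mulIf g0); rewrite -(gauss_sum_frob rp ro zr qF oq rq) legendre_lift // -g2 -exprM.
by rewrite -exprSr mul2n half_pred_odd // prednK ?prime_gt0.
Qed.

(** * Primes with prescribed quadratic symbols *)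

(** Summation by parts: since the weights decrease, the bounds M (w i - w (i + 1)) telescope to M (w
    0). *)
Lemma abel_bound (R : realFieldType) (f w : nat -> R) (M : R) (n : nat) :
  (forall m, `|\sum_(i < m) f i| <= M) -> (forall i, 0 <= w i) ->
  (forall i, w i.+1 <= w i) -> `|\sum_(i < n) f i * w i| <= M * w 0%N.
Proof.
move=> fM w0 wd; pose A m := \sum_(i < m) f i.
have -> : \sum_(i < n) f i * w i = A n * w n + \sum_(i < n) A i.+1 * (w i - w i.+1).
  elim: n => [|n IH]; first by rewrite /A !big_ord0 mul0r add0r.
  by rewrite !big_ord_recr /= IH /A !big_ord_recr /=; ring.
have -> : M * w 0%N = M * w n + \sum_(i < n) M * (w i - w i.+1).
  by elim: n => [|n IH]; rewrite ?big_ord0 ?addr0 // big_ord_recr /= addrA [in RHS]addrAC; rewrite IH; ring.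
apply: le_trans (ler_normD _ _) (lerD _ _).
  by rewrite normrM (ger0_norm (w0 n)) ler_wpM2r ?w0 ?fM.
apply: le_trans (ler_norm_sum _ _ _) (ler_sum _ _) => i _.
by rewrite normrM (ger0_norm (_ : 0 <= w i - _)) ?subr_ge0 // ler_wpM2r ?subr_ge0 ?wd ?fM.
Qed.

(** Any M consecutive terms add up to 0, so whole periods can be removed until fewer than M terms
    remain. *)
Lemma periodic_sum_bound (R : realFieldType) (f : nat -> R) (M : nat) (a n : nat) :
  (0 < M)%N -> (forall i, f (i + M)%N = f i) -> (forall i, `|f i| <= 1) ->
  \sum_(i < M) f i = 0 -> `|\sum_(i < n) f (a + i)%N| <= M%:R.
Proof.
move=> M0 per f1 s0.
have perio b : \sum_(i < M) f (b + i)%N = 0.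
  elim: b => // b; case: M M0 per {s0} => // M _ per e.
  rewrite -[RHS]e; rewrite [LHS]big_ord_recr [RHS]big_ord_recl /= addrC; congr (_ + _).
    by rewrite addn0 -(per b); congr f; lia.
  by apply: eq_bigr => i _; congr f; rewrite /bump; lia.
elim/ltn_ind: n a => n IH a; case: (ltnP n M) => nM.
  apply: le_trans (ler_norm_sum _ _ _) _.
  apply: (@le_trans _ _ (\sum_(i < n) 1)); first by apply: ler_sum => i _.
  by rewrite sumr_const card_ord ler_nat ltnW.
rewrite -(subnKC nM) big_split_ord /= perio add0r.
under eq_bigr do rewrite addnA.
by apply: IH; rewrite ltn_subrL M0 (leq_trans M0).
Qed.

(** * Elementary estimates for the logarithm *)

Section Sums.
Variable R : realType.
Implicit Types (n N K d x y : nat).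

Lemma ln_nat_ge0 n : 0 <= ln (n%:R : R).
Proof. by case: n => [|n]; [rewrite ln0 | rewrite ln_ge0 // ler1n]. Qed.

Lemma ln_le_subr1 (t : R) : 0 < t -> ln t <= t - 1.
Proof. by move=> t0; have := @le_ln1Dx R (t - 1); rewrite addrCA subrr addr0; apply; lra. Qed.

Lemma ln2_ge : 1 / 2 <= ln (2 : R).
Proof.
have := @ln_le_subr1 (2^-1); rewrite lnV ?posrE // invr_gt0 ltr0n => /(_ isT); lra.
Qed.

Lemma ln2_le1 : ln (2 : R) <= 1.
Proof. by have := @ln_le_subr1 2; lra. Qed.

(** The quotient decreases once ln n >= 1; the threshold 4 is where this follows from ln 4 = 2 ln 2
    and [ln2_ge]. *)
Lemma ln_div_decr n : (3 < n)%N -> ln (n.+1%:R : R) / n.+1%:R <= ln n%:R / n%:R.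
Proof.
move=> n3; have n0 : 0 < n%:R :> R by rewrite ltr0n; apply: leq_trans n3.
have l1 : 1 <= ln (n%:R : R).
  apply: le_trans (_ : ln (2 * 2) <= _); first by rewrite lnM ?posrE //; have := ln2_ge; lra.
  have n4 : 4%:R <= n%:R :> R by rewrite ler_nat.
  by rewrite ler_ln ?posrE //; lra.
have l2 : ln (n.+1%:R : R) <= ln n%:R + n%:R^-1.
  have -> : n.+1%:R = n%:R * (1 + n%:R^-1) :> R by rewrite mulrDr mulr1 divff ?gt_eqF // natr1.
  have n1 : 0 < n%:R^-1 :> R by rewrite invr_gt0.
  rewrite lnM ?posrE //; last lra.
  by rewrite lerD2l; have := @ln_le_subr1 (1 + n%:R^-1); lra.
rewrite ler_pdivrMr ?ltr0n // mulrAC ler_pdivlMr //.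
apply: le_trans (ler_wpM2r (ltW n0) l2) _.
by rewrite mulrDl mulVf ?gt_eqF // -natr1 mulrDr mulr1 lerD2l.
Qed.

End Sums.

Lemma sum_multiples (V : zmodType) (F : nat -> V) (d N : nat) : (0 < d)%N ->
  \sum_(1 <= n < N.+1 | (d %| n)%N) F n = \sum_(1 <= k < (N %/ d).+1) F (d * k)%N.
Proof.
move=> d0; elim: N => [|N IH]; first by rewrite div0n !big_geq.
rewrite big_mkcond big_nat_recr //= -big_mkcond /= IH divnS //.
case: ifP => dN; last by rewrite addr0.
rewrite add1n [RHS]big_nat_recr //=; congr (_ + F _).
by have := divnS N d0; rewrite dN add1n => <-; rewrite mulnC divnK.
Qed.

Lemma divisor_swap (V : zmodType) (G : nat -> nat -> V) (N : nat) :
  \sum_(1 <= n < N.+1) \sum_(1 <= d < N.+1 | (d %| n)%N) G d n =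
  \sum_(1 <= d < N.+1) \sum_(1 <= k < (N %/ d).+1) G d (d * k)%N.
Proof.
rewrite (exchange_big_dep predT) //= !big_nat; apply: eq_bigr => d /andP[d0 _].
exact: sum_multiples.
Qed.

(** * The von Mangoldt function and Chebyshev's bound *)

Section Mangoldt.
Variable R : realType.
Implicit Types (n N K d x y : nat).

(** The von Mangoldt function: n is p^k for at most one pair (p, k) with p prime and k positive, and
    then k <= n since k < p^k. *)
Definition mangoldt n : R :=
  \sum_(1 <= p < n.+1 | prime p) \sum_(1 <= k < n.+1 | (p ^ k)%N == n) ln p%:R.

Lemma mangoldt_ge0 n : 0 <= mangoldt n.
Proof. by apply: sumr_ge0 => p _; apply: sumr_ge0 => k _; exact: ln_nat_ge0. Qed.

Lemma mangoldt_eq0 n : (forall p k, prime p -> (0 < k)%N -> n != (p ^ k)%N) -> mangoldt n = 0.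
Proof.
move=> H; rewrite /mangoldt big1 // => p pp; rewrite big_nat_cond big1 //.
by move=> k /andP[/andP[k0 _]]; rewrite eq_sym (negPf (H _ _ pp k0)).
Qed.

Lemma mangoldt_widen n N : (n <= N)%N ->
  mangoldt n = \sum_(1 <= p < N.+1 | prime p) \sum_(1 <= k < N.+1 | (p ^ k)%N == n) ln p%:R.
Proof.
move=> nN; rewrite /mangoldt.
rewrite [RHS](@big_cat_nat _ _ _ n.+1) //= [X in _ = _ + X]big_nat_cond [X in _ = _ + X]big1 ?addr0; last first.
  move=> p /andP[/andP[np _] pp]; rewrite big_nat_cond big1 // => k /andP[/andP[k0 _] /eqP e].
  move: np; rewrite ltnNge -{1}e -{1}(expn1 p).
  by rewrite leq_exp2l ?prime_gt1 // k0.
apply: eq_bigr => p pp; rewrite [RHS](@big_cat_nat _ _ _ n.+1) //=.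
rewrite [X in _ = _ + X]big_nat_cond [X in _ = _ + X]big1 ?addr0 // => k /andP[/andP[nk _] /eqP e].
by have := ltn_expl k (prime_gt1 pp); rewrite e ltnNge (ltnW nk).
Qed.

Lemma ln_prime_factors n : (0 < n)%N ->
  ln n%:R = \sum_(1 <= p < n.+1 | prime p) (logn p n)%:R * ln p%:R :> R.
Proof.
move=> n0; rewrite -{1}(partnT n0) /partn.
have -> : (\prod_(0 <= p < n.+1 | p \in predT) p ^ logn p n = \prod_(1 <= p < n.+1 | prime p) p ^ logn p n)%N.
  rewrite big_ltn //= (lognE 0) /= expn0 mul1n big_mkcond /= [RHS]big_mkcond /=.
  by apply: eq_bigr => p _; case: ifP => // np; rewrite lognE np.
rewrite big_nat_cond [in RHS]big_nat_cond.
have : forall s : seq nat, ln (\prod_(p <- s | (1 <= p < n.+1)%N && prime p) p ^ logn p n)%N%:R = \sum_(p <- s | (1 <= p < n.+1)%N && prime p) (logn p n)%:R * ln p%:R :> R; last exact.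
elim=> [|p s IH]; first by rewrite !big_nil ln1.
rewrite !big_cons; case: ifP => // /andP[/andP[p0 _] pp].
rewrite natrM lnM ?posrE ?IH ?natrX ?lnXn ?ltr0n ?mulr_natl //.
  by rewrite exprn_gt0 ?ltr0n.
by apply: prodn_cond_gt0 => q /andP[_ /prime_gt0]; rewrite expn_gt0 => ->.
Qed.

(** Unique factorization in logarithmic form: p contributes ln p once for each power p^k dividing n,
    with k from 1 to the valuation. *)
Lemma sum_mangoldt_dvd n N : (0 < n <= N)%N ->
  \sum_(1 <= d < N.+1 | (d %| n)%N) mangoldt d = ln n%:R.
Proof.
move=> /andP[n0 nN].
transitivity (\sum_(1 <= d < N.+1 | (d %| n)%N) \sum_(1 <= p < N.+1 | prime p)
    \sum_(1 <= k < N.+1) if (p ^ k)%N == d then ln p%:R else 0 : R).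
  rewrite big_nat_cond [RHS]big_nat_cond; apply: eq_bigr => d /andP[/andP[_ dN] _].
  rewrite (mangoldt_widen (N := N)) //; apply: eq_bigr => p _; exact: big_mkcond.
rewrite exchange_big /= ln_prime_factors //.
rewrite [RHS](_ : _ = \sum_(1 <= p < N.+1 | prime p) (logn p n)%:R * ln p%:R); last first.
  rewrite [RHS](@big_cat_nat _ _ _ n.+1) //= [X in _ = _ + X]big_nat_cond [X in _ = _ + X]big1 ?addr0 //.
  move=> p /andP[/andP[np _] pp]; rewrite (_ : logn p n = 0%N) ?mul0r //.
  by apply/eqP; rewrite -leqn0 leqNgt logn_gt0 mem_primes pp n0 /= gtnNdvd.
apply: eq_bigr => p pp; rewrite exchange_big /=.
have vN : (logn p n <= N)%N by rewrite ltnW // (leq_trans (ltn_logl p n0)).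
transitivity (\sum_(1 <= k < N.+1) if (k <= logn p n)%N then ln p%:R else 0 : R).
  apply: eq_bigr => k _; rewrite -big_mkcondr -(pfactor_dvdn _ pp n0).
  case: ifP => pk; last first.
    rewrite big1 // => d /andP[dn /eqP e]; by rewrite e dn in pk.
  have pkN : (p ^ k)%N \in index_iota 1 N.+1.
    by rewrite mem_index_iota expn_gt0 prime_gt0 //= ltnS (leq_trans (dvdn_leq n0 pk)).
  rewrite big_mkcond (bigD1_seq _ pkN (iota_uniq _ _)) /= pk eqxx big1 ?addr0 //.
  by move=> d; rewrite eq_sym => /negPf ->; rewrite andbF.
rewrite (@big_cat_nat _ _ _ (logn p n).+1) //= [X in _ + X]big_nat_cond [X in _ + X]big1 ?addr0.
  rewrite big_nat_cond (eq_bigr (fun=> ln p%:R)); last first.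
    by move=> k /andP[/andP[_ kv] _]; rewrite -ltnS kv.
  by rewrite -big_nat_cond sumr_const_nat subSS subn0 mulr_natl.
by move=> k /andP[/andP[vk _] _]; rewrite leqNgt vk.
Qed.

Lemma mangoldt_le_ln n : mangoldt n <= ln n%:R.
Proof.
case: n => [|n]; first by rewrite /mangoldt big_geq // ln_nat_ge0.
rewrite -(@sum_mangoldt_dvd n.+1 n.+1) ?leqnn //.
have n1 : n.+1 \in index_iota 1 n.+2 by rewrite mem_index_iota /=.
rewrite big_mkcond (bigD1_seq _ n1 (iota_uniq _ _)) /= dvdnn lerDl sumr_ge0 // => d _.
by case: ifP => _ //; exact: mangoldt_ge0.
Qed.

(* The arithmetic form of [-L'/L = sum chi(n) Lambda(n) n^-s]. *)
Lemma sum_mul_ln (chi : nat -> R) (N : nat) : (forall m n, chi (m * n)%N = chi m * chi n) ->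
  \sum_(1 <= n < N.+1) chi n * ln n%:R =
  \sum_(1 <= d < N.+1) chi d * mangoldt d * \sum_(1 <= k < (N %/ d).+1) chi k.
Proof.
move=> chiM.
transitivity (\sum_(1 <= n < N.+1) \sum_(1 <= d < N.+1 | (d %| n)%N) chi n * mangoldt d).
  by rewrite !big_nat; apply: eq_bigr => n nN; rewrite -mulr_sumr sum_mangoldt_dvd.
rewrite (divisor_swap (fun d n => chi n * mangoldt d)); apply: eq_bigr => d _.
by rewrite mulr_sumr; apply: eq_bigr => k _; rewrite chiM mulrAC.
Qed.

Definition chebyshev_psi N : R := \sum_(1 <= d < N.+1) mangoldt d.

Definition ln_fact N : R := \sum_(1 <= n < N.+1) ln n%:R.

Lemma ln_factE N : ln_fact N = \sum_(1 <= d < N.+1) mangoldt d * (N %/ d)%:R.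
Proof.
transitivity (\sum_(1 <= n < N.+1) 1 * ln n%:R : R).
  by apply: eq_bigr => n _; rewrite mul1r.
rewrite (@sum_mul_ln (fun=> 1) N) => [|m n]; last by rewrite mulr1.
by apply: eq_bigr => d _; rewrite mul1r sumr_const_nat subSS subn0.
Qed.

(** The logarithm of the central binomial coefficient is at most 2 n: each step multiplies (2n)! /
    n!^2 by at most 4, and 2 ln 2 <= 2. *)
Lemma ln_fact_double n : ln_fact n.*2 <= 2 * ln_fact n + n.*2%:R.
Proof.
elim: n => [|n IH]; first by rewrite /ln_fact !big_geq // mulr0 addr0.
rewrite /ln_fact in IH; rewrite doubleS /ln_fact (big_nat_recr n.*2.+2) //= (big_nat_recr n.*2.+1) //= (big_nat_recr n.+1) //=.
have l1 : ln n.*2.+1%:R <= ln n.*2.+2%:R :> R by rewrite ler_ln ?posrE ?ltr0n // ler_nat.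
have l2 : ln n.*2.+2%:R = ln 2 + ln n.+1%:R :> R.
  by rewrite -doubleS -mul2n natrM lnM ?posrE ?ltr0n.
have l3 := ln2_le1 R.
have e : n.*2.+2%:R = n.*2%:R + 2 :> R by rewrite -natrD addn2.
rewrite [X in _ <= _ + X]e; lra.
Qed.

(** Chebyshev's argument: floor(2n/d) - 2 floor(n/d) is never negative and is at least 1 for n < d
    <= 2n, so psi(2n) - psi(n) is at most ln (2n)! - 2 ln n!. *)
Lemma psi_double n : chebyshev_psi n.*2 <= chebyshev_psi n + n.*2%:R.
Proof.
have := ln_fact_double n; rewrite !ln_factE => H.
have e : \sum_(1 <= d < n.+1) mangoldt d * (n %/ d)%:R =
    \sum_(1 <= d < n.*2.+1) mangoldt d * (n %/ d)%:R.
  rewrite [RHS](@big_cat_nat _ _ _ n.+1) //= ?ltnS -?addnn ?leq_addr //.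
  rewrite [X in _ = _ + X]big_nat_cond [X in _ = _ + X]big1 ?addr0 //.
  by move=> d /andP[/andP[nd _] _]; rewrite divn_small ?mulr0.
suff : chebyshev_psi n.*2 - chebyshev_psi n <=
   \sum_(1 <= d < n.*2.+1) mangoldt d * (n.*2 %/ d)%:R - 2 * \sum_(1 <= d < n.+1) mangoldt d * (n %/ d)%:R.
  by lra.
rewrite e mulr_sumr -sumrB {1}/chebyshev_psi (@big_cat_nat _ _ _ n.+1) //= ?ltnS -?addnn ?leq_addr //.
rewrite addrAC subrr add0r [leRHS](@big_cat_nat _ _ _ n.+1) //= ?ltnS ?leq_addr //.
have term d : 0 <= mangoldt d * ((n + n) %/ d)%:R - 2 * (mangoldt d * (n %/ d)%:R).
  rewrite mulrCA -mulrBr mulr_ge0 ?mangoldt_ge0 // -natrM subr_ge0 ler_nat mul2n -addnn.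
  case: (posnP d) => [->|d0]; first by rewrite !divn0.
  by rewrite leq_divRL // mulnDl leq_add // leq_trunc_div.
rewrite ler_wpDl ?sumr_ge0 // big_nat_cond [leRHS]big_nat_cond.
apply: ler_sum => d /andP[/andP[nd d2] _]; rewrite (divn_small nd) mulr0 mulr0 subr0.
rewrite ler_peMr ?mangoldt_ge0 // ler1n divn_gt0 //; exact: leq_trans nd.
Qed.

(** Repeated halving; the constant 4 leaves room for odd N, where one more term, at most ln N <= N -
    1, is added. *)
Lemma psi_le N : chebyshev_psi N <= 4 * N%:R.
Proof.
elim/ltn_ind: N => N IH; case: (posnP N) => [->|N0].
  by rewrite /chebyshev_psi big_geq // mulr0.
have hN : (N./2 < N)%N by rewrite -divn2 ltn_Pdiv.
have IHh := IH _ hN; have dbl := psi_double N./2.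
have e : N%:R = (odd N)%:R + N./2.*2%:R :> R by rewrite -natrD odd_double_half.
have e2 : N./2.*2%:R = 2 * N./2%:R :> R by rewrite -mul2n natrM.
have h0 : 0 <= N./2%:R :> R by rewrite ler0n.
have [oN|eN] := boolP (odd N); last first.
  by rewrite -(odd_double_half N) (negPf eN) add0n; lra.
have -> : chebyshev_psi N = chebyshev_psi N./2.*2 + mangoldt N.
  by rewrite -{1 3}(odd_double_half N) oN add1n /chebyshev_psi big_nat_recr.
have := mangoldt_le_ln N; have := @ln_le_subr1 R N%:R; rewrite ltr0n N0 => /(_ isT).
rewrite e oN /= mulr1n; lra.
Qed.

End Mangoldt.

(** * Partial sums of the inverse square roots *)

Section InverseSqrt.
Variable R : realType.
Implicit Types (n N K d x y : nat).

Let sq n : R := Num.sqrt n%:R.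

Lemma sqrt_nat_gt0 n : (0 < n)%N -> 0 < sq n.
Proof. by move=> n0; rewrite sqrtr_gt0 ltr0n. Qed.

Lemma sqr_sqrt_nat n : sq n ^+ 2 = n%:R.
Proof. by rewrite sqr_sqrtr ?ler0n. Qed.

Lemma sqrt_nat_le m n : (m <= n)%N -> sq m <= sq n.
Proof. by move=> mn; rewrite ler_sqrt ?ler0n // ler_nat. Qed.

(** Comparison with the integral of t^(-1/2) over [n, n + 1], in the algebraic form sqrt(n+1) -
    sqrt(n) = 1 / (sqrt(n+1) + sqrt(n)). *)
Lemma invsqrt_step n : (0 < n)%N ->
  (sq n.+1)^-1 <= 2 * (sq n.+1 - sq n) <= (sq n)^-1.
Proof.
move=> n0; have u0 := sqrt_nat_gt0 n0; have v0 := sqrt_nat_gt0 (ltn0Sn n).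
have uv := sqrt_nat_le (leqnSn n); have u2 := sqr_sqrt_nat n; have v2 := sqr_sqrt_nat n.+1.
move: u0 v0 uv u2 v2; set u := sq n; set v := sq n.+1 => u0 v0 uv u2 v2.
have e : (v - u) * (v + u) = 1 by rewrite -subr_sqr v2 u2 -natr1; ring.
have -> : v - u = (v + u)^-1.
  by apply: (mulIf (_ : v + u != 0)); rewrite ?e ?mulVf // gt_eqF //; lra.
have vu0 : 0 < v + u by lra.
have -> : 2 * (v + u)^-1 = ((v + u) / 2)^-1 by rewrite invf_div mulrC.
by rewrite !lef_pV2 ?posrE //; lra.
Qed.

Definition sum_invsqrt n : R := \sum_(1 <= b < n.+1) (sq b)^-1.

Lemma sum_invsqrtS n : sum_invsqrt n.+1 = sum_invsqrt n + (sq n.+1)^-1.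
Proof. by rewrite /sum_invsqrt big_nat_recr. Qed.

Lemma sum_invsqrt_le n : sum_invsqrt n <= 2 * sq n.
Proof.
elim: n => [|[|n] IH]; first by rewrite /sum_invsqrt big_geq // mulr_ge0 ?sqrtr_ge0.
  by rewrite /sum_invsqrt big_nat1 /sq sqrtr1 invr1; lra.
by rewrite sum_invsqrtS; have /andP[] := invsqrt_step (ltn0Sn n); lra.
Qed.

Lemma sum_invsqrt_ge n : 2 * sq n.+1 - 2 <= sum_invsqrt n.
Proof.
elim: n => [|n IH]; first by rewrite /sum_invsqrt big_geq // /sq sqrtr1; lra.
by rewrite sum_invsqrtS; have /andP[_ h] := invsqrt_step (ltn0Sn n); lra.
Qed.

(** The difference between the sum up to n and 2 sqrt(n) decreases with n, but increases once 1 /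
    sqrt(n) is subtracted. The value at y thus plays the part of the limit constant. *)
Lemma sum_invsqrt_diff x y : (0 < x <= y)%N ->
  `|sum_invsqrt x - 2 * sq x - (sum_invsqrt y - 2 * sq y)| <= (sq x)^-1.
Proof.
move=> /andP[x0 xy]; have inv0 : 0 <= (sq y)^-1 by rewrite invr_ge0 sqrtr_ge0.
have [h1 h2] : sum_invsqrt y - 2 * sq y <= sum_invsqrt x - 2 * sq x /\
  sum_invsqrt x - 2 * sq x - (sq x)^-1 <= sum_invsqrt y - 2 * sq y - (sq y)^-1.
  rewrite -(subnKC xy); elim: (y - x)%N => [|k [IH1 IH2]]; first by rewrite addn0.
  have xk : (0 < x + k)%N by rewrite addn_gt0 x0.
  have /andP[s1 s2] := invsqrt_step xk.
  by rewrite addnS sum_invsqrtS; split; lra.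
by rewrite ger0_norm; lra.
Qed.
End InverseSqrt.

(** * The convolution of 1 with a real character *)

Section DivisorSum.
Variables (R : realType) (chi : nat -> R).
Hypothesis chiM : forall m n, chi (m * n)%N = chi m * chi n.
Hypothesis chi1 : chi 1%N = 1.
Hypothesis chi_val : forall n, [\/ chi n = 0, chi n = 1 | chi n = -1].

Definition divisor_sum n := \sum_(d <- divisors n) chi d.

Lemma divisor_sumE n N : (0 < n <= N)%N ->
  divisor_sum n = \sum_(1 <= d < N.+1 | (d %| n)%N) chi d.
Proof.
move=> /andP[n0 nN]; rewrite -big_filter; apply: perm_big; apply: uniq_perm.
- exact: divisors_uniq.
- by rewrite filter_uniq // iota_uniq.
move=> d; rewrite mem_filter mem_index_iota -dvdn_divisors // andbC.
by case dn : (d %| n)%N; rewrite ?andbF ?andbT // (dvdn_gt0 n0 dn) ltnS (leq_trans (dvdn_leq n0 dn)).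
Qed.

Lemma divisor_sum_pfactor p v m : prime p -> (0 < m)%N -> ~~ (p %| m)%N ->
  divisor_sum (p ^ v * m) = (\sum_(i < v.+1) chi p ^+ i) * divisor_sum m.
Proof.
move=> pp m0 pm; have p0 := prime_gt0 pp.
have pd d : (d %| m)%N -> ~~ (p %| d)%N by move=> dm; apply: contra pm => /dvdn_trans; apply.
have logd i d : (d %| m)%N -> logn p (p ^ i * d) = i.
  move=> dm; have d0 := dvdn_gt0 m0 dm.
  by rewrite lognM ?expn_gt0 ?p0 // pfactorK // [logn p d](_ : _ = 0%N) ?addn0 //; apply/eqP; rewrite -leqn0 leqNgt logn_gt0 mem_primes pp d0 /= pd.
have pexp i : chi (p ^ i)%N = chi p ^+ i.
  by elim: i => [|i IH]; rewrite ?expn0 ?expr0 // expnS chiM IH exprS.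
rewrite /divisor_sum mulr_suml.
transitivity (\sum_(i <- iota 0 v.+1) \sum_(d <- divisors m) chi (p ^ i * d)%N); last first.
  rewrite -/(index_iota 0 v.+1) big_mkord; apply: eq_bigr => i _.
  by rewrite mulr_sumr; apply: eq_bigr => d _; rewrite chiM pexp.
have -> : \sum_(i <- iota 0 v.+1) \sum_(d <- divisors m) chi (p ^ i * d)%N =
    \sum_(k <- [seq (p ^ i * d)%N | i <- iota 0 v.+1, d <- divisors m]) chi k.
  by rewrite big_allpairs_dep.
apply: perm_big; apply: uniq_perm.
- exact: divisors_uniq.
- apply: allpairs_uniq; [exact: iota_uniq | exact: divisors_uniq |].
  move=> x y /allpairsP[[i' d'] [_ dm ->]] /allpairsP[[j' e'] [_ em ->]] /=; simpl in dm, em.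
  rewrite -dvdn_divisors // in dm; rewrite -dvdn_divisors // in em.
  move=> h; have ij : i' = j' by rewrite -(logd i' d') // h logd.
  rewrite ij in h *; congr (_, _); apply/eqP.
  by rewrite -(eqn_pmul2l (_ : 0 < p ^ j')%N) ?expn_gt0 ?p0 // h.
move=> d; rewrite -dvdn_divisors ?muln_gt0 ?expn_gt0 ?p0 //; apply/idP/allpairsP.
- move=> dn; have d0 : (0 < d)%N by apply: dvdn_gt0 dn; rewrite muln_gt0 expn_gt0 p0.
  have [k pk dk] := pfactor_coprime pp d0.
  exists (logn p d, k); rewrite mem_iota -dvdn_divisors //= add0n ltnS; split.
  + by rewrite -(logd v m) // dvdn_leq_log // muln_gt0 expn_gt0 p0.
  + have : (k %| p ^ v * m)%N by apply: dvdn_trans dn; rewrite {1}dk dvdn_mulr.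
    by rewrite Gauss_dvdr // coprime_sym coprimeXl.
  + by rewrite mulnC.
- move=> [[i e] [iv em ->]]; rewrite -dvdn_divisors // in em.
  by rewrite mem_iota add0n ltnS in iv; rewrite dvdn_mul // dvdn_exp2l.
Qed.

Lemma sign_geometric_ge (x : R) v : [\/ x = 0, x = 1 | x = -1] ->
  (~~ odd v)%:R <= \sum_(i < v.+1) x ^+ i.
Proof.
case=> ->.
- rewrite big_ord_recl expr0 big1 ?addr0 => [|i _]; first by case: odd; rewrite ?ler01.
  by rewrite expr0n.
- rewrite (eq_bigr (fun=> 1)) => [|i _]; last by rewrite expr1n.
  by rewrite sumr_const card_ord ler_nat; case: odd.
- rewrite [leRHS](_ : _ = (~~ odd v)%:R) //; elim: v => [|v IH].
    by rewrite big_ord_recr big_ord0 /= add0r expr0.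
  rewrite big_ord_recr /= IH -signr_odd /=; case: odd => /=; rewrite ?expr0 ?expr1 ?add0r //.
  by rewrite subrr.
Qed.

(** The primes are split off one at a time: each contributes a factor 1 + x + ... + x^v with x =
    chi(p), which is nonnegative, and at least 1 for the even exponents of a square. *)
Lemma divisor_sum_ge n : (0 < n)%N ->
  0 <= divisor_sum n /\ forall k, n = (k ^ 2)%N -> 1 <= divisor_sum n.
Proof.
elim/ltn_ind: n => n IH n0; have [n1|n1] := leqP n 1.
  have -> : n = 1%N by case: n n0 n1 {IH} => [|[]].
  by rewrite /divisor_sum big_seq1 chi1; split=> //; exact: ler01.
have pp := pdiv_prime n1; set p := pdiv n in pp.
have e := partnC p n0; rewrite p_part in e; set v := logn p n in e; set m := (n`_p^')%N in e.
have m0 : (0 < m)%N by rewrite part_gt0.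
have v0 : (0 < v)%N by rewrite /v logn_gt0 mem_primes pp n0 pdiv_dvd.
have pm : ~~ (p %| m)%N.
  by have := coprime_partC p n n; rewrite p_part coprime_pexpl // prime_coprime.
have mn : (m < n)%N by rewrite -[X in (_ < X)%N]e ltn_Pmull // -(expn0 p) ltn_exp2l // prime_gt1.
have [IH0 IH1] := IH _ mn m0; have := divisor_sum_pfactor v pp m0 pm; rewrite e => ->.
have g := sign_geometric_ge v (chi_val p).
split=> [|k nk]; first by rewrite mulr_ge0 // (le_trans _ g).
have v2 : v = (2 * logn p k)%N by rewrite /v nk lognX.
have mk : m = ((k`_p^') ^ 2)%N by rewrite /m nk partnX.
have h1 := IH1 _ mk; rewrite v2 mul2n odd_double /= in g.
by rewrite v2 mul2n mulr_ege1.
Qed.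
End DivisorSum.

(** * Lower bound for L(1, chi) and Mertens' estimate for a nonprincipal real character *)

Section Nonvanishing.
Variables (R : realType) (chi : nat -> R) (M : R).
Hypothesis chiM : forall m n, chi (m * n)%N = chi m * chi n.
Hypothesis chi1 : chi 1%N = 1.
Hypothesis chi_val : forall n, [\/ chi n = 0, chi n = 1 | chi n = -1].
Hypothesis chiB : forall a n, `|\sum_(i < n) chi (a + i)%N| <= M.

Let sq n : R := Num.sqrt n%:R.

Lemma char_bound_ge0 : 0 <= M.
Proof. exact: le_trans (normr_ge0 _) (chiB 0 0). Qed.

Lemma char_norm n : `|chi n| <= 1.
Proof. by case: (chi_val n) => ->; rewrite ?normrN ?normr0 ?normr1 ?ler01. Qed.

Lemma char_abel (w : nat -> R) a b : (forall k, (a <= k)%N -> 0 <= w k) ->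
  (forall k, (a <= k)%N -> w k.+1 <= w k) ->
  `|\sum_(a <= k < b) chi k * w k| <= M * w a.
Proof.
move=> w0 wd; rewrite -{1}[a]add0n big_addn big_mkord.
under eq_bigr do rewrite addnC.
have := @abel_bound R (fun i => chi (a + i)%N) (fun i => w (a + i)%N) M (b - a)%N (chiB a).
rewrite addn0; apply=> i; rewrite ?addnS.
  by apply: w0; exact: leq_addr.
by apply: wd; exact: leq_addr.
Qed.

Definition Lsum N : R := \sum_(1 <= k < N.+1) chi k * k%:R^-1.

Lemma Lsum_diff x y : (x <= y)%N -> `|Lsum y - Lsum x| <= M / x.+1%:R.
Proof.
move=> xy; rewrite /Lsum (@big_cat_nat _ _ _ x.+1 1 y.+1) //= addrAC subrr add0r.
apply: (@char_abel (fun k => k%:R^-1)) => k xk; first by rewrite invr_ge0 ler0n.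
by rewrite lef_pV2 ?posrE ?ltr0n ?ler_nat // (leq_trans _ xk).
Qed.

Lemma sum_char_invsqrt_le a b : (0 < a)%N -> `|\sum_(a <= d < b) chi d * (sq d)^-1| <= M / sq a.
Proof.
move=> a0; apply: (@char_abel (fun k => (sq k)^-1)) => k ak; first by rewrite invr_ge0 sqrtr_ge0.
rewrite lef_pV2 ?posrE ?sqrtr_gt0 ?ltr0n ?(leq_trans a0 ak) //.
by rewrite ler_sqrt ?ler0n // ler_nat.
Qed.

(** With the weight n^(-1/2) the squares alone contribute a harmonic sum, while the hyperbola method
    has L(1, chi) in its main term; comparing the two bounds L(1, chi) from below. *)
Definition hyper_sum N : R := \sum_(1 <= n < N.+1) divisor_sum chi n * (sq n)^-1.

Lemma sq_mul m n : (sq (m * n))^-1 = (sq m)^-1 * (sq n)^-1.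
Proof. by rewrite /sq natrM sqrtrM ?ler0n // invfM. Qed.

Lemma hyper_sumE N :
  hyper_sum N = \sum_(1 <= d < N.+1) chi d * (sq d)^-1 * sum_invsqrt R (N %/ d).
Proof.
transitivity (\sum_(1 <= n < N.+1) \sum_(1 <= d < N.+1 | (d %| n)%N) chi d * (sq n)^-1).
  rewrite /hyper_sum !big_nat; apply: eq_bigr => n nN.
  by rewrite (@divisor_sumE _ _ n N) // mulr_suml.
rewrite (divisor_swap (fun d n => chi d * (sq n)^-1)); apply: eq_bigr => d _.
by rewrite /sum_invsqrt mulr_sumr; apply: eq_bigr => k _; rewrite sq_mul mulrA.
Qed.

(** Each square m^2 contributes at least 1 / m, and no other term is negative. *)
Lemma hyper_sum_ge K : \sum_(1 <= m < K.+1) m%:R^-1 <= hyper_sum (K ^ 2).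
Proof.
have pos n : (0 < n)%N -> 0 <= divisor_sum chi n * (sq n)^-1.
  move=> n0; rewrite mulr_ge0 ?invr_ge0 ?sqrtr_ge0 //.
  by have [] := divisor_sum_ge chiM chi1 chi_val n0.
elim: K => [|K IH]; first by rewrite /hyper_sum !big_geq.
rewrite big_nat_recr //= /hyper_sum (@big_cat_nat _ _ _ (K ^ 2).+1 1 (K.+1 ^ 2).+1) //=; last first.
  by rewrite ltnS leq_sqr.
apply: lerD => //; rewrite big_nat_recr /=; last by rewrite ltn_sqr.
have s0 : 0 <= \sum_((K ^ 2).+1 <= i < K.+1 ^ 2) divisor_sum chi i * (sq i)^-1.
  rewrite big_nat_cond; apply: sumr_ge0 => i /andP[/andP[Ki _] _].
  by apply: pos; apply: leq_ltn_trans Ki.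
have K0 : (0 < K.+1 ^ 2)%N by rewrite expn_gt0.
have [_ /(_ K.+1 erefl) h] := divisor_sum_ge chiM chi1 chi_val K0.
have -> : sq (K.+1 ^ 2) = K.+1%:R by rewrite /sq natrX sqrtr_sqr ger0_norm ?ler0n.
rewrite -[leLHS]add0r; apply: lerD => //; rewrite ler_peMl // invr_ge0 ler0n //.
Qed.

(** Dirichlet's hyperbola method on the pairs (d, b) with d b <= K^2, split at d = K. For d <= K the
    sum over b is close to 2 K / sqrt(d) + c, and the first term sums to 2 K [Lsum K]; the part d >
    K is small by cancellation in chi. *)
Lemma hyper_sum_le K : (0 < K)%N -> hyper_sum (K ^ 2) <= 2 * K%:R * Lsum K + 4 * M + 4.
Proof.
move=> K0; set N := (K ^ 2)%N; have M0 := char_bound_ge0.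
have KN : (K <= N)%N by rewrite /N -mulnn leq_pmulr.
have N0 : (0 < N)%N by rewrite (leq_trans K0).
have kp : 0 < K%:R :> R by rewrite ltr0n.
have sK0 := sqrt_nat_gt0 R K0; have sKK := sqr_sqrt_nat R K.
rewrite hyper_sumE (@big_cat_nat _ _ _ K.+1) //= ?ltnS //.
set A := \sum_(1 <= i < K.+1) _; set B := \sum_(K.+1 <= i < N.+1) _.
(* For d > K all b are at most K. After exchanging the sums, the one over d is at most M / sqrt(K),
   and that of b^(-1/2) at most 2 sqrt(K). *)
have hB : B <= 2 * M.
  have -> : B = \sum_(1 <= b < K.+1) (sq b)^-1 * \sum_(K.+1 <= d < (N %/ b).+1) chi d * (sq d)^-1.
    transitivity (\sum_(K.+1 <= d < N.+1) \sum_(1 <= b < K.+1) if (d <= N %/ b)%N then (sq b)^-1 * (chi d * (sq d)^-1) else 0).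
      rewrite /B !big_nat; apply: eq_bigr => d /andP[Kd dN].
      have d0 : (0 < d)%N by apply: leq_trans Kd.
      have NdK : (N %/ d <= K)%N by rewrite -(mulnK K K0) mulnn leq_div2l // ltnW.
      rewrite /sum_invsqrt (big_nat_widen _ _ K.+1) ?ltnS // big_mkcond /= mulr_sumr.
      rewrite !big_nat; apply: eq_bigr => b /andP[b0 _].
      rewrite ltnS leq_divRL // mulnC -leq_divRL //; case: ifP; rewrite ?mulr0 // mulrC //.
    rewrite exchange_big /= !big_nat; apply: eq_bigr => b /andP[b0 bK].
    rewrite mulr_sumr [RHS](big_nat_widen _ _ N.+1) ?ltnS ?leq_div //.
    by rewrite [RHS]big_mkcond /=; apply: eq_bigr => d _; rewrite ltnS.
  apply: (@le_trans _ _ (\sum_(1 <= b < K.+1) (sq b)^-1 * (M / sq K))); last first.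
    rewrite -mulr_suml; apply: le_trans (ler_wpM2r _ (sum_invsqrt_le R K)) _.
      by rewrite divr_ge0 // sqrtr_ge0.
    by rewrite mulrACA divff ?mulr1 ?gt_eqF.
  rewrite !big_nat; apply: ler_sum => b /andP[b0 _]; apply: ler_wpM2l.
    by rewrite invr_ge0 sqrtr_ge0.
  apply: le_trans (ler_norm _) (le_trans (sum_char_invsqrt_le _ _) _) => //.
  by rewrite ler_wpM2l // lef_pV2 ?posrE ?sqrtr_gt0 ?ltr0n // ler_sqrt ?ler0n // ler_nat.
set c := sum_invsqrt R N - 2 * sq N.
have c2 : `|c| <= 2.
  have := sum_invsqrt_le R N; have := sum_invsqrt_ge R N.
  have : sq N <= sq N.+1 by apply: sqrt_nat_le.
  by rewrite /c ler_norml -/(sq _) -/(sq _) => ? ? ?; apply/andP; split; lra.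
have sqN : sq N = K%:R by rewrite /sq /N natrX sqrtr_sqr ger0_norm ?ler0n.
(* With t = K / sqrt(d) and u the square root of floor(t^2), the errors of [sum_invsqrt_diff] and of
   replacing 2 u by 2 t are each at most 1/u <= 2/t. *)
have err d : (0 < d <= K)%N -> `|sum_invsqrt R (N %/ d) - 2 * (K%:R / sq d) - c| <= 4 * (sq d / K%:R).
  move=> /andP[d0 dK]; set x := (N %/ d)%N.
  have x0 : (0 < x)%N by rewrite divn_gt0 // (leq_trans dK).
  have xN : (x <= N)%N by exact: leq_div.
  have u0 : 0 < sq x by apply: sqrt_nat_gt0.
  have s0 : 0 < sq d by apply: sqrt_nat_gt0.
  have u2 : sq x ^+ 2 = x%:R by apply: sqr_sqrt_nat.
  have s2 : sq d ^+ 2 = d%:R by apply: sqr_sqrt_nat.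
  have := @sum_invsqrt_diff R x N; rewrite x0 xN => /(_ isT); rewrite -/(sq x) -/(sq N) -/c.
  pose t := K%:R / sq d; have t0 : 0 < t by rewrite divr_gt0.
  have -> : sq d / K%:R = t^-1 by rewrite /t invf_div.
  have t2 : t ^+ 2 * d%:R = N%:R by rewrite /t expr_div_n s2 divfK ?pnatr_eq0 -?lt0n // -natrX.
  have dp : 0 < d%:R :> R by rewrite ltr0n.
  have tx : x%:R <= t ^+ 2 by rewrite -(ler_pM2r dp) t2 -natrM ler_nat leq_trunc_div.
  have tx1 : t ^+ 2 <= x%:R + 1.
    by rewrite -(ler_pM2r dp) t2 natr1 -natrM ler_nat ltnW // ltn_ceil.
  have x1 : 1 <= x%:R :> R by rewrite ler1n.
  rewrite -/t -u2 in tx tx1 x1 *; move: (sq x) u0 tx tx1 x1 => u u0 tx tx1 x1 h; clearbody t.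
  have [u0' t0'] := (ltW u0, ltW t0).
  have ut : u <= t by rewrite -(ler_pXn2r (_ : 0 < 2)%N) ?nnegrE.
  have uu : 0 <= 2 * u by lra.
  have tu : t <= 2 * u.
    have : t ^+ 2 <= (2 * u) ^+ 2.
      by rewrite exprMn; lra.
    by rewrite ler_pXn2r ?nnegrE.
  have i1 : u^-1 <= 2 * t^-1.
    rewrite -[2]invrK -invfM lef_pV2 ?posrE ?mulr_gt0 //; lra.
  have i2 : 2 * (t - u) <= u^-1.
    rewrite -(ler_pM2r u0) mulVf ?gt_eqF //.
    apply: (@le_trans _ _ ((t - u) * (t + u))); last by rewrite -subr_sqr; lra.
    by rewrite mulrAC mulrC ler_wpM2l ?subr_ge0 //; lra.
  move: h; rewrite !ler_norml => /andP[h1 h2]; apply/andP; split; lra.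
have hA : A <= 2 * K%:R * Lsum K + 2 * M + 4.
  have -> : A = \sum_(1 <= d < K.+1) (2 * K%:R * (chi d * d%:R^-1) + c * (chi d * (sq d)^-1)
     + chi d * (sq d)^-1 * (sum_invsqrt R (N %/ d) - 2 * (K%:R / sq d) - c)).
    rewrite /A !big_nat; apply: eq_bigr => d /andP[d0 _].
    have -> : d%:R^-1 = (sq d)^-1 * (sq d)^-1 :> R by rewrite -sq_mul /sq natrM -expr2 sqrtr_sqr ger0_norm ?ler0n.
    by ring.
  rewrite !big_split /= -!mulr_sumr -/(Lsum K) -addrA -addrA lerD2l; apply: lerD.
    apply: le_trans (ler_norm _) _; rewrite normrM; apply: ler_pM => //.
    apply: le_trans (sum_char_invsqrt_le _ _) _ => //.
    by rewrite /sq sqrtr1 divr1.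
  apply: (@le_trans _ _ (\sum_(1 <= d < K.+1) 4 / K%:R)); last first.
    by rewrite sumr_const_nat subSS subn0 -[_ *+ _]mulr_natr divfK ?gt_eqF.
  rewrite !big_nat; apply: ler_sum => d /andP[d0 dK].
  apply: le_trans (ler_norm _) _; rewrite !normrM.
  have s0 : 0 < sq d by apply: sqrt_nat_gt0.
  have h : `|sum_invsqrt R (N %/ d) - 2 * (K%:R / sq d) - c| <= 4 * (sq d / K%:R) by apply: err; rewrite d0.
  rewrite (ger0_norm (_ : 0 <= (sq d)^-1)) ?invr_ge0 ?(ltW s0) //.
  apply: (@le_trans _ _ (1 * (sq d)^-1 * (4 * (sq d / K%:R)))).
    apply: ler_pM => //; rewrite ?mulr_ge0 ?invr_ge0 ?(ltW s0) //.
    by rewrite ler_wpM2r ?char_norm // invr_ge0 ltW.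
  by rewrite mul1r mulrCA mulKf ?gt_eqF.
lra.
Qed.

Lemma harmonic_unbounded (B : R) : exists K, (0 < K)%N /\ B <= \sum_(1 <= m < K.+1) m%:R^-1.
Proof.
have h k : k%:R / 2 <= \sum_(1 <= m < (2 ^ k).+1) m%:R^-1 :> R.
  elim: k => [|k IH]; first by rewrite mul0r big_nat1 invr1.
  rewrite (@big_cat_nat _ _ _ (2 ^ k).+1) //= ?ltnS ?leq_exp2l // -natr1 mulrDl; apply: lerD => //.
  apply: (@le_trans _ _ (\sum_((2 ^ k).+1 <= i < (2 ^ k.+1).+1) ((2 ^ k.+1)%N%:R)^-1)).
    have e : ((2 ^ k.+1).+1 - (2 ^ k).+1 = 2 ^ k)%N by rewrite subSS expnS mul2n -addnn addnK.
    rewrite sumr_const_nat e; have -> : (2 ^ k.+1)%N%:R^-1 *+ (2 ^ k) = 1 / 2 :> R; last by [].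
    by rewrite -[LHS]mulr_natr expnS natrM invfM -mulrA mulVf ?mulr1 ?mul1r // pnatr_eq0 expn_eq0.
  rewrite !big_nat; apply: ler_sum => i /andP[i1 i2].
  by rewrite lef_pV2 ?posrE ?ltr0n ?ler_nat ?expn_gt0 // (leq_ltn_trans _ i1).
have [k kB] : exists k : nat, 2 * B <= k%:R.
  by exists (Num.truncn (2 * B)).+1; rewrite ltW // truncnS_gt.
by exists (2 ^ k)%N; rewrite expn_gt0; split=> //; apply: le_trans (h k); lra.
Qed.

(* Otherwise [2 K L(1, chi)] would bound the harmonic sum of order K. *)
Lemma Lsum_bounded_below : exists (delta : R) (K0 : nat), 0 < delta /\
  forall N, (K0 <= N)%N -> delta <= Lsum N.
Proof.
(* 6 M + 6 is the error 4 M + 4 of [hyper_sum_le] plus 2 (M + 1), which yields (M + 1) / K <=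
   [Lsum K]; the later terms cost at most M / K and leave 1 / K. *)
have [K [K0 hK]] := harmonic_unbounded (6 * M + 6).
have kp : 0 < K%:R :> R by rewrite ltr0n.
have M0 := char_bound_ge0.
exists (K%:R^-1), K; split=> [|N KN]; first by rewrite invr_gt0.
have h1 : 2 * M + 2 <= 2 * K%:R * Lsum K.
  by have := hyper_sum_le K0; have := hyper_sum_ge K; lra.
have h2 : (M + 1) / K%:R <= Lsum K by rewrite ler_pdivrMr //; lra.
have h3 : M / K.+1%:R <= M / K%:R.
  by rewrite ler_wpM2l // lef_pV2 ?posrE ?ltr0n // ler_nat.
rewrite mulrDl mul1r in h2.
have := Lsum_diff KN; rewrite ler_norml => /andP[h4 _].
move: h2 h3 h4; move: (M / K%:R) (M / K.+1%:R) (K%:R^-1); clear; move=> a b c; lra.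
Qed.

Lemma sum_char_ln_bound : exists C : R, forall N,
  `|\sum_(1 <= n < N.+1) chi n * n%:R^-1 * ln n%:R| <= C.
Proof.
have M0 := char_bound_ge0.
pose w k : R := ln k%:R / k%:R.
exists (\sum_(1 <= n < 4) `|chi n * n%:R^-1 * ln n%:R| + M * w 4%N) => N.
have w0 k : 0 <= w k by rewrite divr_ge0 ?ler0n ?ln_nat_ge0.
have hw : 0 <= M * w 4%N by rewrite mulr_ge0.
have [N4|N4] := leqP N.+1 4.
  apply: le_trans (ler_norm_sum _ _ _) _; rewrite [X in _ <= X + _](@big_cat_nat _ _ _ N.+1) //=.
  by rewrite -addrA lerDl addr_ge0 // sumr_ge0.
(* The first three terms are bounded apart, because [ln_div_decr] provides decreasing weights from 4
   on. *)
rewrite (@big_cat_nat _ _ _ 4) //=; last exact: ltnW.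
apply: le_trans (ler_normD _ _) (lerD (ler_norm_sum _ _ _) _).
rewrite (eq_bigr (fun k => chi k * w k)) => [|k _]; last by rewrite /w -mulrA [_^-1 * _]mulrC.
by apply: char_abel => k k4 //; apply: ln_div_decr.
Qed.

(** By [sum_mul_ln] the bounded sum of chi(n) ln(n) / n is that of chi(d) Lambda(d) / d times
    L(N/d). Replacing L(N/d) by L(N) costs at most M psi(N) / N <= 4 M, and L(N) is at least
    delta. *)
Lemma mertens_char_bound : exists (C : R) (K0 : nat), forall N, (K0 <= N)%N ->
  `|\sum_(1 <= d < N.+1) chi d * d%:R^-1 * mangoldt R d| <= C.
Proof.
have M0 := char_bound_ge0; have [delta [K0 [d0 hd]]] := Lsum_bounded_below.
have [C hC] := sum_char_ln_bound.
exists ((C + 4 * M) / delta), K0.+1 => N KN.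
have N1 : (0 < N)%N by apply: leq_ltn_trans KN.
have N0 : 0 < N%:R :> R by rewrite ltr0n.
set S := \sum_(_ <= _ < _) _.
have chinM m n : chi (m * n)%N * (m * n)%:R^-1 = chi m * m%:R^-1 * (chi n * n%:R^-1).
  by rewrite chiM natrM invfM; ring.
have e := sum_mul_ln N chinM; have := hC N; rewrite e => {}e.
have dif : `|\sum_(1 <= d < N.+1) chi d * d%:R^-1 * mangoldt R d * Lsum (N %/ d) - S * Lsum N| <= 4 * M.
  rewrite mulr_suml -sumrB.
  apply: (@le_trans _ _ (\sum_(1 <= d < N.+1) mangoldt R d * (M / N%:R))); last first.
    rewrite -mulr_suml; apply: le_trans (ler_wpM2r _ (psi_le R N)) _; first by rewrite divr_ge0 // ltW.
    by rewrite mulrACA mulrA -mulrA mulfV ?gt_eqF // mulr1.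
  apply: le_trans (ler_norm_sum _ _ _) _; rewrite !big_nat; apply: ler_sum => d /andP[d1 dN].
  rewrite -mulrBr !normrM (ger0_norm (mangoldt_ge0 R d)) mulrAC mulrC ler_wpM2l ?mangoldt_ge0 //.
  have := Lsum_diff (leq_div N d); rewrite distrC => h.
  have dp : 0 < d%:R :> R by rewrite ltr0n.
  rewrite (ger0_norm (_ : 0 <= d%:R^-1)) ?invr_ge0 ?ler0n //.
  apply: (@le_trans _ _ (1 * d%:R^-1 * (M / (N %/ d).+1%:R))).
    apply: ler_pM => //; first by rewrite mulr_ge0 // invr_ge0 ler0n.
    by rewrite ler_wpM2r ?char_norm // invr_ge0 ler0n.
  rewrite mul1r mulrCA ler_wpM2l // -invfM lef_pV2 ?posrE ?mulr_gt0 ?ltr0n //.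
  by rewrite -natrM ler_nat mulnC ltnW // ltn_ceil.
have LN := hd N (ltnW KN).
have S1 : `|S| * Lsum N <= C + 4 * M.
  have L0 : 0 <= Lsum N by apply: le_trans LN; exact: ltW.
  rewrite -{1}(ger0_norm L0) -normrM.
  move: e dif; set T := (\sum_(1 <= d < N.+1) _) => e dif.
  rewrite -[S * _](subKr T); apply: le_trans (ler_normB _ _) _; exact: lerD.
rewrite ler_pdivlMr //; apply: le_trans S1.
by rewrite ler_wpM2l.
Qed.
End Nonvanishing.

(** * Mertens' sum for the principal character is unbounded *)

Section Principal.
Variables (R : realType) (M : nat).
Hypothesis M0 : (0 < M)%N.

Definition principal_char n : R := (coprime n M)%:R.

Lemma principal_charM m n : principal_char (m * n)%N = principal_char m * principal_char n.
Proof. by rewrite /principal_char coprimeMl -natrM mulnb. Qed.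

Lemma principal_char_ge0 n : 0 <= principal_char n.
Proof. exact: ler0n. Qed.

(** From each block of M consecutive integers only j M + 1 is kept: it is coprime to M and its
    logarithm is at least ln j. This avoids counting the residues coprime to M. *)
Lemma sum_principal_ln j :
  \sum_(1 <= i < j) ln i%:R <= \sum_(1 <= n < (j * M).+1) principal_char n * ln n%:R.
Proof.
have pos a b : 0 <= \sum_(a <= n < b) principal_char n * ln n%:R.
  by apply: sumr_ge0 => n _; rewrite mulr_ge0 ?ler0n ?ln_nat_ge0.
elim: j => [|[|j] IH]; [by rewrite big_geq | by rewrite big_geq |].
rewrite [leLHS]big_nat_recr //= (@big_cat_nat _ _ _ (j.+1 * M).+1 1 (j.+2 * M).+1) //=; last first.
  by rewrite ltnS leq_mul.
apply: lerD => //; rewrite big_ltn; last by rewrite ltnS ltn_mul2r M0 /=.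
rewrite -[leLHS]addr0; apply: lerD => //.
have cop : coprime (j.+1 * M).+1 M.
  by rewrite -coprime_modl -[(_ * M).+1]addn1 modnMDl coprime_modl coprime1n.
rewrite /principal_char cop mul1r ler_ln ?posrE ?ltr0n // ler_nat leqW //.
by rewrite leq_pmulr.
Qed.

(** The 2^k integers from 2^k on have logarithms at least k ln 2 >= k / 2. With N = 2^(k+1) M and S
    the sum to be bounded, [sum_mul_ln] gives 2^k k / 2 <= N S, that is k <= 4 M S. *)
Lemma mertens_principal (B : R) (N0 : nat) : exists N, (N0 <= N)%N /\
  B <= \sum_(1 <= d < N.+1) principal_char d * d%:R^-1 * mangoldt R d.
Proof.
pose k := maxn N0 (Num.truncn (4 * M%:R * B)).+1.
pose N := (2 ^ k.+1 * M)%N; have N1 : (0 < N)%N by rewrite muln_gt0 expn_gt0.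
have Mp : 0 < M%:R :> R by rewrite ltr0n.
exists N; split.
  apply: leq_trans (leq_maxl _ _) (leq_trans (ltnW (ltn_expl k (isT : (1 < 2)%N))) _).
  by rewrite /N -[leqLHS]muln1 leq_mul // leq_exp2l.
set S := \sum_(_ <= _ < _) _.
have kB : 4 * M%:R * B <= k%:R.
  by apply: le_trans (ltW (truncnS_gt _)) _; rewrite ler_nat leq_maxr.
have NS : (2 ^ k)%:R * (k%:R / 2) <= N%:R * S.
  apply: (@le_trans _ _ (\sum_(1 <= i < 2 ^ k.+1) ln i%:R)).
    have k1 : (1 <= 2 ^ k)%N by rewrite expn_gt0.
    have k2 : (2 ^ k <= 2 ^ k.+1)%N by rewrite leq_exp2l.
    rewrite (@big_cat_nat _ _ _ (2 ^ k)%N) //= -[leLHS]add0r; apply: lerD.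
      by apply: sumr_ge0 => i _; exact: ln_nat_ge0.
    apply: (@le_trans _ _ (\sum_(2 ^ k <= i < 2 ^ k.+1) (k%:R / 2))).
      rewrite sumr_const_nat (_ : (2 ^ k.+1 - 2 ^ k = 2 ^ k)%N) ?mulr_natl //.
      by rewrite expnS mul2n -addnn addnK.
    rewrite !big_nat; apply: ler_sum => i /andP[ki _].
    apply: (@le_trans _ _ (ln (2 ^ k)%:R)); last first.
      by rewrite ler_ln ?posrE ?ltr0n ?ler_nat // (leq_trans k1).
    rewrite natrX lnXn // -[leRHS]mulr_natl; apply: ler_wpM2l; rewrite ?ler0n //; have := ln2_ge R; lra.
  apply: le_trans (sum_principal_ln _) _; rewrite sum_mul_ln; last exact: principal_charM.
  rewrite /S mulr_sumr !big_nat; apply: ler_sum => d /andP[d1 _].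
  have dp : 0 < d%:R :> R by rewrite ltr0n.
  have -> : N%:R * (principal_char d * d%:R^-1 * mangoldt R d) =
    principal_char d * mangoldt R d * (N%:R / d%:R) by ring.
  rewrite ler_wpM2l ?mulr_ge0 ?principal_char_ge0 ?mangoldt_ge0 //.
  apply: (@le_trans _ _ (\sum_(1 <= i < (N %/ d).+1) 1)).
    by apply: ler_sum => i _; rewrite /principal_char; case: coprime; rewrite ?ler01.
  rewrite sumr_const_nat subSS subn0 ler_pdivlMr // -natrM ler_nat.
  exact: leq_trunc_div.
have kp : 0 < (2 ^ k)%:R :> R by rewrite ltr0n expn_gt0.
have : k%:R / 2 <= 2 * M%:R * S.
  by rewrite -(ler_pM2l kp); apply: le_trans NS _; rewrite /N natrM expnS natrM; rewrite le_eqVlt; apply/orP; left; apply/eqP; ring.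
move=> h; have Mp2 : 0 < 2 * M%:R :> R by lra.
rewrite -(ler_pM2l Mp2); lra.
Qed.
End Principal.

(** * Detecting a prime by a finite family of real characters *)

Section SymbolFamily.
Variables (R : realType) (Q : seq nat) (chi : nat -> nat -> R) (eps : nat -> R).
Hypothesis Q_uniq : uniq Q.
Hypothesis Q_coprime : forall p q : nat, p \in Q -> q \in Q -> p != q -> coprime p q.
Hypothesis Q_gt0 : forall q : nat, q \in Q -> (0 < q)%N.
Hypothesis chiM : forall q m n : nat, q \in Q -> chi q (m * n)%N = chi q m * chi q n.
Hypothesis chi1 : forall q : nat, q \in Q -> chi q 1%N = 1.
Hypothesis chi_val : forall q n : nat, q \in Q -> [\/ chi q n = 0, chi q n = 1 | chi q n = -1].
Hypothesis chi_eq0 : forall q n : nat, q \in Q -> (chi q n == 0) = ~~ coprime n q.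
Hypothesis chi_mod : forall q m n : nat, q \in Q -> m = n %[mod q] -> chi q m = chi q n.
Hypothesis chi_nonres : forall q : nat, q \in Q -> exists u, chi q u = -1.
Hypothesis eps_val : forall q : nat, q \in Q -> eps q = 1 \/ eps q = -1.
Hypothesis eps_N1 : exists2 q : nat, q \in Q & eps q = -1.

Let M := (\prod_(q <- Q) q)%N.

Definition char_prod (s : seq nat) n : R := principal_char R M n * \prod_(q <- s) chi q n.

(** At n coprime to all moduli this is 2 to the size of l if every symbol of n has its prescribed
    value, and 0 otherwise. *)
Definition symbol_filter (l : seq nat) n : R := \prod_(q <- l) (1 + eps q * chi q n).

Lemma modulus_gt0 : (0 < M)%N.
Proof. by rewrite /M big_seq_cond; apply: prodn_cond_gt0 => q /andP[qQ _]; exact: Q_gt0. Qed.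

Lemma modulus_dvd q : q \in Q -> (q %| M)%N.
Proof. by move=> qQ; rewrite /M (big_rem q) //= dvdn_mulr. Qed.

Lemma char_prodM s m n : {subset s <= Q} -> char_prod s (m * n)%N = char_prod s m * char_prod s n.
Proof.
move=> sQ; rewrite /char_prod principal_charM mulrACA -big_split /= !big_seq.
by congr (_ * _); apply: eq_bigr => q /sQ qQ; rewrite chiM.
Qed.

Lemma char_prod1 s : {subset s <= Q} -> char_prod s 1%N = 1.
Proof.
move=> sQ; rewrite /char_prod /principal_char coprime1n mul1r big_seq big1 // => q /sQ.
exact: chi1.
Qed.

Lemma char_prod_val s n : {subset s <= Q} ->
  [\/ char_prod s n = 0, char_prod s n = 1 | char_prod s n = -1].
Proof.
rewrite /char_prod /principal_char; case: coprime; rewrite ?mul0r; last by move=> _; exact: Or31.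
rewrite mul1r; elim: s => [|q s IH] sQ; first by rewrite big_nil; exact: Or32.
have qQ : q \in Q by apply: sQ; rewrite mem_head.
have /IH : {subset s <= Q} by move=> x xs; apply: sQ; rewrite inE xs orbT.
rewrite big_cons; case: (chi_val n qQ) => ->; case=> ->;
  rewrite ?mul0r ?mulr0 ?mul1r ?mulr1 ?mulN1r ?opprK; auto using Or31, Or32, Or33.
Qed.

Lemma char_prod_mod s m n : {subset s <= Q} -> m = n %[mod M] -> char_prod s m = char_prod s n.
Proof.
move=> sQ mn; rewrite /char_prod /principal_char -coprime_modl mn coprime_modl !big_seq.
congr (_ * _); apply: eq_bigr => q /sQ qQ; apply: chi_mod => //.
by rewrite -(modn_dvdm m (modulus_dvd qQ)) mn modn_dvdm ?modulus_dvd.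
Qed.

(** Chinese remainders: u is a nonresidue at one modulus of s and 1 at all other moduli of Q. *)
Lemma char_prod_nonprincipal s : {subset s <= Q} -> uniq s -> s != [::] ->
  exists2 u, coprime u M & char_prod s u = -1.
Proof.
case: s => // x s sQ /= /andP[xs us] _.
have xQ : x \in Q by apply: sQ; rewrite mem_head.
have {}sQ : {subset s <= Q} by move=> y ys; apply: sQ; rewrite inE ys orbT.
have [v chv] := chi_nonres xQ.
pose M' := (\prod_(q <- rem x Q) q)%N.
have ME : M = (x * M')%N by rewrite /M (big_rem x).
have mem_rem q : q \in rem x Q -> q \in Q /\ q != x.
  by rewrite mem_rem_uniq // inE => /andP[].
have cxM : coprime x M'.
  rewrite /M' big_seq; apply: (big_ind (fun m => coprime x m)) => [|a b|q].
  - exact: coprimen1.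
  - by rewrite coprimeMr => -> ->.
  - by move=> /mem_rem[qQ qx]; apply: Q_coprime => //; rewrite eq_sym.
pose u := chinese x M' v 1.
have ux : chi x u = -1 by rewrite (chi_mod xQ (chinese_modl cxM v 1)).
have uM' : u = 1 %[mod M'] by apply: chinese_modr.
have cuM : coprime u M.
  rewrite ME coprimeMr -[coprime u x]negbK -chi_eq0 // ux oppr_eq0 oner_eq0 /=.
  by rewrite -coprime_modl uM' coprime_modl coprime1n.
exists u => //; rewrite /char_prod /principal_char cuM mul1r big_cons ux big_seq big1 ?mulr1 //.
move=> q qs; have qQ := sQ _ qs.
have qM' : (q %| M')%N.
  have qr : q \in rem x Q by rewrite mem_rem_uniq // inE qQ andbT; apply: contraNneq xs => <-.
  by rewrite /M' (big_rem q) //= dvdn_mulr.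
rewrite -(chi1 qQ); apply: chi_mod => //.
by rewrite -(modn_dvdm u qM') uM' modn_dvdm.
Qed.

(** Multiplication by a unit of value -1 permutes the residues modulo M and changes the sign of the
    sum. *)
Lemma char_prod_sum0 s : {subset s <= Q} -> uniq s -> s != [::] ->
  \sum_(i < M) char_prod s i = 0.
Proof.
move=> sQ us s0; have [u uM ue] := char_prod_nonprincipal sQ us s0.
have M0 := modulus_gt0.
pose f (i : 'I_M) : 'I_M := Ordinal (ltn_pmod (u * i) M0).
have f_inj : injective f.
  move=> i j /(congr1 val) /= /eqP e; apply/val_inj/eqP.
  wlog ij : i j e / (j <= i)%N.
    by move=> H; case/orP: (leq_total i j) => ij; [rewrite eq_sym; apply: H; rewrite 1?eq_sym | apply: H].
  rewrite eqn_mod_dvd ?leq_mul // -mulnBr Gauss_dvdr 1?coprime_sym // in e.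
  rewrite eqn_leq ij andbT -subn_eq0; apply: contraLR e => ne.
  by rewrite gtnNdvd ?lt0n // (leq_ltn_trans (leq_subr _ _)).
have : \sum_(i < M) char_prod s i = - \sum_(i < M) char_prod s i; last by lra.
rewrite {1}(reindex_inj f_inj) /= -sumrN; apply: eq_bigr => i _.
rewrite (@char_prod_mod s _ (u * i)%N) ?modn_mod // char_prodM // ue mulN1r.
by [].
Qed.

Lemma char_prod_bound s : {subset s <= Q} -> uniq s -> s != [::] ->
  forall a n, `|\sum_(i < n) char_prod s (a + i)%N| <= M%:R.
Proof.
move=> sQ us s0 a n; apply: periodic_sum_bound; first exact: modulus_gt0.
- by move=> i; apply: char_prod_mod => //; rewrite modnDr.
- by move=> i; case: (char_prod_val i sQ) => ->; rewrite ?normrN ?normr0 ?normr1 ?ler01.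
- exact: char_prod_sum0.
Qed.

Definition mertens_sum (f : nat -> R) N := \sum_(1 <= d < N.+1) f d * d%:R^-1 * mangoldt R d.

(** Expanding the factor at x gives products over s and over x :: s. As s is nonempty and the moduli
    are distinct, every product that arises is a nonprincipal character. *)
Lemma mertens_filter_bound l s : uniq (s ++ l) -> {subset s ++ l <= Q} -> s != [::] ->
  exists (C : R) (K : nat), forall N, (K <= N)%N ->
    `|mertens_sum (fun n => char_prod s n * symbol_filter l n) N| <= C.
Proof.
elim: l s => [|x l IH] s ul slQ s0.
  rewrite cats0 in ul slQ.
  have [C [K h]] := mertens_char_bound (fun m n => char_prodM m n slQ) (char_prod1 slQ)
    (fun n => char_prod_val n slQ) (char_prod_bound slQ ul s0).
  exists C, K => N KN.
  have -> : mertens_sum (fun n => char_prod s n * symbol_filter [::] n) N = mertens_sum (char_prod s) N.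
    by apply: eq_bigr => n _; rewrite /symbol_filter big_nil mulr1.
  exact: h.
have [|||C1 [K1 h1]] := IH s.
- by move: ul; rewrite !cat_uniq /= => /and3P[-> /norP[_ ->] /andP[_ ->]].
- by move=> q; rewrite mem_cat => /orP[] qs; apply: slQ; rewrite mem_cat ?inE qs ?orbT.
- exact: s0.
have [|||C2 [K2 h2]] := IH (x :: s) => //.
- by rewrite -(cat1s x s) -catA (perm_uniq (_ : perm_eq _ (s ++ x :: l))) // perm_catCA.
- move=> q qs; apply: slQ; move: qs; rewrite !mem_cat !inE.
  by case: (q \in s); case: (q == x).
have xQ : x \in Q by apply: slQ; rewrite mem_cat mem_head orbT.
exists (C1 + C2), (maxn K1 K2) => N; rewrite geq_max => /andP[/h1 {}h1 /h2 {}h2].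
have -> : mertens_sum (fun n => char_prod s n * symbol_filter (x :: l) n) N =
    mertens_sum (fun n => char_prod s n * symbol_filter l n) N +
    eps x * mertens_sum (fun n => char_prod (x :: s) n * symbol_filter l n) N.
  rewrite /mertens_sum mulr_sumr -big_split /=; apply: eq_bigr => n _.
  by rewrite /symbol_filter /char_prod !big_cons; ring.
apply: le_trans (ler_normD _ _) (lerD h1 _); rewrite normrM.
by case: (eps_val xQ) => ->; rewrite ?normrN normr1 mul1r.
Qed.

(** In the full expansion only the empty set of symbols yields the principal character; the
    remaining terms contain some x and are bounded. *)
Lemma mertens_filter_unbounded l : uniq l -> {subset l <= Q} ->
  exists C : R, exists K : nat, forall N, (K <= N)%N ->
    mertens_sum (principal_char R M) N - C <=
    mertens_sum (fun n => principal_char R M n * symbol_filter l n) N.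
Proof.
elim: l => [|x l IH] ul lQ.
  exists 0, 0%N => N _; rewrite subr0 /mertens_sum; apply: ler_sum => n _.
  by rewrite /symbol_filter big_nil mulr1.
have /andP[_ ul'] := ul; have lQ' : {subset l <= Q} by move=> q ql; apply: lQ; rewrite inE ql orbT.
have [C1 [K1 h1]] := IH ul' lQ'.
have [//|//|//|C2 [K2 h2]] := @mertens_filter_bound l [:: x].
have xQ : x \in Q by apply: lQ; rewrite mem_head.
exists (C1 + C2), (maxn K1 K2) => N; rewrite geq_max => /andP[/h1 {}h1 /h2 {}h2].
have -> : mertens_sum (fun n => principal_char R M n * symbol_filter (x :: l) n) N =
    mertens_sum (fun n => principal_char R M n * symbol_filter l n) N +
    eps x * mertens_sum (fun n => char_prod [:: x] n * symbol_filter l n) N.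
  rewrite /mertens_sum mulr_sumr -big_split /=; apply: eq_bigr => n _.
  by rewrite /symbol_filter /char_prod !big_cons big_nil; ring.
move: h2; rewrite ler_norml => /andP[h2 h3].
by case: (eps_val xQ) => ->; lra.
Qed.

(* The symbol of an even power is 1, so that prescribing the value -1
   somewhere turns a prime power with the right symbols into such a prime. *)
Lemma prime_with_symbols : exists p, prime p /\ forall q, q \in Q -> chi q p = eps q.
Proof.
have [C [K h]] := mertens_filter_unbounded Q_uniq (fun q qQ => qQ).
have [N [KN hN]] := @mertens_principal R M modulus_gt0 (C + 1) K.
apply: contrapT => none.
suff e : mertens_sum (fun n => principal_char R M n * symbol_filter Q n) N = 0.
  by have := h _ KN; rewrite e -/(mertens_sum _ _) in hN *; lra.
rewrite /mertens_sum big_nat big1 // => n _.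
have [cn|cn] := boolP (coprime n M); last by rewrite /principal_char (negPf cn) !mul0r.
have [/allP symb|] := boolP (all (fun q => chi q n == eps q) Q); last first.
  move=> /allPn[q qQ ne]; rewrite /symbol_filter (big_rem q) //=.
  suff -> : 1 + eps q * chi q n = 0 by rewrite !(mul0r, mulr0).
  have : chi q n != 0 by rewrite chi_eq0 // negbK (coprime_dvdr (modulus_dvd qQ)).
  move: ne; case: (chi_val n qQ) => ->; case: (eps_val qQ) => ->; rewrite ?eqxx // => _ _; ring.
rewrite mangoldt_eq0 ?mulr0 // => p k pp k0; apply/negP => /eqP nk; apply: none.
have chiX q : q \in Q -> chi q n = chi q p ^+ k.
  move=> qQ; rewrite nk; elim: {nk k0} k => [|k IH]; first by rewrite expr0 chi1.
  by rewrite expnS chiM // IH exprS.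
have ok : odd k.
  have [q qQ eq] := eps_N1; have := symb _ qQ; rewrite eq chiX //.
  apply: contraLR => ek; rewrite -(odd_double_half k) (negPf ek) add0n -mul2n exprM.
  have : 0 <= (chi q p ^+ 2) ^+ k./2 by rewrite exprn_ge0 ?sqr_ge0.
  by apply: contraTN => /eqP ->; rewrite -ltNge oppr_lt0 ltr01.
exists p; split=> // q qQ; rewrite -(eqP (symb _ qQ)) chiX //.
case: (chi_val p qQ) => ->; rewrite ?expr1n ?expr0n ?gtn_eqF //.
by rewrite -signr_odd ok.
Qed.
End SymbolFamily.

Definition chi4 (n : nat) : int :=
  match (n %% 4)%N with 1%N => 1 | 3 => -1 | _ => 0 end.

Lemma chi4M m n : chi4 (m * n) = chi4 m * chi4 n.
Proof.
rewrite /chi4 -modnMm; have := ltn_pmod m (isT : 0 < 4)%N; have := ltn_pmod n (isT : 0 < 4)%N.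
by case: (m %% 4)%N => [|[|[|[|]]]] //; case: (n %% 4)%N => [|[|[|[|]]]].
Qed.

Lemma chi4_val n : [\/ chi4 n = 0, chi4 n = 1 | chi4 n = -1].
Proof.
by rewrite /chi4; case: (n %% 4)%N => [|[|[|[|]]]]; auto using Or31, Or32, Or33.
Qed.

Lemma chi4_eq0 n : (chi4 n == 0) = ~~ coprime n 4.
Proof.
have -> : coprime n 4 = odd n by rewrite -[4%N]/(2 ^ 2)%N coprime_pexpr // coprimen2.
rewrite /chi4.
have -> : odd n = odd (n %% 4) by rewrite -{1}(odd_mod n (erefl : odd 4 = false)).
have := ltn_pmod n (isT : 0 < 4)%N.
by case: (n %% 4)%N => [|[|[|[|]]]].
Qed.

Lemma chi4_eq1 n : chi4 n = 1 -> (n %% 4 = 1)%N.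
Proof. by rewrite /chi4; case: (n %% 4)%N => [|[|[|[|]]]]. Qed.

(** The number 4 joins the moduli with [chi4] as its symbol and prescribed value 1, which puts the
    prime in the class of 1 modulo 4. *)
Lemma prime_with_legendre (R : realType) (s : seq nat) (eps : nat -> int) : uniq s ->
  (forall q : nat, q \in s -> prime q /\ odd q) -> (forall q : nat, q \in s -> eps q = 1 \/ eps q = -1) ->
  (exists2 q : nat, q \in s & eps q = -1) ->
  exists p, [/\ prime p, (p %% 4 = 1)%N & forall q : nat, q \in s -> legendre q p = eps q].
Proof.
move=> us sP se [q0 q0s q0e].
have s4 : 4%N \notin s by apply/negP => /sP[].
have n4 q : q \in s -> (q == 4%N) = false by move=> qs; apply: contraNF s4 => /eqP <-.
pose chi (q n : nat) : int := if q == 4%N then chi4 n else legendre q n.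
pose eps' (q : nat) : int := if q == 4%N then 1 else eps q.
have [|||||||||||p [pp hp]] := @prime_with_symbols R (4%N :: s) (fun q n => (chi q n)%:~R) (fun q => (eps' q)%:~R).
- by rewrite /= s4.
- have cop4 q : q \in s -> coprime 4 q.
    by move=> /sP[qp oq]; rewrite -[4%N]/(2 ^ 2)%N coprime_pexpl // coprime2n.
  move=> p q; rewrite !inE => /orP[/eqP->|ps] /orP[/eqP->|qs] //.
  + by move=> _; exact: cop4.
  + by move=> _; rewrite coprime_sym; exact: cop4.
  + have [pp _] := sP _ ps; have [qp _] := sP _ qs.
    by rewrite prime_coprime // dvdn_prime2.
- by move=> q; rewrite inE => /orP[/eqP->|/sP[/prime_gt0]].
- move=> q m n; rewrite inE /chi -intrM; case: eqP => [_ _|_ /= /sP[qp oq]]; first by rewrite chi4M.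
  by rewrite legendreM.
- by move=> q; rewrite inE /chi; case: eqP => // _ /= /sP[qp oq]; rewrite legendre1.
- move=> q n _; have [->|->|->] : [\/ chi q n = 0, chi q n = 1 | chi q n = -1].
  + by rewrite /chi; case: eqP => _; [exact: chi4_val | exact: legendre_val].
  + exact: Or31.
  + exact: Or32.
  + exact: Or33.
- move=> q n; rewrite inE intr_eq0 /chi; case: eqP => [-> _|_ /= /sP[qp oq]]; first exact: chi4_eq0.
  by rewrite legendre_eq0 // coprime_sym prime_coprime // negbK.
- move=> q m n; rewrite inE /chi; case: eqP => [-> _ mn|_ /= /sP[qp oq] mn].
    by rewrite /chi4 mn.
  by rewrite (legendre_mod qp mn).
- move=> q; rewrite inE /chi; case: eqP => [_ _|_ /= /sP[qp oq]]; first by exists 3%N.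
  by have [n nP] := Fp_nonresidue qp oq; exists n; rewrite nP.
- move=> q; rewrite inE /eps'; case: eqP => [_ _|_ /= /se[->|->]]; by [left | right].
- by exists q0; rewrite ?inE ?q0s ?orbT // /eps' n4 // q0e.
have inj (x y : int) : x%:~R = y%:~R :> R -> x = y by apply: intr_inj.
exists p; split=> // [|q qs].
  by apply: chi4_eq1; apply: inj; have := hp 4%N (mem_head _ _).
apply: inj; have := hp q; rewrite inE qs orbT => /(_ isT).
by rewrite /chi /eps' n4.
Qed.

(** * Integers represented by a ternary form *)

Definition squarefree (m : nat) := forall p, prime p -> ~~ (p ^ 2 %| m)%N.

Lemma squarefree_dvd m k : squarefree m -> (k %| m)%N -> squarefree k.
Proof. by move=> sm km p pp; apply: contra (sm p pp) => /dvdn_trans; apply. Qed.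

Lemma squarefree_decomp n : (0 < n)%N -> exists m k, squarefree m /\ n = (m * k ^ 2)%N.
Proof.
elim/ltn_ind: n => n IH n0.
have [[p pp pn]|none] := pselect (exists2 p, prime p & (p ^ 2 %| n)%N); last first.
  by exists n, 1%N; rewrite muln1; split=> // p pp; apply/negP => pn; apply: none; exists p.
have [j jn] := dvdnP pn; have j0 : (0 < j)%N by move: n0; rewrite jn muln_gt0 => /andP[].
have [|//|m [k [sm jE]]] := IH j.
  by rewrite jn ltn_Pmulr // -(exp1n 2) ltn_sqr prime_gt1.
by exists m, (k * p)%N; split=> //; rewrite jn jE expnMn mulnA.
Qed.

Lemma logn_squarefree m p : squarefree m -> prime p -> (p %| m)%N -> logn p m = 1%N.
Proof.
move=> sm pp pm; have m0 : (0 < m)%N.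
  by case: m sm pm => // /(_ p pp); rewrite dvdn0.
apply/eqP; rewrite eqn_leq -(pfactor_dvdn 1) // expn1 pm andbT leqNgt -pfactor_dvdn //.
exact: sm.
Qed.

Lemma squarefree_primes m : squarefree m -> m = (\prod_(p <- primes m) p)%N.
Proof.
move=> sm; have m0 : (0 < m)%N.
  by case: m sm => // /(_ 2 isT); rewrite dvdn0.
rewrite {1}(prod_prime_decomp m0) prime_decompE big_map /= !big_seq.
apply: eq_bigr => p; rewrite mem_primes => /and3P[pp _ pm].
by rewrite logn_squarefree.
Qed.

Lemma squarefree_prod (s : seq nat) : uniq s -> (forall p, p \in s -> prime p) ->
  squarefree (\prod_(p <- s) p)%N /\
  forall q, prime q -> (q %| \prod_(p <- s) p)%N = (q \in s).
Proof.
elim: s => [|x s IH] /=.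
  rewrite big_nil; split=> [p pp|q qp].
    by rewrite dvdn1 -(exp1n 2) eqn_sqr gtn_eqF // prime_gt1.
  by rewrite dvdn1 gtn_eqF // prime_gt1.
move=> /andP[xs us] sp; have xp : prime x by apply: sp; rewrite mem_head.
have [|sq dv] := IH us; first by move=> p ps; apply: sp; rewrite inE ps orbT.
rewrite big_cons; split=> [p pp|q qp]; last by rewrite Euclid_dvdM // dvdn_prime2 // dv // inE.
have [->|px] := eqVneq p x; first by rewrite expnS expn1 dvdn_pmul2l ?prime_gt0 // dv.
rewrite Gauss_dvdr ?sq // coprimeXl // prime_coprime // dvdn_prime2 //.
Qed.

(** If z were nonzero, the p-adic valuation of the left side would be odd and that of the right side
    even. *)
Lemma nonsquare_int (p N : nat) (x z : int) : prime p -> (p %| N)%N -> ~~ (p ^ 2 %| N)%N ->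
  N%:Z * x ^+ 2 = z ^+ 2 -> z = 0.
Proof.
move=> pp pN p2N e; apply/eqP/negPn/negP => z0.
have N0 : (0 < N)%N by case: N p2N {pN e} => //; rewrite dvdn0.
have v1 : logn p N = 1%N.
  by apply/eqP; rewrite eqn_leq -(pfactor_dvdn 1) // expn1 pN andbT leqNgt -pfactor_dvdn.
have en : (N * `|x| ^ 2 = `|z| ^ 2)%N.
  by move/(congr1 absz): e; rewrite abszM !abszX absz_nat.
have x0 : (0 < `|x|)%N.
  by rewrite lt0n; apply: contraNneq z0 => x0; move: en; rewrite x0 exp0n // muln0 => /esym/eqP; rewrite expn_eq0 andbT absz_eq0.
move/(congr1 (logn p)): en; rewrite lognM ?expn_gt0 ?x0 // !lognX v1.
by clear; lia.
Qed.

Lemma nonsquare_nat (p N : nat) : prime p -> (p %| N)%N -> ~~ (p ^ 2 %| N)%N ->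
  forall z : nat, (z ^ 2 != N)%N.
Proof.
move=> pp pN p2N z; apply/eqP => e.
have : z%:Z = 0 by apply: (@nonsquare_int p N 1) => //; rewrite expr1n mulr1 -e -mulnn PoszM expr2.
move=> -[z0]; move: p2N; rewrite -e z0 exp0n // dvdn0.
by [].
Qed.

(** Chinese remainders over the primes of m, each coprime to its cofactor by squarefreeness. *)
Lemma square_mod_squarefree (b c : int) (m : nat) : squarefree m ->
  (forall p, prime p -> (p %| m)%N -> exists k : int, (p %| b * k ^+ 2 - c)%Z) ->
  exists k : int, (m %| b * k ^+ 2 - c)%Z.
Proof.
elim/ltn_ind: m => m IH sm hp; have [m1|m1] := leqP m 1.
  have -> : m = 1%N by case: m m1 sm {IH hp} => [|[|]] // _ /(_ 2 isT); rewrite dvdn0.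
  by exists 0; rewrite dvdzE dvd1n.
have pp := pdiv_prime m1; have pm := pdiv_dvd m; set p := pdiv m in pp pm.
have [j jm] := dvdnP pm; have j0 : (0 < j)%N by case: j jm => // jm; rewrite jm in m1.
have cpj : coprime p j.
  by rewrite prime_coprime //; apply: contra (sm p pp) => pj; rewrite jm mulnC expnS expn1 dvdn_pmul2l ?prime_gt0.
have [k1 h1] := hp p pp pm.
have [|||k2 h2] := IH j.
- by rewrite jm ltn_Pmulr ?prime_gt1.
- by apply: squarefree_dvd sm _; rewrite jm dvdn_mulr.
- by move=> q qp qj; apply: hp => //; rewrite jm dvdn_mulr.
have cz : coprimez p j by rewrite coprimezE.
pose k := zchinese p j k1 k2; exists k.
have sub (u : int) (l : nat) : (k = u %[mod l])%Z -> (l %| b * u ^+ 2 - c)%Z -> (l %| b * k ^+ 2 - c)%Z.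
  move=> ku h; have -> : b * k ^+ 2 - c = b * u ^+ 2 - c + (b * (k + u)) * (k - u) by ring.
  by rewrite rpredD // dvdz_mull // -eqz_mod_dvd; apply/eqP.
have d1 := sub _ _ (zchinese_modl cz k1 k2) h1; have d2 := sub _ _ (zchinese_modr cz k1 k2) h2.
by move: d1 d2; rewrite !dvdzE !absz_nat jm Gauss_dvd 1?coprime_sym // => -> ->.
Qed.

Lemma legendre_quot (q a b : nat) : prime q -> odd q -> legendre q (a * b) = 1 ->
  exists k : int, (q %| a%:Z * k ^+ 2 - b%:Z)%Z.
Proof.
move=> qp oq e; have := legendreE (a * b) qp oq; rewrite e => /esym.
move=> /(Fp_half_pow1 qp oq)[k ek].
have a0 : (a%:R : 'F_q) != 0.
  rewrite Fp_nat_eq0 //; apply/negP => qa; have : (q %| a * b)%N by rewrite dvdn_mulr.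
  by rewrite -legendre_eq0 // e.
(* Since k^2 = a b, the quotient v = k / a satisfies a v^2 = b. *)
have [v ev] : exists v : 'F_q, v = k / a%:R by exists (k / a%:R).
exists (v : nat)%:Z.
rewrite -Fp_int_eq0 // rmorphB rmorphM rmorphXn /= -!pmulrn natr_Zp ev expr_div_n -ek natrM.
by rewrite subr_eq0; apply/eqP; field.
Qed.

Lemma legendre_quotN (q a b : nat) : prime q -> (q %% 4 = 1)%N -> legendre q (a * b) = 1 ->
  exists k : int, (q %| a%:Z * k ^+ 2 + b%:Z)%Z.
Proof.
move=> qp q4 e; have oq : odd q by move: q4; clear; lia.
have [|k hk] := @legendre_quot q a (q.-1 * b)%N qp oq.
  by rewrite mulnCA legendreM // legendreN1 // mul1r.
exists k; have -> : a%:Z * k ^+ 2 + b%:Z = a%:Z * k ^+ 2 - (q.-1 * b)%N%:Z + b%:Z * q%:Z.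
  by rewrite PoszM (_ : q%:Z = q.-1%:Z + 1); [ring | move: (prime_gt0 qp); clear; lia].
by rewrite rpredD // dvdz_mull.
Qed.

Lemma legendre_prod (q : nat) (s : seq nat) : prime q -> odd q ->
  legendre q (\prod_(p <- s) p)%N = \prod_(p <- s) legendre q p.
Proof.
move=> qp oq; elim: s => [|p s IH]; first by rewrite !big_nil legendre1.
by rewrite !big_cons legendreM // IH.
Qed.

(* n = 4 P d m^2 - 1 and n0 is its squarefree part: a prime r with well chosen
   symbols is simultaneously a value of z^2 - P x^2 and of d z^2 - n0 y^2, up to
   rational squares. *)
Lemma ternary_rep (R : realType) (A : seq nat) (d : nat) (m : int) :
  uniq A -> A != [::] -> (forall p, p \in A -> prime p /\ odd p) ->
  prime d -> (d %% 4 = 1)%N -> (forall p, p \in A -> legendre p d = -1) ->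
  let P := (\prod_(p <- A) p)%N in
  exists t y1 y2 y3 : int, t != 0 /\
    y1 ^+ 2 - P%:Z * y2 ^+ 2 - d%:Z * y3 ^+ 2 + 4 * P%:Z * d%:Z * (m * t) ^+ 2 = t ^+ 2.
Proof.
move=> uA nA pA dp d4 dA P; have od : odd d by move: d4; clear; lia.
have [sP dvP] := squarefree_prod uA (fun p h => proj1 (pA p h)); rewrite -/P in sP dvP.
have [-> | m0] := eqVneq m 0.
  by exists 1, 1, 0, 0; split=> //; ring.
pose M := `|m|%N; have M0 : (0 < M)%N by rewrite absz_gt0.
have dA' : d \notin A.
  apply/negP => dA1; have [qp oq] := pA _ dA1; have := dA _ dA1.
  by move: (legendre_eq0 d qp oq); rewrite dvdnn => /eqP ->.
have P0 : (0 < P)%N.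
  by rewrite /P big_seq_cond; apply: prodn_cond_gt0 => p /andP[/pA[/prime_gt0]].
have d0 := prime_gt0 dp.
pose n := (4 * P * d * M ^ 2).-1.
have nE : n.+1 = (4 * P * d * M ^ 2)%N by rewrite prednK // !muln_gt0 P0 d0 ?expn_gt0 M0.
have n0 : (0 < n)%N.
  have h : (0 < P * (d * M ^ 2))%N by rewrite !muln_gt0 P0 d0 ?expn_gt0 M0.
  by move: nE h; rewrite -!mulnA; move: (P * (d * M ^ 2))%N n; clear; lia.
have [n1 [k [sn1 n1E]]] := squarefree_decomp n0.
have n10 : (0 < n1)%N by move: n0; rewrite n1E muln_gt0 => /andP[].
have cop l : prime l -> (l %| n1)%N -> [/\ odd l, l != d & l \notin A].
  move=> lp ln1; have ln : (l %| n)%N by rewrite n1E dvdn_mulr.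
  have nd : ~~ (l %| 4 * P * d * M ^ 2)%N.
    by rewrite -nE -addn1 dvdn_addr // dvdn1 gtn_eqF // prime_gt1.
  split.
  - have [l2|//] := even_prime lp; move: nd.
    by rewrite l2 -!mulnA (_ : 4 = 2 * 2)%N // -mulnA dvdn_mulr.
  - by apply: contraNneq nd => ->; rewrite dvdn_mulr // dvdn_mull.
  - apply: contra nd => lA; rewrite -mulnA dvdn_mulr // dvdn_mull // dvP //.
have dn1 : ~~ (d %| n1)%N by apply/negP => /(cop _ dp)[_ /eqP].
have memL l : l \in primes n1 -> prime l /\ (l %| n1)%N.
  by rewrite mem_primes => /and3P[].
(* [prime_with_legendre] asks for a prescribed value -1, which the symbols at A, d and the divisors
   of n1 might not include; q0 is a fresh prime that supplies one. *)
have [q0 q0b q0p] := prime_above (\max_(x <- 2 :: A ++ d :: primes n1) x)%N.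
have q0n x : x \in 2 :: A ++ d :: primes n1 -> (x < q0)%N.
  by move=> xs; apply: leq_ltn_trans q0b; exact: (@leq_bigmax_seq _ _ predT id).
have oq0 : odd q0.
  have [q02|//] := even_prime q0p; have := q0n 2 (mem_head _ _); by rewrite q02 ltnn.
pose s := q0 :: A ++ d :: primes n1.
(* Value 1 at A and at d serves the solvability of both conics at these primes; at l | n1 the second
   conic needs r d to be a square modulo l. *)
pose eps x := if x == q0 then -1 else if x \in primes n1 then legendre x d else 1.
have sq0 x : x \in A ++ d :: primes n1 -> x != q0.
  by move=> xs; have := q0n x; rewrite inE xs orbT => /(_ isT); case: ltngtP.
have us : uniq s.
  rewrite /s cons_uniq; apply/andP; split; first by apply/negP => /sq0/eqP.
  rewrite cat_uniq uA /= primes_uniq andbT negb_or dA' /=; apply/andP; split.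
    by apply/hasPn => l /memL[lp /(cop _ lp)[]].
  by apply/negP => /memL[_]; apply/negP.
have sprime x : x \in s -> prime x /\ odd x.
  rewrite inE mem_cat inE => /or4P[/eqP->|/pA|/eqP->|/memL[lp /(cop _ lp)[]]] //.
have legLd l : l \in primes n1 -> legendre l d = 1 \/ legendre l d = -1.
  move=> /memL[lp ln1]; have [ol ld _] := cop _ lp ln1.
  have : legendre l d != 0 by rewrite legendre_eq0 // dvdn_prime2.
  by case: (legendre_val l d) => ->; [rewrite eqxx | left | right].
have [r [rp r4 hr]] : exists p, [/\ prime p, (p %% 4 = 1)%N & forall q, q \in s -> legendre q p = eps q].
  apply: (prime_with_legendre R) => //.
  - move=> q qs; rewrite /eps; case: eqP => _; first by right.
    by case: ifP => [/legLd//|_]; left.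
  - by exists q0; rewrite ?mem_head // /eps eqxx.
have or : odd r by move: r4; clear; lia.
have rs x : x \in s -> x != r.
  move=> xs; have [xp ox] := sprime _ xs; apply/eqP => xr; have := hr _ xs.
  have /eqP -> : legendre x r == 0 by rewrite legendre_eq0 // xr.
  by move: xs; rewrite /s inE /eps; case: eqP => // _ /=; case: ifP => // /legLd[->|->].
have sA p : p \in A -> p \in s by move=> h; rewrite inE mem_cat h orbT.
have sd : d \in s by rewrite inE mem_cat mem_head !orbT.
have sL l : l \in primes n1 -> l \in s by move=> h; rewrite inE mem_cat inE h !orbT.
have rA p : p \in A -> legendre p r = 1.
  move=> h; rewrite hr ?sA // /eps (negPf (sq0 p _)) ?mem_cat ?h //.
  by case: ifP => // /memL[lp /(cop _ lp)[_ _]]; rewrite h.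
have rd : legendre d r = 1.
  rewrite hr // /eps (negPf (sq0 d _)) ?mem_cat ?mem_head ?orbT //.
  by case: ifP => // /memL[_]; rewrite (negPf dn1).
have rL l : l \in primes n1 -> legendre l r = legendre l d.
  by move=> h; rewrite hr ?sL // /eps (negPf (sq0 l _)) ?h // mem_cat inE h !orbT.
have nrP : ~~ (r %| P)%N by rewrite dvP //; apply/negP => /sA/rs/eqP.
have nrn1 : ~~ (r %| n1)%N.
  apply/negP => h; have : r \in primes n1 by rewrite mem_primes rp n10.
  by move=> /sL/rs/eqP.
have nrd : ~~ (r %| d)%N by rewrite dvdn_prime2 // eq_sym rs.
have [p1 p1A] : exists p, p \in A by case: (A) nA => // p A' _; exists p; rewrite mem_head.
have [p1p _] := pA _ p1A; have p1P : (p1 %| P)%N by rewrite dvP.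
have nsqM q a b : prime q -> (q %| a)%N -> ~~ (q ^ 2 %| a)%N -> ~~ (q %| b)%N ->
    (q %| a * b)%N /\ ~~ (q ^ 2 %| a * b)%N.
  move=> qp qa q2a qb; rewrite dvdn_mulr //; split=> //.
  by rewrite Gauss_dvdl // coprimeXl // prime_coprime.
have psq q : prime q -> ~~ (q ^ 2 %| q)%N.
  by move=> qp; rewrite gtnNdvd ?prime_gt0 // -[ltnLHS]expn1 ltn_exp2l // prime_gt1.
have nrp1 : ~~ (p1 %| r)%N by rewrite dvdn_prime2 // rs // sA.
have [x [y [z [z0 eA]]]] : exists x y z : int, z != 0 /\ P%:Z * x ^+ 2 + r%:Z * y ^+ 2 = 1%:Z * z ^+ 2.
  have [k1 h1] : exists k1 : int, (P %| r%:Z * k1 ^+ 2 - 1%:Z)%Z.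
    apply: square_mod_squarefree => // p pp; rewrite dvP // => pA1; have [_ op] := pA _ pA1.
    by apply: legendre_quot => //; rewrite muln1 rA.
  have [k2 h2] : exists k2 : int, (r %| P%:Z * k2 ^+ 2 - 1%:Z)%Z.
    apply: legendre_quot => //; rewrite muln1 /P legendre_prod // big_seq big1 // => p h.
    by have [pp op] := pA _ h; rewrite quadratic_reciprocity ?rA // rs // sA.
  apply: (@legendre_conic P r 1 k1 k2 0) => //; rewrite ?prime_gt0 ?coprimen1 //.
  - by rewrite coprime_sym prime_coprime.
  - have [h3 h4] := nsqM p1 P r p1p p1P (sP _ p1p) nrp1; exact: nonsquare_nat h3 h4.
  - by rewrite muln1; exact: nonsquare_nat p1p p1P (sP _ p1p).
  - by rewrite muln1; exact: nonsquare_nat rp (dvdnn r) (psq _ rp).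
(* n is -1 modulo d, hence a residue as d is 1 modulo 4, and n1 differs from n by a square prime to
   d. *)
have ln1E : legendre d n1 = 1.
  have : legendre d n = 1.
    rewrite (@legendre_mod d _ d.-1) ?legendreN1 //; apply/eqP.
    rewrite -(eqn_modDr 1) !addn1 prednK // nE modnn -mulnA mulnCA -mulnA modnMr.
    by [].
  rewrite n1E legendreM // -mulnn legendre_sq ?mulr1 //.
  apply/negP => dk; have : legendre d n = 1.
    rewrite (@legendre_mod d _ d.-1) ?legendreN1 //; apply/eqP.
    by rewrite -(eqn_modDr 1) !addn1 prednK // nE modnn -mulnA mulnCA -mulnA modnMr.
  by rewrite n1E -mulnn mulnA legendreM // (eqP (_ : legendre d k == 0)) ?mulr0 // legendre_eq0.
have [x' [y' [z' [z0' eB]]]] : exists x y z : int, z != 0 /\ r%:Z * x ^+ 2 + n1%:Z * y ^+ 2 = d%:Z * z ^+ 2.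
  (* For l | n1 two reciprocities and the choice of r give (l / r) = (r / l) = (d / l) = (l / d);
     their product is (n1 / d) = 1. *)
  have rn1 : legendre r n1 = 1.
    transitivity (legendre d n1) => //; rewrite (squarefree_primes sn1) !legendre_prod // !big_seq.
    apply: eq_bigr => l h; have [lp ln1] := memL _ h; have [ol ld _] := cop _ lp ln1.
    by rewrite quadratic_reciprocity // ?rL ?(quadratic_reciprocity lp dp) // rs // sL.
  have rd1 : legendre r d = 1 by rewrite quadratic_reciprocity // rs.
  have [k1 h1] : exists k1 : int, (r %| n1%:Z * k1 ^+ 2 - d%:Z)%Z.
    by apply: legendre_quot => //; rewrite legendreM // rn1 rd1.
  have [k2 h2] : exists k2 : int, (n1 %| r%:Z * k2 ^+ 2 - d%:Z)%Z.
    apply: square_mod_squarefree => // l lp ln1; have [ol ld _] := cop _ lp ln1.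
    have h : l \in primes n1 by rewrite mem_primes lp n10.
    by apply: legendre_quot => //; rewrite legendreM // rL //; case: (legLd _ h) => ->.
  have [k3 h3] : exists k3 : int, (d %| r%:Z * k3 ^+ 2 + n1%:Z)%Z.
    by apply: legendre_quotN => //; rewrite legendreM // rd ln1E.
  have cnd : coprime n1 d by rewrite coprime_sym prime_coprime.
  apply: (@legendre_conic r n1 d k1 k2 k3) => //; rewrite ?prime_gt0 // ?(prime_coprime _ rp) //.
  - by have [h4 h5] := nsqM r r n1 rp (dvdnn r) (psq _ rp) nrn1; exact: nonsquare_nat h4 h5.
  - by have [h4 h5] := nsqM r r d rp (dvdnn r) (psq _ rp) nrd; exact: nonsquare_nat h4 h5.
  - by have [h4 h5] := nsqM d d n1 dp (dvdnn d) (psq _ dp) dn1; rewrite mulnC; exact: nonsquare_nat h4 h5.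
have y0 : y != 0.
  apply: contraNneq z0 => y0; apply/eqP.
  apply: (@nonsquare_int p1 P x) => //; first exact: sP.
  by move: eA; rewrite y0 expr0n mulr0 addr0 mul1r.
have y0' : y' != 0.
  apply: contraNneq z0' => y0'; have [h4 h5] := nsqM r r d rp (dvdnn r) (psq _ rp) nrd.
  have : d%:Z * z' = 0.
    apply: (@nonsquare_int r (r * d) x') => //.
    move: eB; rewrite y0' expr0n mulr0 addr0 exprMn expr2 -mulrA => <-.
    by rewrite PoszM; ring.
  by move/eqP; rewrite mulf_eq0 => /orP[|//]; rewrite eqz_nat gtn_eqF.
(* The two conics give y1^2 - P y2^2 = k^2 r (x' y)^2 and d y3^2 = k^2 y^2 (r x'^2 + n1 y'^2). The
   difference is - n t^2 with t = y y', and n + 1 = 4 P d m^2. *)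
exists (y * y'), (k%:Z * z * x'), (k%:Z * x * x'), (k%:Z * z' * y); split; first by rewrite mulf_neq0.
have eM : m ^+ 2 = M%:Z ^+ 2 by rewrite /M abszE real_normK ?num_real.
have en : 4 * P%:Z * d%:Z * m ^+ 2 = n1%:Z * k%:Z ^+ 2 + 1.
  rewrite eM; have := congr1 Posz nE; rewrite -addn1 n1E !(PoszM, PoszD) => e; lra.
have -> : 4 * P%:Z * d%:Z * (m * (y * y')) ^+ 2 = (4 * P%:Z * d%:Z * m ^+ 2) * (y * y') ^+ 2 by ring.
rewrite en mul1r in eA *.
have -> : (k%:Z * z * x') ^+ 2 = k%:Z ^+ 2 * x' ^+ 2 * z ^+ 2 by ring.
have -> : d%:Z * (k%:Z * z' * y) ^+ 2 = k%:Z ^+ 2 * y ^+ 2 * (d%:Z * z' ^+ 2) by ring.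
by rewrite -eA -eB; ring.
Qed.

(** * Forcing integrality by anisotropy *)

Local Open Scope classical_set_scope.
Local Open Scope ring_scope.

Lemma denq_dvd (x : rat) (a b : int) : b != 0 -> x * b%:~R = a%:~R -> (denq x %| b)%Z.
Proof.
move=> b0 e; have xE := divq_num_den x.
have : numq x * b = a * denq x.
  apply: (@intr_inj rat); rewrite !rmorphM /= -e -{2}xE mulrAC divfK ?intr_eq0 ?denq_neq0 //.
move=> h; have : (denq x %| numq x * b)%Z by rewrite h dvdz_mull.
by rewrite Gauss_dvdzr // coprimez_sym coprimezE coprime_num_den.
Qed.

Lemma prime_prod_mem (p : nat) (s : seq nat) : prime p -> (forall q, q \in s -> prime q) ->
  (p %| \prod_(q <- s) q)%N -> p \in s.
Proof.
move=> pp; elim: s => [|q s IH] sp; first by rewrite big_nil dvdn1 gtn_eqF // prime_gt1.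
have qp : prime q by apply: sp; rewrite mem_head.
rewrite big_cons Euclid_dvdM // dvdn_prime2 // inE => /orP[-> //|h].
by rewrite IH ?orbT // => r rs; apply: sp; rewrite inE rs orbT.
Qed.

Lemma prime_factorization (n : nat) : (0 < n)%N ->
  exists2 s : seq nat, n = (\prod_(p <- s) p)%N & forall p, p \in s -> prime p /\ (p %| n)%N.
Proof.
elim/ltn_ind: n => n IH n0; have [n1|n1] := leqP n 1.
  by exists [::]; rewrite // big_nil; case: n n0 n1 {IH} => [|[]].
have pp := pdiv_prime n1; have [j jn] := dvdnP (pdiv_dvd n).
have j0 : (0 < j)%N by case: j jn => // jn; rewrite jn in n1.
have [|s sE sp] := IH j _ j0; first by rewrite jn ltn_Pmulr ?prime_gt1.
exists (pdiv n :: s); first by rewrite big_cons -sE mulnC.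
move=> p; rewrite inE => /orP[/eqP->|/sp[qp qj]]; first by rewrite pdiv_dvd.
by split=> //; rewrite jn dvdn_mulr.
Qed.

(** Membership becomes a condition at each prime separately, the form in which anisotropy controls
    denominators. *)
Lemma Zinv_denqP (S : set nat) (x : rat) : (forall p, S p -> prime p) ->
  Zinv S x <-> forall p, prime p -> (p %| `|denq x|)%N -> S p.
Proof.
move=> Sp; split=> [[a [s [sS ->]]] p pp|H].
  have b0 : (0 < \prod_(p <- s) p)%N.
    by rewrite big_seq_cond; apply: prodn_cond_gt0 => q /andP[qs _]; exact/prime_gt0/Sp/sS.
  have : (denq (a%:~R / (\prod_(p <- s) p)%N%:R) %| (\prod_(p <- s) p)%N%:Z)%Z.
    apply: (@denq_dvd _ a); first by rewrite eqz_nat -lt0n.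
    by rewrite -pmulrn divfK // pnatr_eq0 -lt0n.
  rewrite dvdzE => dv pd; have sp q : q \in s -> prime q by move=> qs; exact/Sp/sS.
  by apply: sS; exact: prime_prod_mem pp sp (dvdn_trans pd dv).
have d0 : (0 < `|denq x|)%N by rewrite absz_gt0 denq_neq0.
have [s sE sp] := prime_factorization d0.
exists (numq x), s; split=> [p /sp[]|]; first exact: H.
by rewrite -sE -[(absz _)%:R]/((Posz `|denq x|)%:~R) absz_denq divq_num_den.
Qed.

Lemma Zinv_int (S : set nat) (a : int) : Zinv S a%:~R.
Proof. by exists a, [::]; split=> //; rewrite big_nil divr1. Qed.

Lemma Zinv_subset (S T : set nat) (x : rat) : S `<=` T -> Zinv S x -> Zinv T x.
Proof. by move=> ST [a [s [sS xE]]]; exists a, s; split=> // p /sS/ST. Qed.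

Lemma common_denominator (s : seq rat) : exists2 D : int, D != 0 &
  forall x, x \in s -> exists a : int, x * D%:~R = a%:~R.
Proof.
elim: s => [|y s [D D0 H]]; first by exists 1.
exists (denq y * D); first by rewrite mulf_neq0 ?denq_neq0.
move=> x; rewrite inE rmorphM /= => /orP[/eqP->|/H[a xD]].
  by exists (numq y * D); rewrite mulrA -numqE rmorphM.
by exists (denq y * a); rewrite mulrCA xD rmorphM.
Qed.

Lemma bezout_seq (v : seq int) : exists c : nat -> int, exists g : int,
  \sum_(i < size v) c i * v`_i = g /\ forall i, (g %| v`_i)%Z.
Proof.
elim: v => [|a v [c [g [cE gv]]]]; first by exists (fun=> 0), 0; rewrite big_ord0; split=> // i; rewrite nth_nil.
have [[k l] kl] : {kl | kl.1 * a + kl.2 * g = gcdz a g}.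
  by case: (Bezoutz a g) => k [l kl]; exists (k, l).
exists (fun i => if i is j.+1 then l * c j else k), (gcdz a g); split.
  rewrite /= big_ord_recl /= -kl -cE mulr_sumr; congr (_ + _).
  by apply: eq_bigr => i _; rewrite mulrA.
by case=> [|i] /=; [exact: dvdz_gcdl | apply: dvdz_trans (gv i); exact: dvdz_gcdr].
Qed.

(** * Descent at a prime dividing P exactly once *)

Section Anisotropy.
Variables (p P d : nat).
Hypotheses (pp : prime p) (op : odd p) (pP : (p %| P)%N) (p2P : ~~ (p ^ 2 %| P)%N).
Hypothesis dp : legendre p d = -1.

Lemma legendre_aniso (a b : int) : (p %| a ^+ 2 - d%:Z * b ^+ 2)%Z -> (p %| a)%Z /\ (p %| b)%Z.
Proof.
rewrite -!Fp_int_eq0 // rmorphB rmorphXn (rmorphM _ d%:Z) rmorphXn /= -[(Posz d)%:~R]/(d%:R).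
set x := a%:~R; set y := b%:~R; rewrite subr_eq0 => /eqP e.
have [y0|y0] := eqVneq y 0.
  by move/eqP: e; rewrite y0 expr0n mulr0 expf_eq0 /= => /eqP ->; rewrite eqxx.
have [v vE] : exists v : 'F_p, v = x / y by exists (x / y).
have dE : d%:R = (v * v)%N%:R :> 'F_p.
  by rewrite natrM natr_Zp vE mulrACA -invfM -!expr2 e mulfK // expf_neq0.
have : legendre p d = legendre p (v * v)%N by rewrite /legendre dE.
rewrite dp legendreM //; by case: (legendre_val p v) => ->.
Qed.

(** Modulo p the form is y1^2 - d y3^2; once a factor p is removed, a unit times y2^2 - d (2 u)^2
    remains. Both are anisotropic modulo p. The equation is further multiplied by 4, which is
    harmless as p is odd. *)
Lemma aniso_dvd (y1 y2 y3 u t : int) :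
  y1 ^+ 2 - P%:Z * y2 ^+ 2 - d%:Z * y3 ^+ 2 + 4 * P%:Z * d%:Z * u ^+ 2 = t ^+ 2 ->
  (p %| t)%Z -> [/\ (p %| y1)%Z, (p %| y2)%Z, (p %| y3)%Z & (p %| u)%Z].
Proof.
move=> e /dvdzP[t' tE]; have [j jE] := dvdnP pP.
have pj : ~~ (p %| j)%N.
  by apply: contra p2P => pj; rewrite jE mulnC expnS expn1 dvdn_pmul2l ?prime_gt0.
have [|d1 d3] := @legendre_aniso y1 y3.
  have -> : y1 ^+ 2 - d%:Z * y3 ^+ 2 = (t' ^+ 2 * p%:Z + j%:Z * y2 ^+ 2 - 4 * j%:Z * d%:Z * u ^+ 2) * p%:Z.
    rewrite jE PoszM tE in e; lra.
  exact: dvdz_mull.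
have /dvdzP[z1 z1E] := d1; have /dvdzP[z3 z3E] := d3.
have p0 : p%:Z != 0 by rewrite eqz_nat -lt0n prime_gt0.
have e2 : j%:Z * ((2 * y2) ^+ 2 - d%:Z * (4 * u) ^+ 2) = 4 * p%:Z * (z1 ^+ 2 - d%:Z * z3 ^+ 2 - t' ^+ 2).
  apply: (mulfI p0); rewrite jE PoszM tE z1E z3E in e; lra.
have : (p %| j%:Z * ((2 * y2) ^+ 2 - d%:Z * (4 * u) ^+ 2))%Z.
  by rewrite e2 mulrAC dvdz_mull.
rewrite Gauss_dvdzr; last by rewrite coprimezE !absz_nat prime_coprime.
have p2 : coprime p 2 by rewrite coprimen2.
have c2 : coprimez p (2%:R : int) by rewrite coprimezE.
have c4 : coprimez p (4%:R : int) by rewrite coprimezE; have := coprimeMr p 2 2; rewrite p2.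
move=> /legendre_aniso[]; rewrite (Gauss_dvdzr _ c2) (Gauss_dvdzr _ c4).
by split.
Qed.

(** Infinite descent on the sum of absolute values: while p divides t, all five entries can be
    divided by p. The pair u', t' expresses that u / t is p-integral. *)
Lemma aniso_integral (y1 y2 y3 u t : int) :
  y1 ^+ 2 - P%:Z * y2 ^+ 2 - d%:Z * y3 ^+ 2 + 4 * P%:Z * d%:Z * u ^+ 2 = t ^+ 2 ->
  ~~ [&& y1 == 0, y2 == 0, y3 == 0, u == 0 & t == 0] ->
  t != 0 /\ exists u' t' : int, ~~ (p %| t')%Z /\ u * t' = u' * t.
Proof.
have p1 := prime_gt1 pp.
move: {2}(`|y1| + `|y2| + `|y3| + `|u| + `|t|)%N (leqnn (`|y1| + `|y2| + `|y3| + `|u| + `|t|)%N) => N.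
elim: N y1 y2 y3 u t => [|N IH] y1 y2 y3 u t hN e nz.
  by move: hN nz; rewrite leqn0 !addn_eq0 !absz_eq0 -!andbA => ->.
have [pt|npt] := boolP (p %| t)%Z; last first.
  split; last by exists u, t.
  by apply: contraNneq npt => ->; rewrite dvdz0.
have [/dvdzP[z1 e1] /dvdzP[z2 e2] /dvdzP[z3 e3] /dvdzP[z4 e4]] := aniso_dvd e pt.
have /dvdzP[z5 e5] := pt.
have p0 : p%:Z != 0 by rewrite eqz_nat -lt0n prime_gt0.
move: hN e nz; rewrite e1 e2 e3 e4 e5 !abszM !absz_nat -!mulnDl => hN e nz.
have [|||t0 [u' [t' [pt' ut']]]] := IH z1 z2 z3 z4 z5.
- have : (0 < `|z1| + `|z2| + `|z3| + `|z4| + `|z5|)%N.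
    by rewrite lt0n; apply: contra nz; rewrite !addn_eq0 !absz_eq0 -!andbA => /and5P[/eqP-> /eqP-> /eqP-> /eqP-> /eqP->]; rewrite !mul0r !eqxx.
  by move: hN p1; clear; move: (_ + _)%N => a; nia.
- have p20 : p%:Z ^+ 2 != 0 by rewrite expf_neq0.
  apply: (mulIf p20); rewrite -exprMn -e; ring.
- apply: contra nz => /and5P[/eqP-> /eqP-> /eqP-> /eqP-> /eqP->]; by rewrite !mul0r !eqxx.
split; first by rewrite mulf_neq0.
by exists u', t'; split=> //; rewrite mulrAC ut' -mulrA.
Qed.
End Anisotropy.

(* V = (t, y1, y2, y3, u, y1', y2', y3', w): for t != 0 the first two equations
   make u/t and w/t integral at the prime divisors of P, and x is their quotient
   (u/t) / (1 + P w/t).  The last equation excludes V = 0. *)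
Definition integrality_system (P d : nat) (x : rat) (V c : nat -> rat) : Prop :=
  [/\ V 1%N ^+ 2 - P%:R * V 2 ^+ 2 - d%:R * V 3 ^+ 2 + 4 * P%:R * d%:R * V 4 ^+ 2 = V 0%N ^+ 2,
      V 5 ^+ 2 - P%:R * V 6 ^+ 2 - d%:R * V 7 ^+ 2 + 4 * P%:R * d%:R * V 8 ^+ 2 = V 0%N ^+ 2,
      x * (V 0%N + P%:R * V 8) = V 4
    & \sum_(j < 9) c j * V j = 1].

Lemma aniso_rat (p P d : nat) (y1 y2 y3 u t : rat) : prime p -> odd p -> (p %| P)%N ->
  ~~ (p ^ 2 %| P)%N -> legendre p d = -1 ->
  y1 ^+ 2 - P%:R * y2 ^+ 2 - d%:R * y3 ^+ 2 + 4 * P%:R * d%:R * u ^+ 2 = t ^+ 2 ->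
  ~~ [&& y1 == 0, y2 == 0, y3 == 0, u == 0 & t == 0] ->
  t != 0 /\ exists u' t' : int, ~~ (p %| t')%Z /\ u * t'%:~R = u'%:~R * t.
Proof.
move=> pp op pP p2P dp e nz.
have [D D0 hD] := common_denominator [:: y1; y2; y3; u; t].
have [|a1 e1] := hD y1; first by rewrite ?inE ?eqxx //.
have [|a2 e2] := hD y2; first by rewrite ?inE ?eqxx ?orbT //.
have [|a3 e3] := hD y3; first by rewrite ?inE ?eqxx ?orbT //.
have [|b eb] := hD u; first by rewrite ?inE ?eqxx ?orbT //.
have [|s es] := hD t; first by rewrite ?inE ?eqxx ?orbT //.
have DR : (D%:~R : rat) != 0 by rewrite intr_eq0.
have z0 (z : rat) (a : int) : z * D%:~R = a%:~R -> (a == 0) = (z == 0).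
  by move=> h; rewrite -(intr_eq0 rat) -h mulf_eq0 (negPf DR) orbF.
have eI : a1 ^+ 2 - P%:Z * a2 ^+ 2 - d%:Z * a3 ^+ 2 + 4 * P%:Z * d%:Z * b ^+ 2 = s ^+ 2.
  apply: (@intr_inj rat); rewrite !(rmorphXn, rmorph_nat, rmorphB, rmorphD, rmorphM) /=.
  rewrite -!pmulrn -e1 -e2 -e3 -eb -es !exprMn -e; ring.
have [|s0 [u' [t' [pt' ut']]]] := aniso_integral pp op pP p2P dp eI.
  by rewrite (z0 _ _ e1) (z0 _ _ e2) (z0 _ _ e3) (z0 _ _ eb) (z0 _ _ es).
split; first by rewrite -(z0 _ _ es).
exists u', t'; split=> //; apply: (mulIf DR).
by rewrite mulrAC eb -mulrA es -!rmorphM ut'.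
Qed.

Lemma integrality_system_sound (A : seq nat) (d : nat) (x : rat) (V c : nat -> rat) (p : nat) :
  uniq A -> (forall p, p \in A -> prime p /\ odd p) ->
  (forall p, p \in A -> legendre p d = -1) -> p \in A ->
  integrality_system (\prod_(p <- A) p)%N d x V c -> ~~ (p %| `|denq x|)%N.
Proof.
move=> uA hA dA pA [e1 e2 e3 e4]; have [pp op] := hA _ pA.
have [sP dvP] := squarefree_prod uA (fun p h => proj1 (hA p h)).
set P := (\prod_(p <- A) p)%N in e1 e2 e3 sP dvP.
have pP : (p %| P)%N by rewrite dvP.
have aniso := aniso_rat pp op pP (sP _ pp) (dA _ pA).
(* If t were 0, anisotropy would annihilate both solutions, and the Bezout equation would read 0 =
   1. *)
have t0 : V 0%N != 0.
  apply/negP => /eqP t0; rewrite t0 in e1 e2.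
  have h1 : [&& V 1%N == 0, V 2 == 0, V 3 == 0, V 4 == 0 & (0 : rat) == 0].
    by apply/negPn/negP => /(aniso _ _ _ _ _ e1)[]; rewrite eqxx.
  have h2 : [&& V 5 == 0, V 6 == 0, V 7 == 0, V 8 == 0 & (0 : rat) == 0].
    by apply/negPn/negP => /(aniso _ _ _ _ _ e2)[]; rewrite eqxx.
  move: e4; rewrite !big_ord_recr big_ord0 /=.
  move/and5P: h1 => [/eqP-> /eqP-> /eqP-> /eqP-> _]; move/and5P: h2 => [/eqP-> /eqP-> /eqP-> /eqP-> _].
  rewrite t0 !mulr0 !addr0 => /eqP; by rewrite eq_sym oner_eq0.
have [|_ [u [s [ps us]]]] := aniso _ _ _ _ _ e1; first by rewrite (negPf t0) !andbF.
have [|_ [w [r [pr wr]]]] := aniso _ _ _ _ _ e2; first by rewrite (negPf t0) !andbF.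
have pz := fun a b => Euclid_dvdM `|a|%N `|b|%N pp.
(* x is (u/s) / (1 + P w/r); over the denominator (r + P w) s it is p-integral, since p divides P
   but neither r nor s. *)
have key : x * ((r + P%:Z * w) * s)%:~R = (u * r)%:~R.
  apply: (mulIf t0); rewrite !rmorphM rmorphD rmorphM /= -pmulrn.
  transitivity (r%:~R * (u%:~R * V 0%N)); last by ring.
  rewrite -us -e3.
  transitivity (x * s%:~R * (r%:~R * V 0%N + P%:R * (w%:~R * V 0%N))); first by ring.
  by rewrite -wr; ring.
have npb : ~~ (p %| (r + P%:Z * w) * s)%Z.
  rewrite dvdzE abszM absz_nat Euclid_dvdM // negb_or; apply/andP; split=> //.
  apply: contra pr => h; have -> : r = (r + P%:Z * w) - P%:Z * w by ring.
  by apply: rpredB; [rewrite dvdzE | rewrite dvdz_mulr // dvdzE].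
have b0 : (r + P%:Z * w) * s != 0 by apply: contraNneq npb => ->; rewrite dvdz0.
have := denq_dvd b0 key; rewrite dvdzE => h; apply: contra npb => pd.
by rewrite dvdzE absz_nat (dvdn_trans pd).
Qed.

Lemma integrality_system_complete (R : realType) (A : seq nat) (d : nat) (x : rat) :
  uniq A -> A != [::] -> (forall p, p \in A -> prime p /\ odd p) ->
  prime d -> (d %% 4 = 1)%N -> (forall p, p \in A -> legendre p d = -1) ->
  (forall p, p \in A -> ~~ (p %| `|denq x|)%N) ->
  exists V c : nat -> int,
    integrality_system (\prod_(p <- A) p)%N d x (fun j => (V j)%:~R) (fun j => (c j)%:~R).
Proof.
move=> uA nA hA dp d4 dA xA.
have rep := ternary_rep R _ uA nA hA dp d4 dA; rewrite /= in rep.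
have [sP dvP] := squarefree_prod uA (fun p h => proj1 (hA p h)).
set P := (\prod_(p <- A) p)%N in rep sP dvP *.
have cop : coprimez (denq x) P.
  rewrite coprimezE absz_nat /P big_seq.
  apply: (big_ind (fun k => coprime `|denq x| k)) => [|a b|q qA]; first exact: coprimen1.
    by rewrite coprimeMr => -> ->.
  by have [qp _] := hA _ qA; rewrite coprime_sym prime_coprime // xA.
(* From k [denq x] + l P = 1, x is the quotient of the integer [numq x] k by 1 + P (-l); these
   supply u/t and w/t. *)
have /coprimezP[[k l] /= kl] := cop.
have [t1 [a1 [a2 [a3 [t10 ea]]]]] := rep (numq x * k).
have [t2 [b1 [b2 [b3 [t20 eb]]]]] := rep (- l).
pose t := t1 * t2; have t0 : t != 0 by rewrite mulf_neq0.
pose v := [:: t; a1 * t2; a2 * t2; a3 * t2; numq x * k * t; b1 * t1; b2 * t1; b3 * t1; - l * t].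
have [c [g [cg gv]]] := bezout_seq v.
have g0 : g != 0.
  by apply: contraNneq t0 => g0; have := gv 0%N; rewrite g0 dvd0z.
(* The first three equations are homogeneous in V, so both representations can share one t and be
   divided by the gcd g; this makes the Bezout combination equal to 1. *)
pose V j := (v`_j %/ g)%Z.
have VE j : V j * g = v`_j by rewrite divzK.
have q1 : V 1%N ^+ 2 - P%:Z * V 2 ^+ 2 - d%:Z * V 3 ^+ 2 + 4 * P%:Z * d%:Z * V 4 ^+ 2 = V 0%N ^+ 2.
  apply: (mulIf (expf_neq0 2 g0)).
  transitivity ((V 1%N * g) ^+ 2 - P%:Z * (V 2 * g) ^+ 2 - d%:Z * (V 3 * g) ^+ 2 + 4 * P%:Z * d%:Z * (V 4 * g) ^+ 2); first by ring.
  rewrite -exprMn !VE /= /t; apply/eqP; rewrite -subr_eq0; apply/eqP.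
  transitivity ((a1 ^+ 2 - P%:Z * a2 ^+ 2 - d%:Z * a3 ^+ 2 + 4 * P%:Z * d%:Z * (numq x * k * t1) ^+ 2 - t1 ^+ 2) * t2 ^+ 2).
    by ring.
  by rewrite ea subrr mul0r.
have q2 : V 5%N ^+ 2 - P%:Z * V 6 ^+ 2 - d%:Z * V 7 ^+ 2 + 4 * P%:Z * d%:Z * V 8 ^+ 2 = V 0%N ^+ 2.
  apply: (mulIf (expf_neq0 2 g0)).
  transitivity ((V 5 * g) ^+ 2 - P%:Z * (V 6 * g) ^+ 2 - d%:Z * (V 7 * g) ^+ 2 + 4 * P%:Z * d%:Z * (V 8 * g) ^+ 2); first by ring.
  rewrite -exprMn !VE /= /t; apply/eqP; rewrite -subr_eq0; apply/eqP.
  transitivity ((b1 ^+ 2 - P%:Z * b2 ^+ 2 - d%:Z * b3 ^+ 2 + 4 * P%:Z * d%:Z * (- l * t2) ^+ 2 - t2 ^+ 2) * t1 ^+ 2).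
    by ring.
  by rewrite eb subrr mul0r.
have q3 : numq x * (V 0%N + P%:Z * V 8) = denq x * V 4.
  apply: (mulIf g0); transitivity (numq x * (V 0%N * g + P%:Z * (V 8 * g))); first by ring.
  rewrite -mulrA !VE /=.
  transitivity (numq x * t * (1 - l * P%:Z)); first by ring.
  by rewrite -kl; ring.
have DR : ((denq x)%:~R : rat) != 0 by rewrite intr_eq0 denq_neq0.
exists V, c; split.
- have := congr1 (fun z : int => z%:~R : rat) q1.
  by rewrite !(rmorphXn, rmorph_nat, rmorphB, rmorphD, rmorphM) /= -!pmulrn.
- have := congr1 (fun z : int => z%:~R : rat) q2.
  by rewrite !(rmorphXn, rmorph_nat, rmorphB, rmorphD, rmorphM) /= -!pmulrn.
- apply: (mulfI DR); rewrite mulrA [_ * x]mulrC -numqE -rmorphM -q3 !(rmorphD, rmorphM) /=.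
  by rewrite -!pmulrn.
- have : \sum_(j < 9) c j * V j = 1.
    apply: (mulIf g0); rewrite mulr_suml mul1r -[RHS]cg; apply: eq_bigr => i _.
    by rewrite -mulrA VE.
  move=> /(congr1 (fun z : int => z%:~R : rat)); rewrite rmorph_sum /= => h.
  transitivity (1%:~R : rat) => //; rewrite -h; apply: eq_bigr => i _.
  by rewrite rmorphM.
Qed.

(** * Polynomial systems as indices *)

(* A polynomial in the variables x_0, x_1, ... as a list of terms: a coefficient
   and the list, with repetition, of the variables of the monomial. *)
Definition vpoly := seq (int * seq nat).

Definition veval (x : nat -> rat) (p : vpoly) : rat :=
  \sum_(a <- p) a.1%:~R * \prod_(j <- a.2) x j.

Definition vmul (p q : vpoly) : vpoly :=
  [seq (a.1 * b.1, a.2 ++ b.2) | a <- p, b <- q].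

Definition nat_of_int (z : int) : nat :=
  match z with Posz m => m.*2 | Negz m => m.*2.+1 end.

Lemma nat_of_intK : cancel nat_of_int int_of_nat.
Proof. by case=> m; rewrite /int_of_nat /= odd_double ?doubleK //= uphalf_double. Qed.

Definition vindex (N : nat) (p : vpoly) : nat :=
  CodeSeq.code (N :: [seq CodeSeq.code (nat_of_int a.1 ::
    [seq count_mem j a.2 | j <- iota 0 N]) | a <- p]).

Definition vterm (n : nat) (s : seq nat) : int * seq nat :=
  (int_of_nat (head 0%N s), flatten [seq nseq (nth 0%N (behead s) i) i | i <- iota 0 n]).

Definition of_index (e : nat) : vpoly :=
  [seq vterm (index_nvars e) (CodeSeq.decode t) | t <- behead (CodeSeq.decode e)].

Lemma veval_cat x p q : veval x (p ++ q) = veval x p + veval x q.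
Proof. exact: big_cat. Qed.

Lemma veval_mul x p q : veval x (vmul p q) = veval x p * veval x q.
Proof.
rewrite /veval /vmul big_allpairs_dep mulr_suml; apply: eq_bigr => a _.
rewrite mulr_sumr; apply: eq_bigr => b _ /=.
by rewrite intrM big_cat /=; ring.
Qed.

Lemma veval_flatten x (ps : seq vpoly) : veval x (flatten ps) = \sum_(p <- ps) veval x p.
Proof.
elim: ps => [|p ps IH]; first by rewrite /veval !big_nil.
by rewrite /= veval_cat IH big_cons.
Qed.

Lemma prod_nseq_flatten (x : nat -> rat) (f : nat -> nat) (n : nat) :
  \prod_(j <- flatten [seq nseq (f i) i | i <- iota 0 n]) x j = \prod_(i < n) x i ^+ f i.
Proof.
rewrite -(big_mkord predT (fun i => x i ^+ f i)) /index_iota subn0.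
elim: (iota 0 n) => [|i s IH]; first by rewrite !big_nil.
rewrite /= big_cat big_cons IH /=; congr (_ * _).
by rewrite big_nseq -Monoid.iteropE.
Qed.

Lemma index_polyE (e : nat) (x : nat -> rat) :
  (map_mpoly intr (index_poly e)).@[fun i => x i] = veval x (of_index e).
Proof.
rewrite /index_poly /veval /of_index big_map (raddf_sum (map_mpoly intr)) /= (raddf_sum (meval _)) /=.
apply: eq_bigr => t _; rewrite /index_monomial /vterm /= prod_nseq_flatten.
rewrite map_mpolyZ mevalZ map_mpolyX mevalX; congr (_ * _).
by apply: eq_bigr => i _; rewrite mnmE.
Qed.

Lemma HTP_veval (R : set rat) (e : nat) : HTP R e <->
  exists x : nat -> rat, (forall i, (i < index_nvars e)%N -> R (x i)) /\ veval x (of_index e) = 0.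
Proof.
split=> [[v [Rv ev]]|[x [Rx ex]]]; last first.
  by exists (fun i => x i); split=> [i|]; [exact: Rx | rewrite index_polyE].
pose x i := if insub i is Some j then v j else 0.
have xE (i : 'I_(index_nvars e)) : x i = v i by rewrite /x valK.
exists x; split=> [i ie|]; first by rewrite (xE (Ordinal ie)).
by rewrite -index_polyE -[RHS]ev; congr (_.@[_]); apply: funext.
Qed.

Lemma index_nvars_vindex N p : index_nvars (vindex N p) = N.
Proof. by rewrite /index_nvars /vindex CodeSeq.codeK. Qed.

Lemma veval_vindex N p x : (forall a, a \in p -> all (fun j => (j < N)%N) a.2) ->
  veval x (of_index (vindex N p)) = veval x p.
Proof.
move=> pN; have bh (h : nat) (s : seq nat) : behead (h :: s) = s by [].
rewrite /veval /of_index index_nvars_vindex /vindex CodeSeq.codeK bh !big_map !big_seq.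
apply: eq_bigr => a /pN aN; rewrite CodeSeq.codeK /vterm /= nat_of_intK prod_nseq_flatten.
congr (_ * _); rewrite -(big_mkord predT (fun i => x i ^+ nth 0%N _ i)).
rewrite (eq_big_nat _ _ (F2 := fun i => x i ^+ count_mem i a.2)) => [|i /andP[_ iN]]; last first.
  by rewrite (nth_map 0%N) ?size_iota // nth_iota.
rewrite /index_iota subn0; elim: a.2 aN => [|j s IH] /=.
  by rewrite big_nil big1.
move=> /andP[jN /IH {}IH]; rewrite big_cons -IH.
under eq_bigr do rewrite exprD; rewrite big_split /=; congr (_ * _).
rewrite (bigD1_seq j) ?iota_uniq ?mem_iota //= eqxx expr1 big1 ?mulr1 // => i ij.
by rewrite eq_sym (negPf ij).
Qed.

(* The variables o, ..., o+8 stand for V and o+9, ..., o+17 for the coefficients c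
   of the integrality system, whose four equations these are. *)
Definition system_polys (P d i o : nat) : seq vpoly :=
  let v j := (o + j)%N in
  [:: [:: (1, [:: v 1%N; v 1%N]); (- P%:Z, [:: v 2%N; v 2%N]); (- d%:Z, [:: v 3%N; v 3%N]);
          ((4 * P * d)%N%:Z, [:: v 4%N; v 4%N]); (-1, [:: v 0%N; v 0%N])];
      [:: (1, [:: v 5%N; v 5%N]); (- P%:Z, [:: v 6%N; v 6%N]); (- d%:Z, [:: v 7%N; v 7%N]);
          ((4 * P * d)%N%:Z, [:: v 8%N; v 8%N]); (-1, [:: v 0%N; v 0%N])];
      [:: (1, [:: i; v 0%N]); (P%:Z, [:: i; v 8%N]); (-1, [:: v 4%N])];
      (-1, [::]) :: [seq (1, [:: (o + 9 + j)%N; v j]) | j <- iota 0 9]].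

Definition system_offset (n i : nat) := (n + 18 * i)%N.

(** The sum of the squares combines the system into one polynomial, as a sum of squares in Q
    vanishes only termwise. Each of the n variables has 18 auxiliary unknowns of its own, hence 19 n
    variables. *)
Definition reduced_poly (P d : nat) (n : nat) (f : vpoly) : vpoly :=
  flatten [seq vmul g g | g <- f :: flatten
    [seq system_polys P d i (system_offset n i) | i <- iota 0 n]].

Definition reduced_index (P d e : nat) : nat :=
  vindex (19 * index_nvars e) (reduced_poly P d (index_nvars e) (of_index e)).

Lemma system_polysP P d i o (x : nat -> rat) :
  (forall g, g \in system_polys P d i o -> veval x g = 0) <->
  integrality_system P d (x i) (fun j => x (o + j)%N) (fun j => x (o + 9 + j)%N).
Proof.
set g1 := nth [::] (system_polys P d i o) 0; set g2 := nth [::] (system_polys P d i o) 1.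
set g3 := nth [::] (system_polys P d i o) 2; set g4 := nth [::] (system_polys P d i o) 3.
have E1 : veval x g1 = x (o + 1)%N ^+ 2 - P%:R * x (o + 2)%N ^+ 2 - d%:R * x (o + 3)%N ^+ 2
    + 4 * P%:R * d%:R * x (o + 4)%N ^+ 2 - x (o + 0)%N ^+ 2.
  by rewrite /veval /g1 /= !big_cons !big_nil /= !PoszM !(rmorphM, rmorphN) /= -!pmulrn; ring.
have E2 : veval x g2 = x (o + 5)%N ^+ 2 - P%:R * x (o + 6)%N ^+ 2 - d%:R * x (o + 7)%N ^+ 2
    + 4 * P%:R * d%:R * x (o + 8)%N ^+ 2 - x (o + 0)%N ^+ 2.
  by rewrite /veval /g2 /= !big_cons !big_nil /= !PoszM !(rmorphM, rmorphN) /= -!pmulrn; ring.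
have E3 : veval x g3 = x i * (x (o + 0)%N + P%:R * x (o + 8)%N) - x (o + 4)%N.
  by rewrite /veval /g3 /= !big_cons !big_nil /= !(rmorphM, rmorphN) /= -!pmulrn; ring.
have E4 : veval x g4 = \sum_(j < 9) x (o + 9 + j)%N * x (o + j)%N - 1.
  by rewrite /veval /g4 !big_ord_recr big_ord0 /= !big_cons !big_nil /= !rmorphN /=; ring.
have gE : system_polys P d i o = [:: g1; g2; g3; g4] by [].
rewrite gE; split=> [H|[e1 e2 e3 e4] g].
  have := H g1; have := H g2; have := H g3; have := H g4.
  rewrite E1 E2 E3 E4 !inE !eqxx !orbT => h4 h3 h2 h1.
  by split; apply/eqP; rewrite -subr_eq0; apply/eqP; auto.
by rewrite !inE => /or4P[] /eqP ->; rewrite ?E1 ?E2 ?E3 ?E4 ?e1 ?e2 ?e3 ?e4 subrr.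
Qed.

Lemma reduced_polyP P d n f (x : nat -> rat) :
  veval x (reduced_poly P d n f) = 0 <->
  veval x f = 0 /\ forall i, (i < n)%N -> integrality_system P d (x i)
    (fun j => x (system_offset n i + j)%N) (fun j => x (system_offset n i + 9 + j)%N).
Proof.
rewrite /reduced_poly veval_flatten big_map.
under eq_bigr do rewrite veval_mul -expr2.
split=> [/eqP|[f0 H]].
  rewrite psumr_eq0 => [/allP H|g _]; last exact: sqr_ge0.
  have {}H g : g \in f :: flatten [seq system_polys P d i (system_offset n i) | i <- iota 0 n] ->
      veval x g = 0 by move=> /H /=; rewrite sqrf_eq0 => /eqP.
  split=> [|i ni]; first by apply: H; rewrite mem_head.
  apply/system_polysP => g gi; apply: H; rewrite inE; apply/orP; right.
  by apply/flatten_mapP; exists i; rewrite // mem_iota.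
rewrite big_seq big1 // => g; rewrite inE => /orP[/eqP->|]; first by rewrite f0 expr0n.
by move=> /flatten_mapP[i]; rewrite mem_iota => /H/system_polysP hg /hg ->; rewrite expr0n.
Qed.

(** [vindex N] records only the exponents of variables below N, so it represents its polynomial
    faithfully under this bound. *)
Definition vbounded (N : nat) (p : vpoly) := all (fun a => all (fun j => j < N)%N a.2) p.

Lemma vbounded_of_index e : vbounded (index_nvars e) (of_index e).
Proof.
apply/allP => a /mapP[t _ ->]; apply/allP => j /flatten_mapP[i].
by rewrite mem_iota => /andP[_ ni] /nseqP[-> _].
Qed.

Lemma vbounded_mul N p q : vbounded N p -> vbounded N q -> vbounded N (vmul p q).
Proof.
move=> /allP hp /allP hq; apply/allP => a /allpairsP[[b c] [/hp hb /hq hc ->]].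
by rewrite all_cat hb.
Qed.

Lemma vbounded_reduced P d n f : vbounded n f -> vbounded (19 * n) (reduced_poly P d n f).
Proof.
move=> hf; have hn : (n <= 19 * n)%N by rewrite leq_pmull.
apply/allP => a /flatten_mapP[g hg ga].
suff h : vbounded (19 * n) g by exact: (allP (vbounded_mul h h)).
move: hg; rewrite inE => /orP[/eqP->|].
  by apply: sub_all hf => b; apply: sub_all => j jn; exact: leq_trans hn.
move=> /flatten_mapP[i]; rewrite mem_iota => /andP[_ ni].
have o18 j : (j < 18)%N -> (system_offset n i + j < 19 * n)%N.
  by move: ni; rewrite /system_offset add0n; clear; lia.
have oi : (i < 19 * n)%N by apply: leq_trans hn.
have o9 j : (j < 9)%N -> (system_offset n i + 9 + j < 19 * n)%N.
  by move=> j9; rewrite -addnA; apply: o18; move: j9; clear; lia.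
by rewrite !inE => /or4P[] /eqP ->; rewrite /vbounded /= ?o18 ?o9 ?oi.
Qed.

Lemma eq_veval (x y : nat -> rat) (N : nat) (p : vpoly) : vbounded N p ->
  (forall j, (j < N)%N -> x j = y j) -> veval x p = veval y p.
Proof.
move=> /allP hp xy; rewrite /veval !big_seq; apply: eq_bigr => a /hp/allP ha.
by rewrite !big_seq; congr (_ * _); apply: eq_bigr => j /ha/xy.
Qed.

(** Forward, soundness removes the primes of A from the denominators of the original variables.
    Backward, the auxiliary unknowns are integers and so belong to Z[W^-1] whatever W is. *)
Lemma HTP_reduced_index (R : realType) (W : set nat) (A : seq nat) (d e : nat) :
  (forall p, W p -> prime p) -> uniq A -> A != [::] ->
  (forall p, p \in A -> prime p /\ odd p) -> prime d -> (d %% 4 = 1)%N ->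
  (forall p, p \in A -> legendre p d = -1) ->
  HTP (Zinv W) (reduced_index (\prod_(p <- A) p)%N d e) <->
  HTP (Zinv (W `\` [set` A])) e.
Proof.
move=> Wp uA nA hA dp d4 dA; set n := index_nvars e; set P := (\prod_(p <- A) p)%N.
have bf := vbounded_of_index e; have br := vbounded_reduced P d bf.
have WAp p : (W `\` [set` A]) p -> prime p by move=> [/Wp].
rewrite !HTP_veval index_nvars_vindex -/n; split=> [[x [Wx]]|[x [Wx fx]]].
  rewrite veval_vindex; last by move=> a /(allP br).
  move=> /reduced_polyP[fx sys]; exists x; split=> // i ni.
  have in_ : (i < 19 * n)%N by apply: leq_trans ni _; rewrite leq_pmull.
  apply/(Zinv_denqP _ WAp) => p pp pd; split.
    by have /(Zinv_denqP _ Wp) := Wx _ in_; apply.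
  by move=> /= pA; have := integrality_system_sound uA hA dA pA (sys _ ni); rewrite pd.
have ex i : exists VC : (nat -> int) * (nat -> int), (i < n)%N ->
    integrality_system P d (x i) (fun j => (VC.1 j)%:~R) (fun j => (VC.2 j)%:~R).
  have [ni|ni] := ltnP i n; last by exists (fun=> 0, fun=> 0).
  have [p pA|V [c h]] := integrality_system_complete (x := x i) R uA nA hA dp d4 dA; last by exists (V, c).
  apply/negP => pd; have [pp _] := hA _ pA.
  have /(Zinv_denqP _ WAp)/(_ p pp pd) := Wx _ ni.
  by move=> [_]; apply.
have [VC hVC] := choice ex.
pose y k : rat := if (k < n)%N then x k else
  let i := ((k - n) %/ 18)%N in let j := ((k - n) %% 18)%N in
  (if (j < 9)%N then (VC i).1 j else (VC i).2 (j - 9)%N)%:~R.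
have yx k : (k < n)%N -> y k = x k by rewrite /y => ->.
have yo i j : (j < 18)%N -> y (system_offset n i + j)%N =
    (if (j < 9)%N then (VC i).1 j else (VC i).2 (j - 9)%N)%:~R.
  move=> j18; rewrite /y /system_offset -addnA ltnNge leq_addr /= addKn mulnC.
  by rewrite divnMDl // modnMDl divn_small // modn_small // addn0.
exists y; split=> [k kn|].
  by rewrite /y; case: ifP => [/Wx|_]; [apply: Zinv_subset => ? [] | exact: Zinv_int].
rewrite veval_vindex; last by move=> a /(allP br).
apply/reduced_polyP; split=> [|i ni]; first by rewrite (eq_veval bf yx).
have e1 j : (j < 9)%N -> y (system_offset n i + j)%N = ((VC i).1 j)%:~R.
  by move=> j9; rewrite yo ?j9 // (leq_trans j9).
have e2 j : (j < 9)%N -> y (system_offset n i + 9 + j)%N = ((VC i).2 j)%:~R.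
  move=> j9; have h : (9 + j < 18)%N by move: j9; clear; lia.
  by rewrite -addnA (yo _ _ h) ltnNge leq_addr /= addKn.
have [h1 h2 h3 h4] := hVC i ni; split; rewrite ?e1 ?(yx _ ni) //.
by rewrite -[RHS]h4; apply: eq_bigr => j _; rewrite e1 ?e2.
Qed.

(** * Mu-recursive programs *)

Local Open Scope nat_scope.

(** The empty oracle always answers 0, as [PZero] does; the replacement carries oracle-free
    computations over to any oracle. *)
Fixpoint unoracle (p : prog) : prog :=
  match p with
  | POracle => PZero
  | PComp f gs => PComp (unoracle f) [seq unoracle g | g <- gs]
  | PPrec f g => PPrec (unoracle f) (unoracle g)
  | PMu f => PMu (unoracle f)
  | q => q
  end.

Fixpoint sem_unoracle (O : set nat) (p : prog) : forall xs y, sem set0 p xs y -> sem O (unoracle p) xs y.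
Proof.
have no (b : nat) : nat_of_bool `[< (set0 : set nat) b >] = 0 by case: asboolP.
case: p => [||i||f gs|f g|f] xs y //=.
- by move=> ->; rewrite no.
- move=> [ys [gsys fy]]; exists ys; split; last exact: sem_unoracle.
  move: ys gsys {fy}; elim: gs => [|g gs IH] ys h; inversion h; subst; constructor.
    exact: sem_unoracle.
  exact: IH.
- move=> [r [h0 hS ->]]; exists r; split=> //; first exact: sem_unoracle.
  by move=> i ih; apply: sem_unoracle; exact: hS.
- move=> [h0 hlt]; split; first exact: sem_unoracle.
  by move=> z zy; have [k hk] := hlt z zy; exists k; exact: sem_unoracle.
Qed.

Section Raw.
Variable O : set nat.

Definition raw1 (f : nat -> nat) := exists p, forall x, sem O p [:: x] (f x).
Definition raw2 (f : nat -> nat -> nat) := exists p, forall x y, sem O p [:: x; y] (f x y).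

Lemma sem_comp1 f g xs a y : sem O g xs a -> sem O f [:: a] y -> sem O (PComp f [:: g]) xs y.
Proof. by move=> ga fy; exists [:: a]; split=> //; repeat constructor. Qed.

Lemma sem_comp2 f g h xs a b y : sem O g xs a -> sem O h xs b -> sem O f [:: a; b] y ->
  sem O (PComp f [:: g; h]) xs y.
Proof. by move=> ga hb fy; exists [:: a; b]; split=> //; repeat constructor. Qed.

Lemma sem_comp3 f g h k xs a b c y : sem O g xs a -> sem O h xs b -> sem O k xs c ->
  sem O f [:: a; b; c] y -> sem O (PComp f [:: g; h; k]) xs y.
Proof. by move=> ga hb kc fy; exists [:: a; b; c]; split=> //; repeat constructor. Qed.

Lemma raw_const c : exists p, forall xs, sem O p xs c.
Proof.
elim: c => [|c [p hp]]; first by exists PZero.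
by exists (PComp PSucc [:: p]) => xs; exact: sem_comp1 (hp xs) _.
Qed.

Lemma raw1_comp2 F f g : raw2 F -> raw1 f -> raw1 g -> raw1 (fun x => F (f x) (g x)).
Proof.
move=> [pF hF] [pf hf] [pg hg]; exists (PComp pF [:: pf; pg]) => x.
exact: sem_comp2 (hf x) (hg x) (hF _ _).
Qed.

Lemma raw1_comp f g : raw1 f -> raw1 g -> raw1 (fun x => f (g x)).
Proof. by move=> [pf hf] [pg hg]; exists (PComp pf [:: pg]) => x; exact: sem_comp1 (hg x) (hf _). Qed.

Lemma raw1_id : raw1 id.
Proof. by exists (PProj 0). Qed.

Lemma raw2_iter h : raw1 h -> raw2 (fun n x => iter n h x).
Proof.
move=> [p hp]; exists (PPrec (PProj 0) (PComp p [:: PProj 1])) => n x.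
exists (fun i => iter i h x); split=> // i _.
by apply: sem_comp1 (hp _).
Qed.

Lemma raw2_swap F : raw2 F -> raw2 (fun x y => F y x).
Proof. by move=> [p hp]; exists (PComp p [:: PProj 1; PProj 0]) => x y; exact: sem_comp2 (hp _ _). Qed.

Lemma raw1_succ : raw1 succn.
Proof. by exists PSucc. Qed.

Lemma raw1_pred : raw1 predn.
Proof. by exists (PPrec PZero (PProj 0)) => n; exists predn. Qed.

Lemma raw2_ext F G : (forall x y, F x y = G x y) -> raw2 F -> raw2 G.
Proof. by move=> FG [p hp]; exists p => x y; rewrite -FG. Qed.

Lemma raw1_ext f g : (forall x, f x = g x) -> raw1 f -> raw1 g.
Proof. by move=> fg [p hp]; exists p => x; rewrite -fg. Qed.

Lemma raw2_add : raw2 addn.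
Proof.
by apply: raw2_ext (raw2_iter raw1_succ) => x y; elim: x => //= x ->.
Qed.

Lemma raw2_sub : raw2 subn.
Proof.
apply: raw2_ext (raw2_swap (raw2_iter raw1_pred)) => x y.
by elim: y => [|y IH] /=; rewrite ?subn0 // IH subnS.
Qed.

Lemma raw1_double : raw1 double.
Proof. by apply: raw1_ext (raw1_comp2 raw2_add raw1_id raw1_id) => x; rewrite addnn. Qed.

Lemma raw1_half : raw1 half.
Proof.
have [ps hs] := raw2_sub; exists (PPrec PZero (PComp ps [:: PProj 0; PProj 1])) => n.
exists half; split=> // i _; apply: sem_comp2 => //.
have -> : i.+1./2 = i - i./2 by rewrite -[X in X - _]odd_double_half; have := uphalf_half i; lia.
exact: hs.
Qed.

Lemma raw1_odd : raw1 (fun n => odd n).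
Proof.
have [ps hs] := raw2_sub; have [p1 h1] := raw_const 1.
exists (PPrec PZero (PComp ps [:: p1; PProj 1])) => n.
exists (fun n => odd n); split=> // i _; apply: (sem_comp2 (h1 _)) => //.
have -> : nat_of_bool (~~ odd i) = 1 - odd i by case: odd.
exact: hs.
Qed.

Definition pcode (a b : nat) := 2 ^ a * b.*2.+1.

Lemma raw2_pcode : raw2 pcode.
Proof.
have [pi hi] := raw2_iter raw1_double; have [ps hs] := raw1_comp raw1_succ raw1_double.
exists (PComp pi [:: PProj 0; PComp ps [:: PProj 1]]) => a b.
apply: (@sem_comp2 _ _ _ _ a b.*2.+1) => //; first exact: sem_comp1 (hs b).
have -> : pcode a b = iter a double b.*2.+1; last exact: hi.
by rewrite /pcode; elim: a => [|a IH]; rewrite ?mul1n // expnS -mulnA IH mul2n.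
Qed.

(* [pcode a b] is [CodeSeq.code] of a list with head a and tail of code b. *)
Definition pfst (c : nat) := logn 2 c.
Definition psnd (c : nat) := (iter (pfst c) half c)./2.

Lemma iter_half_pow a b : iter a half (2 ^ a * b) = b.
Proof.
elim: a b => [|a IH] b; first by rewrite mul1n.
by rewrite iterSr expnS -mulnA mul2n doubleK IH.
Qed.

Lemma pcodeK1 a b : pfst (pcode a b) = a.
Proof.
by rewrite /pfst /pcode lognM ?expn_gt0 // pfactorK // lognE dvdn2 /= odd_double addn0.
Qed.

Lemma pcodeK2 a b : psnd (pcode a b) = b.
Proof. by rewrite /psnd pcodeK1 /pcode iter_half_pow /= uphalf_double. Qed.

Lemma psnd0 : psnd 0 = 0.
Proof. by rewrite /psnd /pfst logn0. Qed.

Lemma raw1_pfst : raw1 pfst.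
Proof.
have [pi hi] := raw2_iter raw1_half; have [po ho] := raw1_odd.
have [ps hs] := raw2_sub; have [pa ha] := raw2_add; have [p1 h1] := raw_const 1.
(* c + (1 - c) is the maximum of c and 1: the search for the first odd iterated half would not halt
   at 0, where [logn] is 0 as it is at 1. *)
pose pc := PComp pa [:: PProj 1; PComp ps [:: p1; PProj 1]].
pose pt := PComp ps [:: p1; PComp po [:: PComp pi [:: PProj 0; pc]]].
exists (PMu pt) => c.
have hc k : sem O pc [:: k; c] (c + (1 - c)).
  apply: (@sem_comp2 _ _ _ _ c (1 - c)) => //; first exact: sem_comp2 (h1 _) _ (hs _ _).
have ht k : sem O pt [:: k; c] (1 - odd (iter k half (c + (1 - c)))).
  apply: sem_comp2 (h1 _) _ (hs _ _); apply: sem_comp1 (ho _).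
  exact: (@sem_comp2 _ _ _ _ k (c + (1 - c))).
pose c' := c + (1 - c); have c'0 : 0 < c' by rewrite /c'; lia.
have ec : pfst c = pfst c' by rewrite /c' /pfst; case: (c) => [|n]; rewrite ?logn1 ?logn0 // subSS sub0n addn0.
have [b ob cE] : exists2 b, odd b & c' = 2 ^ pfst c' * b.
  have [b cb cE] := pfactor_coprime (isT : prime 2) c'0; exists b; last by rewrite mulnC.
  by rewrite -coprime2n.
rewrite ec; split.
  have e1 : odd (iter (pfst c') half c') by rewrite [X in iter _ half X]cE iter_half_pow.
  by have := ht (pfst c'); rewrite -/c' e1.
move=> z zc; exists 0; have := ht z; rewrite -/c'.
have -> : odd (iter z half c') = false; last by [].
have [e ve] : exists e, pfst c' = z + e.+1 by exists (pfst c' - z.+1); rewrite addnS -addSn subnKC.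
by rewrite cE ve expnD -mulnA iter_half_pow expnS -mulnA mul2n odd_double.
Qed.

Lemma raw1_psnd : raw1 psnd.
Proof.
apply: (raw1_comp raw1_half); exact: raw1_comp2 (raw2_iter raw1_half) raw1_pfst raw1_id.
Qed.

Lemma raw_cond : exists p, forall (b : bool) x y, sem O p [:: nat_of_bool b; x; y] (if b then x else y).
Proof.
exists (PPrec (PProj 1) (PProj 2)) => b x y.
by exists (fun i => if i is 0 then y else x); split=> //; case: b => //= -[|].
Qed.
End Raw.

(** Programs only have to be right on codes, so a subtype can share the codes of the type around it.
    [dflt] fills in for the head of an empty list. *)
Class Enc (T : Type) := { enc : T -> nat; dflt : T }.

#[export] Instance enc_nat : Enc nat := {| enc := id; dflt := 0 |}.
#[export] Instance enc_bool : Enc bool := {| enc := nat_of_bool; dflt := false |}.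
#[export] Instance enc_int : Enc int := {| enc := nat_of_int; dflt := 0%R |}.
#[export] Instance enc_prod (T U : Type) `{Enc T} `{Enc U} : Enc (T * U) :=
  {| enc := fun z => pcode (enc z.1) (enc z.2); dflt := (dflt, dflt) |}.
(** On lists of naturals this is [CodeSeq.code]; pairs and lists share [pcode], hence its two
    projections. *)
#[export] Instance enc_seq (T : Type) `{Enc T} : Enc (seq T) :=
  {| enc := foldr (fun a c => pcode (enc a) c) 0; dflt := [::] |}.

(** * Computable functions between encoded types *)

Section Computable.
Variable O : set nat.

Definition computable {T U : Type} `{Enc T} `{Enc U} (f : T -> U) :=
  exists p, forall x, sem O p [:: enc x] (enc (f x)).

Context {X : Type} {EX : Enc X}.

Lemma comp_ext {U : Type} `{Enc U} (f g : X -> U) : (forall x, f x = g x) -> computable f -> computable g.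
Proof. by move=> fg [p hp]; exists p => x; rewrite -fg. Qed.

Lemma comp_lift1 {T U : Type} `{Enc T} `{Enc U} (h : nat -> nat) (g : T -> U) (f : X -> T) :
  raw1 O h -> (forall t, enc (g t) = h (enc t)) -> computable f -> computable (fun x => g (f x)).
Proof.
move=> [ph hh] gh [pf hf]; exists (PComp ph [:: pf]) => x; rewrite gh.
exact: sem_comp1 (hf x) (hh _).
Qed.

Lemma comp_lift2 {T T' U : Type} `{Enc T} `{Enc T'} `{Enc U} (h : nat -> nat -> nat)
    (g : T -> T' -> U) (f : X -> T) (f' : X -> T') :
  raw2 O h -> (forall t t', enc (g t t') = h (enc t) (enc t')) ->
  computable f -> computable f' -> computable (fun x => g (f x) (f' x)).
Proof.
move=> [ph hh] gh [pf hf] [pf' hf']; exists (PComp ph [:: pf; pf']) => x; rewrite gh.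
exact: sem_comp2 (hf x) (hf' x) (hh _ _).
Qed.

Lemma comp_id : computable (fun x : X => x).
Proof. by exists (PProj 0). Qed.

Lemma comp_const {U : Type} `{Enc U} (u : U) : computable (fun _ : X => u).
Proof. by have [p hp] := raw_const O (enc u); exists p => x. Qed.

Lemma comp_comp {T U : Type} `{Enc T} `{Enc U} (g : T -> U) (f : X -> T) :
  computable g -> computable f -> computable (fun x => g (f x)).
Proof. by move=> [pg hg] [pf hf]; exists (PComp pg [:: pf]) => x; exact: sem_comp1 (hf x) (hg _). Qed.

Lemma comp_pair {T U : Type} `{Enc T} `{Enc U} (f : X -> T) (g : X -> U) :
  computable f -> computable g -> computable (fun x => (f x, g x)).
Proof. exact: comp_lift2 (raw2_pcode O) _. Qed.

Lemma comp_fst {T U : Type} `{Enc T} `{Enc U} (f : X -> T * U) : computable f -> computable (fun x => (f x).1).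
Proof. by apply: comp_lift1 (raw1_pfst O) _ => t; rewrite pcodeK1. Qed.

Lemma comp_snd {T U : Type} `{Enc T} `{Enc U} (f : X -> T * U) : computable f -> computable (fun x => (f x).2).
Proof. by apply: comp_lift1 (raw1_psnd O) _ => t; rewrite pcodeK2. Qed.

Lemma comp_if {U : Type} `{Enc U} (b : X -> bool) (f g : X -> U) :
  computable b -> computable f -> computable g -> computable (fun x => if b x then f x else g x).
Proof.
move=> [pb hb] [pf hf] [pg hg]; have [pc hc] := raw_cond O.
exists (PComp pc [:: pb; pf; pg]) => x; apply: sem_comp3 (hb x) (hf x) (hg x) _.
by have := hc (b x) (enc (f x)) (enc (g x)); case: (b x).
Qed.

Lemma comp_iter {S : Type} `{Enc S} (n : X -> nat) (F : X -> S -> S) (b : X -> S) :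
  computable n -> computable (fun z : X * S => F z.1 z.2) -> computable b ->
  computable (fun x => iter (n x) (F x) (b x)).
Proof.
move=> [pn hn] [pF hF] [pb hb]; have [pp hp] := raw2_pcode O.
(* The step of the recursion sees the arguments i, r, b, x, so that projections 3 and 1 are the
   parameter and the current value. *)
pose step := PComp pF [:: PComp pp [:: PProj 3; PProj 1]].
exists (PComp (PPrec (PProj 0) step) [:: pn; pb; PProj 0]) => x.
apply: (sem_comp3 (hn x) (hb x) (erefl : sem O (PProj 0) [:: enc x] (enc x))).
exists (fun i => enc (iter i (F x) (b x))); split=> // i _.
apply: sem_comp1 (hF (x, iter i (F x) (b x))).
apply: (@sem_comp2 O _ _ _ _ (enc x) (enc (iter i (F x) (b x)))) ; [exact: erefl | exact: erefl | exact: hp].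
Qed.

Lemma comp_S (f : X -> nat) : computable f -> computable (fun x => (f x).+1).
Proof. exact: (comp_lift1 (g := succn) (raw1_succ O) (fun=> erefl)). Qed.

Lemma comp_pred (f : X -> nat) : computable f -> computable (fun x => (f x).-1).
Proof. exact: (comp_lift1 (g := predn) (raw1_pred O) (fun=> erefl)). Qed.

Lemma comp_double (f : X -> nat) : computable f -> computable (fun x => (f x).*2).
Proof. exact: (comp_lift1 (g := double) (raw1_double O) (fun=> erefl)). Qed.

Lemma comp_half (f : X -> nat) : computable f -> computable (fun x => (f x)./2).
Proof. exact: (comp_lift1 (g := half) (raw1_half O) (fun=> erefl)). Qed.

Lemma comp_odd (f : X -> nat) : computable f -> computable (fun x => odd (f x)).
Proof. exact: (comp_lift1 (g := (fun n => odd n)) (raw1_odd O) (fun=> erefl)). Qed.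

Lemma comp_add (f g : X -> nat) : computable f -> computable g -> computable (fun x => f x + g x).
Proof. exact: (comp_lift2 (g := addn) (raw2_add O) (fun _ _ => erefl)). Qed.

Lemma comp_sub (f g : X -> nat) : computable f -> computable g -> computable (fun x => f x - g x).
Proof. exact: (comp_lift2 (g := subn) (raw2_sub O) (fun _ _ => erefl)). Qed.

Lemma comp_not (b : X -> bool) : computable b -> computable (fun x => ~~ b x).
Proof.
move=> hb; apply: comp_ext (comp_if hb (comp_const false) (comp_const true)) => x.
by case: (b x).
Qed.

Lemma comp_and (b c : X -> bool) : computable b -> computable c -> computable (fun x => b x && c x).
Proof. by move=> hb hc; apply: comp_ext (comp_if hb hc (comp_const false)). Qed.

Lemma comp_eq0 (f : X -> nat) : computable f -> computable (fun x => f x == 0).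
Proof.
move=> hf; have [p hp] := comp_sub (comp_const 1) hf.
by exists p => x; have := hp x; rewrite /=; case: (f x) => [|n]; rewrite ?subSS ?sub0n.
Qed.

Lemma comp_leq (f g : X -> nat) : computable f -> computable g -> computable (fun x => f x <= g x).
Proof. by move=> hf hg; apply: comp_ext (comp_eq0 (comp_sub hf hg)). Qed.

Lemma comp_eqn (f g : X -> nat) : computable f -> computable g -> computable (fun x => f x == g x).
Proof.
move=> hf hg; apply: comp_ext (comp_and (comp_leq hf hg) (comp_leq hg hf)) => x.
by rewrite eqn_leq.
Qed.

Lemma comp_oracle (f : X -> nat) : computable f -> computable (fun x => `[< O (f x) >]).
Proof. by move=> [p hp]; exists (PComp POracle [:: p]) => x; exact: sem_comp1 (hp x) _. Qed.

Lemma comp_mu (P : X -> nat -> bool) (m : X -> nat) : computable (fun z : X * nat => P z.1 z.2) ->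
  (forall x, P x (m x)) -> (forall x k, k < m x -> ~~ P x k) -> computable m.
Proof.
move=> [p hp] Pm Pk; have [ps hs] := raw2_sub O; have [p1 h1] := raw_const O 1.
have [pp hpp] := raw2_pcode O.
pose pt := PComp ps [:: p1; PComp p [:: PComp pp [:: PProj 1; PProj 0]]].
have ht x k : sem O pt [:: k; enc x] (1 - P x k).
  apply: sem_comp2 (h1 _) _ (hs _ _); apply: sem_comp1 (hp (x, k)).
  by apply: (@sem_comp2 O _ _ _ _ (enc x) k); [exact: erefl | exact: erefl | exact: hpp].
exists (PMu pt) => x; split; first by have := ht x (m x); rewrite Pm.
by move=> z /Pk Pz; exists 0; have := ht x z; rewrite (negPf Pz).
Qed.

Lemma enc_cons {T : Type} `{Enc T} (a : T) (s : seq T) : enc (a :: s) = pcode (enc a) (enc s).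
Proof. by []. Qed.

Lemma comp_cons {T : Type} `{Enc T} (f : X -> T) (s : X -> seq T) :
  computable f -> computable s -> computable (fun x => f x :: s x).
Proof. exact: (comp_lift2 (g := cons) (raw2_pcode O) (fun _ _ => erefl)). Qed.

Lemma comp_behead {T : Type} `{Enc T} (s : X -> seq T) : computable s -> computable (fun x => behead (s x)).
Proof. by apply: comp_lift1 (raw1_psnd O) _ => -[|a t] /=; rewrite ?psnd0 ?pcodeK2. Qed.

Lemma enc_seq_eq0 {T : Type} `{Enc T} (s : seq T) : (enc s == 0) = nilp s.
Proof. by case: s => [|a s] //=; rewrite /pcode muln_eq0 expn_eq0. Qed.

Lemma comp_encode {T : Type} `{Enc T} (f : X -> T) : computable f -> computable (fun x => enc (f x)).
Proof. by move=> [p hp]; exists p. Qed.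

Lemma comp_nilp {T : Type} `{Enc T} (s : X -> seq T) : computable s -> computable (fun x => nilp (s x)).
Proof. by move=> hs; apply: comp_ext (comp_eq0 (comp_encode hs)) => x; rewrite enc_seq_eq0. Qed.

Lemma comp_head {T : Type} `{Enc T} (t0 : T) (s : X -> seq T) : computable s -> computable (fun x => head t0 (s x)).
Proof.
move=> hs; have [pn hn] := comp_nilp hs; have [ps hps] := hs; have [pf hf] := raw1_pfst O.
have [p0 h0] := raw_const O (enc t0); have [pc hc] := raw_cond O.
exists (PComp pc [:: pn; p0; PComp pf [:: ps]]) => x.
apply: sem_comp3 (hn x) (h0 _) (sem_comp1 (hps x) (hf _)) _.
have := hc (nilp (s x)) (enc t0) (pfst (enc (s x))).
case: (s x) => [|a t] //.
by rewrite enc_cons pcodeK1.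
Qed.
End Computable.

Lemma comp_fst0 (O : set nat) {X T : Type} `{Enc X} `{Enc T} : computable O (@fst X T).
Proof. exact: (comp_fst (comp_id O)). Qed.

Lemma comp_snd0 (O : set nat) {X T : Type} `{Enc X} `{Enc T} : computable O (@snd X T).
Proof. exact: (comp_snd (comp_id O)). Qed.

Section ListComputable.
Variable O : set nat.
Local Notation computable := (computable O).
Context {X : Type} {EX : Enc X}.

Lemma size_enc {T : Type} `{Enc T} (s : seq T) : size s <= enc s.
Proof.
elim: s => //= a s IH; apply: leq_ltn_trans IH _; rewrite /pcode.
have : enc s < (enc s).*2.+1 by rewrite ltnS -addnn leq_addr.
by move=> h; apply: leq_trans h _; rewrite leq_pmull // expn_gt0.
Qed.

(** A pair of accumulator and remaining list is iterated. The code of the list bounds its size, and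
    surplus rounds do nothing on the empty list. *)
Lemma comp_foldl {S T : Type} `{Enc S} {ET : Enc T} (F : X -> S -> T -> S) (b : X -> S) (s : X -> seq T) :
  computable (fun z : X * (S * T) => F z.1 z.2.1 z.2.2) -> computable b -> computable s ->
  computable (fun x => foldl (F x) (b x) (s x)).
Proof.
move=> hF hb hs.
pose step x (z : S * seq T) := if nilp z.2 then z else (F x z.1 (head (@dflt T ET) z.2), behead z.2).
have stepE x n a (l : seq T) : size l <= n -> (iter n (step x) (a, l)).1 = foldl (F x) a l.
  elim: n a l => [|n IH] a [|c l] // hl; rewrite iterSr /step /=; last by rewrite -IH.
  by rewrite IH.
apply: (@comp_ext _ _ _ _ _ (fun x => (iter (enc (s x)) (step x) (b x, s x)).1)).
  by move=> x; rewrite stepE // size_enc.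
apply: comp_fst; apply: comp_iter; [exact: comp_encode | | exact: comp_pair].
have h2 : computable (fun z : X * (S * seq T) => z.2) by exact: comp_snd (comp_id _).
apply: comp_if; [exact: comp_nilp (comp_snd h2) | exact: h2 |].
apply: comp_pair; last exact: comp_behead (comp_snd h2).
apply: (comp_comp (g := fun z : X * (S * T) => F z.1 z.2.1 z.2.2)
   (f := fun z : X * (S * seq T) => (z.1, (z.2.1, head (@dflt T ET) z.2.2)))) => //.
apply: comp_pair; first exact: comp_fst (comp_id _).
apply: comp_pair; [exact: comp_fst h2 | exact: comp_head (comp_snd h2)].
Qed.

Lemma comp_rev {T : Type} `{Enc T} (s : X -> seq T) : computable s -> computable (fun x => rev (s x)).
Proof.
move=> hs.
have e' (l : seq T) : rev l = foldl (fun r a => a :: r) [::] l.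
  by rewrite /rev; elim: l [::] => //= a l IH t; rewrite IH.
apply: comp_ext (comp_foldl (F := fun x r a => a :: r) _ (comp_const _ [::]) hs).
  by move=> x; rewrite e'.
exact: comp_cons (comp_snd (comp_snd (comp_id _))) (comp_fst (comp_snd (comp_id _))).
Qed.

Lemma comp_foldr {S T : Type} `{Enc S} `{Enc T} (F : X -> T -> S -> S) (b : X -> S) (s : X -> seq T) :
  computable (fun z : X * (T * S) => F z.1 z.2.1 z.2.2) -> computable b -> computable s ->
  computable (fun x => foldr (F x) (b x) (s x)).
Proof.
move=> hF hb hs.
apply: comp_ext (comp_foldl (F := fun x a c => F x c a) _ hb (comp_rev hs)).
  by move=> x; rewrite foldl_rev.
apply: (comp_comp (g := fun z : X * (T * S) => F z.1 z.2.1 z.2.2)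
   (f := fun z : X * (S * T) => (z.1, (z.2.2, z.2.1)))) => //.
apply: comp_pair; first exact: comp_fst (comp_id _).
exact: comp_pair (comp_snd (comp_snd (comp_id _))) (comp_fst (comp_snd (comp_id _))).
Qed.
End ListComputable.

Ltac comp_step :=
  first [ assumption | apply: comp_id | apply: comp_fst0 | apply: comp_snd0 | apply: comp_const | refine (comp_fst _) | refine (comp_snd _)
        | refine (comp_pair _ _) | refine (comp_cons _ _) | refine (comp_S _) | refine (comp_pred _) | refine (comp_odd _)
        | refine (comp_half _) | refine (comp_double _) | refine (comp_add _ _) | refine (comp_sub _ _)
        | refine (comp_not _) | refine (comp_and _ _) | refine (comp_eq0 _) | refine (comp_leq _ _) | refine (comp_eqn _ _)
        | refine (comp_behead _) | refine (comp_nilp _) | refine (comp_head _ _)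
        | refine (comp_oracle _) | refine (comp_if _ _ _) ].

Ltac comp_tac := repeat comp_step.

Section Multiplication.
Variable O : set nat.
Local Notation computable := (computable O).
Context {X : Type} {EX : Enc X}.

Lemma comp_mul (f g : X -> nat) : computable f -> computable g -> computable (fun x => f x * g x).
Proof.
move=> hf hg; apply: comp_ext (comp_iter (F := fun x r => g x + r) hf _ (comp_const O 0)).
  by move=> x; elim: (f x) => //= n ->; rewrite mulSn.
by apply: comp_add; [apply: (comp_comp hg) | ]; comp_tac.
Qed.

End Multiplication.

Section ListOperations.
Variable O : set nat.
Local Notation computable := (computable O).
Context {X : Type} {EX : Enc X}.

Lemma comp_exp (f g : X -> nat) : computable f -> computable g -> computable (fun x => f x ^ g x).
Proof.
move=> hf hg; apply: comp_ext (comp_iter (F := fun x r => f x * r) hg _ (comp_const O 1)).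
  by move=> x; elim: (g x) => //= n ->; rewrite expnS.
by apply: comp_mul; [apply: (comp_comp hf) | ]; comp_tac.
Qed.

Lemma iter_modn d m : iter m (fun r => if r.+1 == d then 0 else r.+1) 0 = m %% d.
Proof.
elim: m => [|m IH]; first by rewrite mod0n.
rewrite iterS IH; case: d {IH} => [|d]; first by rewrite !modn0.
have key : m.+1 %% d.+1 = (m %% d.+1).+1 %% d.+1 by rewrite -[m.+1]addn1 -modnDml addn1.
have := ltn_pmod m (ltn0Sn d); rewrite key.
case: eqP => [-> _|ne h]; first by rewrite modnn.
by rewrite [RHS]modn_small // ltn_neqAle h andbT; apply/eqP.
Qed.

Lemma comp_modn (f g : X -> nat) : computable f -> computable g -> computable (fun x => f x %% g x).
Proof.
move=> hf hg.
apply: comp_ext (comp_iter (F := fun x r => if r.+1 == g x then 0 else r.+1) hf _ (comp_const O 0)).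
  by move=> x; rewrite iter_modn.
by apply: comp_if; comp_tac; apply: (comp_comp hg); comp_tac.
Qed.

Lemma comp_cat {T : Type} `{Enc T} (s t : X -> seq T) : computable s -> computable t -> computable (fun x => s x ++ t x).
Proof.
move=> hs ht; apply: comp_ext (comp_foldr (F := fun _ a r => a :: r) _ ht hs); last by comp_tac.
by move=> x; elim: (s x) => //= a l ->.
Qed.

Lemma comp_map {T U : Type} `{Enc T} `{Enc U} (G : X -> T -> U) (s : X -> seq T) :
  computable (fun z : X * T => G z.1 z.2) -> computable s -> computable (fun x => [seq G x a | a <- s x]).
Proof.
move=> hG hs; apply: comp_ext (comp_foldr (F := fun x a r => G x a :: r) _ (comp_const O [::]) hs).
  by move=> x; elim: (s x) => //= a l ->.
apply: comp_cons; last first.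
  by comp_tac.
by apply: (comp_comp (f := fun z : X * (T * seq U) => (z.1, z.2.1)) hG); comp_tac.
Qed.

Lemma comp_iota (m n : X -> nat) : computable m -> computable n -> computable (fun x => iota (m x) (n x)).
Proof.
move=> hm hn.
pose F (x : X) (z : nat * seq nat) := (z.1.+1, z.1 :: z.2).
have hF : computable (fun z : X * (nat * seq nat) => F z.1 z.2) by comp_tac.
apply: comp_ext (comp_rev (comp_snd (comp_iter hn hF (comp_pair hm (comp_const O [::]))))).
move=> x; rewrite (_ : iter _ _ _ = (m x + n x, rev (iota (m x) (n x)))) /= ?revK //.
elim: (n x) => [|k IH]; first by rewrite addn0.
rewrite iterS IH /F [LHS]/= -addnS; congr (_, _).
by have := iotaD (m x) k 1; rewrite addn1 => ->; rewrite rev_cat.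
Qed.

Lemma comp_nth {T : Type} `{Enc T} (t0 : T) (s : X -> seq T) (i : X -> nat) :
  computable s -> computable i -> computable (fun x => nth t0 (s x) (i x)).
Proof.
move=> hs hi.
have hF : computable (fun z : X * seq T => behead z.2) by comp_tac.
apply: comp_ext (comp_head t0 (comp_iter (F := fun _ r => behead r) hi hF hs)) => x.
elim: (i x) (s x) => [|k IH] l; first by case: l.
by rewrite iterSr IH; case: l => [|c l] /=; rewrite ?nth_nil.
Qed.

Lemma comp_nseq {T : Type} `{Enc T} (n : X -> nat) (a : X -> T) :
  computable n -> computable a -> computable (fun x => nseq (n x) (a x)).
Proof.
move=> hn ha; apply: (comp_iter (F := fun x r => a x :: r)) => //; last exact: comp_const.
by apply: comp_cons; [apply: (comp_comp ha) | ]; comp_tac.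
Qed.

Lemma comp_all {T : Type} `{Enc T} (P : X -> T -> bool) (s : X -> seq T) :
  computable (fun z : X * T => P z.1 z.2) -> computable s -> computable (fun x => all (P x) (s x)).
Proof.
move=> hP hs; apply: comp_ext (comp_foldr (F := fun x a r => P x a && r) _ (comp_const O true) hs).
  by move=> x; elim: (s x) => //= a l ->.
apply: comp_and; last by comp_tac.
by apply: (comp_comp (f := fun z : X * (T * bool) => (z.1, z.2.1)) hP); comp_tac.
Qed.

Lemma comp_count {T : Type} `{Enc T} (P : X -> T -> bool) (s : X -> seq T) :
  computable (fun z : X * T => P z.1 z.2) -> computable s -> computable (fun x => count (P x) (s x)).
Proof.
move=> hP hs; apply: comp_ext (comp_foldr (F := fun x a r => (if P x a then 1 else 0) + r) _ (comp_const O 0) hs).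
  by move=> x; elim: (s x) => //= a l ->; case: (P x a).
apply: comp_add; last by comp_tac.
apply: comp_if; [|exact: comp_const|exact: comp_const].
by apply: (comp_comp (f := fun z : X * (T * nat) => (z.1, z.2.1)) hP); comp_tac.
Qed.

Lemma comp_count_mem (j : X -> nat) (s : X -> seq nat) : computable j -> computable s ->
  computable (fun x => count_mem (j x) (s x)).
Proof.
move=> hj hs; apply: (comp_count (P := fun x a => a == j x)) => //.
by apply: comp_eqn; [|apply: (comp_comp hj)]; comp_tac.
Qed.

Lemma comp_mem (j : X -> nat) (s : X -> seq nat) : computable j -> computable s -> computable (fun x => j x \in s x).
Proof.
move=> hj hs; apply: comp_ext (comp_not (comp_eq0 (comp_count_mem hj hs))) => x.
by rewrite -lt0n -has_count has_pred1.
Qed.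

Lemma comp_sumn (s : X -> seq nat) : computable s -> computable (fun x => sumn (s x)).
Proof. by move=> hs; apply: (comp_foldr (F := fun _ a r => a + r)) => //; comp_tac. Qed.

Lemma comp_size {T : Type} `{Enc T} (s : X -> seq T) : computable s -> computable (fun x => size (s x)).
Proof.
move=> hs; apply: comp_ext (comp_count (P := fun _ _ => true) (comp_const O true) hs) => x.
by rewrite count_predT.
Qed.

Lemma comp_decode (n : X -> nat) : computable n -> computable (fun x => CodeSeq.decode (n x)).
Proof.
apply: (comp_lift1 (g := CodeSeq.decode) (raw1_id O)) => t.
exact: CodeSeq.decodeK.
Qed.

Lemma comp_code (s : X -> seq nat) : computable s -> computable (fun x => CodeSeq.code (s x)).
Proof. by move=> [p hp]; exists p. Qed.

Lemma comp_int_of_nat (n : X -> nat) : computable n -> computable (fun x => int_of_nat (n x)).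
Proof.
apply: (comp_lift1 (g := int_of_nat) (raw1_id O)) => t /=.
by rewrite /int_of_nat; case o: (odd t); have := odd_double_half t; rewrite o.
Qed.

(** Integer operations are carried out on naturals through z = z+ - z-, and only the final
    difference is coded back. *)
Definition pos_part (z : int) := if z is Posz m then m else 0.
Definition neg_part (z : int) := if z is Negz m then m.+1 else 0.

Lemma part_diff (z : int) : ((pos_part z)%:Z - (neg_part z)%:Z)%R = z.
Proof. by case: z => m; rewrite /= ?subr0 // sub0r -NegzE. Qed.

Lemma comp_pos_part (z : X -> int) : computable z -> computable (fun x => pos_part (z x)).
Proof.
move=> hz; apply: comp_ext (comp_if (comp_odd (comp_encode hz)) (comp_const O 0) (comp_half (comp_encode hz))).
by move=> x; case: (z x) => m /=; rewrite odd_double // doubleK.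
Qed.

Lemma comp_neg_part (z : X -> int) : computable z -> computable (fun x => neg_part (z x)).
Proof.
move=> hz; apply: comp_ext (comp_if (comp_odd (comp_encode hz)) (comp_S (comp_half (comp_encode hz))) (comp_const O 0)).
by move=> x; case: (z x) => m /=; rewrite odd_double //= uphalf_double.
Qed.

Lemma comp_diff (p n : X -> nat) : computable p -> computable n -> computable (fun x => ((p x)%:Z - (n x)%:Z)%R).
Proof.
move=> hp hn.
have [g hg] : computable (fun x => if n x <= p x then (p x - n x).*2 else (n x - p x).-1.*2.+1).
  by comp_tac.
exists g => x; have := hg x; rewrite /=; case: leqP => h.
  by rewrite subzn.
rewrite -[(_ - _)%R]GRing.opprK GRing.opprB subzn ?(ltnW h) //.
have : 0 < n x - p x by rewrite subn_gt0.
by case: (n x - p x) => // k _; rewrite -NegzE.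
Qed.

Lemma comp_addz (y z : X -> int) : computable y -> computable z -> computable (fun x => (y x + z x)%R).
Proof.
move=> hy hz; apply: comp_ext (comp_diff (comp_add (comp_pos_part hy) (comp_pos_part hz))
  (comp_add (comp_neg_part hy) (comp_neg_part hz))) => x.
by rewrite !PoszD opprD addrACA !part_diff.
Qed.

Lemma comp_oppz (z : X -> int) : computable z -> computable (fun x => (- z x)%R).
Proof.
move=> hz; apply: comp_ext (comp_diff (comp_neg_part hz) (comp_pos_part hz)) => x.
by rewrite -opprB part_diff.
Qed.

Lemma comp_mulz (y z : X -> int) : computable y -> computable z -> computable (fun x => (y x * z x)%R).
Proof.
move=> hy hz; have [py ny] := (comp_pos_part hy, comp_neg_part hy).
have [pz nz] := (comp_pos_part hz, comp_neg_part hz).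
apply: comp_ext (comp_diff (comp_add (comp_mul py pz) (comp_mul ny nz))
  (comp_add (comp_mul py nz) (comp_mul ny pz))) => x.
transitivity (((pos_part (y x))%:Z - (neg_part (y x))%:Z) * ((pos_part (z x))%:Z - (neg_part (z x))%:Z))%R.
  by rewrite !PoszD !PoszM; ring.
by rewrite !part_diff.
Qed.

Lemma comp_Posz (n : X -> nat) : computable n -> computable (fun x => Posz (n x)).
Proof. by apply: (comp_lift1 (g := Posz) (raw1_double O)) => t. Qed.

Lemma comp_eqz0 (z : X -> int) : computable z -> computable (fun x => z x == 0%R).
Proof.
move=> hz; apply: comp_ext (comp_eq0 (comp_encode hz)) => x.
by case: (z x) => [[|m]|m].
Qed.
End ListOperations.

Lemma comp_flatten (O : set nat) {X : Type} {EX : Enc X} {T : Type} `{Enc T} (s : X -> seq (seq T)) :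
  computable O s -> computable O (fun x => flatten (s x)).
Proof.
move=> hs; apply: (comp_foldr (F := fun _ a r => a ++ r)) => //; last exact: comp_const.
by apply: comp_cat; comp_tac.
Qed.

Definition trial_prime (d : nat) := (1 < d) && all (fun k => d %% k != 0) (iota 2 (d - 2)).

Lemma trial_primeE d : trial_prime d = prime d.
Proof.
apply/idP/idP => [/andP[d1 /allP h]|pd].
  apply/primeP; split=> // k kd; rewrite -implyNb; apply/implyP => k1; apply/negPn/negP => kd'.
  have k0 : 0 < k by apply: dvdn_gt0 kd; apply: ltnW.
  have kled := dvdn_leq (ltnW d1) kd.
  have : k \in iota 2 (d - 2).
    by rewrite mem_iota; move: k1 kd' k0 kled d1 => /=; clear; lia.
  by move=> /h; rewrite -/(dvdn k d) kd.
rewrite /trial_prime prime_gt1 //; apply/allP => k; rewrite mem_iota => /andP[k2 kd].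
apply/negP => kd'; have [_ /(_ k kd')/pred2P] := primeP pd.
by move: k2 kd (prime_gt1 pd); clear; lia.
Qed.

(** Euler's criterion with -1 written as p - 1: a test on naturals, so that d can be searched for
    uniformly in A. *)
Definition nonresidue_test (A : seq nat) (d : nat) :=
  trial_prime d && ((d %% 4 == 1) && all (fun p => d ^ p.-1./2 %% p == p.-1) A).

Lemma legendre_euler p d : prime p -> odd p -> (d ^ p.-1./2 %% p == p.-1) = (legendre p d == -1)%R.
Proof.
move=> pp op; have pm1 : (p.-1%:R : 'F_p)%R = (-1)%R.
  by apply/eqP; rewrite -subr_eq0 opprK natr1 prednK ?prime_gt0 // Fp_nat_eq0.
have e := legendreE d pp op; rewrite -natrX in e; apply/eqP/eqP => h.
  apply: (@Fp_sign_inj p) => //; [exact: legendre_val | exact: Or33 |].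
  by rewrite e -(Fp_nat_mod pp) h pm1.
rewrite h in e; have : (p.-1%:R : 'F_p)%R = (d ^ p.-1./2)%:R%R by rewrite pm1 -e.
move=> /(congr1 (@nat_of_ord _)); rewrite !val_Fp_nat // => <-.
by rewrite modn_small // prednK ?prime_gt0.
Qed.

Definition zprod (nums : seq int) (vs : seq nat) : int :=
  foldr (fun j r => nth 0 nums j * r)%R 1%R vs.

Definition degree_bound (f : vpoly) : nat := sumn [seq size a.2 | a <- f].

(* The value of f at nums / D, multiplied by a power of D. *)
Definition zeval (nums : seq int) (D : nat) (f : vpoly) : int :=
  foldr (fun a r => a.1 * zprod nums a.2 * (D ^ (degree_bound f - size a.2))%N%:Z + r)%R 0%R f.

Lemma zevalE nums D f : 0 < D ->
  ((zeval nums D f)%:~R =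
   veval (fun j => (nth 0 nums j)%:~R / D%:R) f * D%:R ^+ degree_bound f :> rat)%R.
Proof.
move=> D0; have DR : (D%:R != 0 :> rat)%R by rewrite pnatr_eq0 -lt0n.
have pr vs : ((zprod nums vs)%:~R = \prod_(j <- vs) ((nth 0 nums j)%:~R / D%:R) * D%:R ^+ size vs :> rat)%R.
  elim: vs => [|j vs IH]; first by rewrite big_nil mul1r.
  by rewrite /= intrM IH big_cons exprS; field.
rewrite /zeval; have : forall a, a \in f -> size a.2 <= degree_bound f.
  move=> a; rewrite /degree_bound; elim: (f) => //= b g IH; rewrite inE => /orP[/eqP->|/IH h].
    exact: leq_addr.
  by rewrite (leq_trans h) // leq_addl.
move: (degree_bound f) => K; elim: f => [|a f IH] hK.
  by rewrite /veval big_nil mul0r.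
rewrite /veval big_cons mulrDl -/(veval _ f) -IH; last by move=> b bf; apply: hK; rewrite inE bf orbT.
rewrite /= intrD !intrM pr; congr (_ + _)%R.
have h := hK a (mem_head _ _).
rewrite -[in RHS](subnKC h) exprD -pmulrn natrX; ring.
Qed.

Lemma comp_trial_prime {O : set nat} {X : Type} {EX : Enc X} (d : X -> nat) : computable O d -> computable O (fun x => trial_prime (d x)).
Proof.
move=> hd; apply: comp_and; first by comp_tac.
apply: (comp_all (P := fun x k => d x %% k != 0)).
  by apply/comp_not/comp_eq0/comp_modn; [apply: (comp_comp hd) | ]; comp_tac.
by apply: comp_iota; comp_tac.
Qed.

Lemma comp_nonresidue_test {O : set nat} {X : Type} {EX : Enc X} (A : X -> seq nat) (d : X -> nat) : computable O A -> computable O d ->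
  computable O (fun x => nonresidue_test (A x) (d x)).
Proof.
move=> hA hd; apply: comp_and; first exact: comp_trial_prime.
apply: comp_and; first by apply: comp_eqn; [apply: comp_modn | ]; comp_tac.
apply: (comp_all (P := fun x p => d x ^ p.-1./2 %% p == p.-1)) => //.
apply: comp_eqn; last by comp_tac.
apply: comp_modn; last by comp_tac.
by apply: comp_exp; [apply: (comp_comp hd) | ]; comp_tac.
Qed.

Lemma comp_vterm {O : set nat} {X : Type} {EX : Enc X} (n : X -> nat) (s : X -> seq nat) : computable O n -> computable O s ->
  computable O (fun x => vterm (n x) (s x)).
Proof.
move=> hn hs; apply: comp_pair; first by apply: comp_int_of_nat; comp_tac.
apply: comp_flatten; apply: (comp_map (G := fun x i => nseq (nth 0 (behead (s x)) i) i)).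
  apply: comp_nseq; last by comp_tac.
  by apply: comp_nth; [apply: comp_behead; apply: (comp_comp hs) | ]; comp_tac.
by apply: comp_iota; comp_tac.
Qed.

Lemma comp_index_nvars {O : set nat} {X : Type} {EX : Enc X} (e : X -> nat) : computable O e -> computable O (fun x => index_nvars (e x)).
Proof. by move=> he; apply/comp_head/comp_decode. Qed.

Lemma comp_of_index {O : set nat} {X : Type} {EX : Enc X} (e : X -> nat) : computable O e -> computable O (fun x => of_index (e x)).
Proof.
move=> he; apply: (comp_map (G := fun x t => vterm (index_nvars (e x)) (CodeSeq.decode t))).
  apply: comp_vterm; last by apply: comp_decode; comp_tac.
  by apply: comp_index_nvars; apply: (comp_comp he); comp_tac.
by apply/comp_behead/comp_decode.
Qed.

Lemma comp_vmul {O : set nat} {X : Type} {EX : Enc X} (p q : X -> vpoly) : computable O p -> computable O q -> computable O (fun x => vmul (p x) (q x)).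
Proof.
move=> hp hq; apply: comp_flatten.
apply: (comp_map (G := fun x a => [seq ((a.1 * b.1)%R, a.2 ++ b.2) | b <- q x])) => //.
apply: (comp_map (G := fun (z : X * (int * seq nat)) (b : int * seq nat) => ((z.2.1 * b.1)%R, z.2.2 ++ b.2))).
  by apply: comp_pair; [apply: comp_mulz | apply: comp_cat]; comp_tac.
by apply: (comp_comp hq); comp_tac.
Qed.

Lemma comp_vindex {O : set nat} {X : Type} {EX : Enc X} (N : X -> nat) (p : X -> vpoly) : computable O N -> computable O p ->
  computable O (fun x => vindex (N x) (p x)).
Proof.
move=> hN hp; apply: comp_code; apply: comp_cons => //.
apply: (comp_map (G := fun x a => CodeSeq.code (nat_of_int a.1 :: [seq count_mem j a.2 | j <- iota 0 (N x)]))) => //.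
apply: comp_code; apply: comp_cons.
  by apply: (comp_encode (f := fun z : X * (int * seq nat) => z.2.1)); comp_tac.
apply: (comp_map (G := fun (z : X * (int * seq nat)) j => count_mem j z.2.2)).
  by apply: comp_count_mem; comp_tac.
by apply: comp_iota; [|apply: (comp_comp hN)]; comp_tac.
Qed.

Lemma comp_system_polys {O : set nat} {X : Type} {EX : Enc X} (P d i o : X -> nat) : computable O P -> computable O d -> computable O i -> computable O o ->
  computable O (fun x => system_polys (P x) (d x) (i x) (o x)).
Proof.
move=> hP hd hi ho; rewrite /system_polys.
have hv j : computable O (fun x => o x + j) by comp_tac.
have nP : computable O (fun x => (- (P x)%:Z)%R) by apply/comp_oppz/comp_Posz.
have nd : computable O (fun x => (- (d x)%:Z)%R) by apply/comp_oppz/comp_Posz.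
have PZ := comp_Posz hP.
have cPd : computable O (fun x => Posz (4 * P x * d x)).
  by apply: comp_Posz; apply: comp_mul => //; apply: comp_mul; comp_tac.
apply: comp_cons; first by comp_tac.
apply: comp_cons; first by comp_tac.
apply: comp_cons; first by comp_tac.
apply: comp_cons; last by comp_tac.
apply: comp_cons; first by comp_tac.
apply: (comp_map (G := fun x j => (1%R : int, [:: o x + 9 + j; o x + j]))); last by comp_tac.
have ho' : computable O (fun z : X * nat => o z.1) by apply: (comp_comp ho); comp_tac.
by comp_tac.
Qed.

Lemma comp_reduced_index {O : set nat} {X : Type} {EX : Enc X} (P d e : X -> nat) : computable O P -> computable O d -> computable O e ->
  computable O (fun x => reduced_index (P x) (d x) (e x)).
Proof.
move=> hP hd he; have hn := comp_index_nvars he.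
apply: comp_vindex; first by apply: comp_mul => //; comp_tac.
apply: comp_flatten; apply: (comp_map (G := fun _ g => vmul g g)).
  by apply: comp_vmul; comp_tac.
apply: comp_cons; first exact: comp_of_index.
apply: comp_flatten; apply: (comp_map (G := fun x i =>
  system_polys (P x) (d x) i (system_offset (index_nvars (e x)) i))).
  apply: comp_system_polys; [exact: (comp_comp hP (comp_fst0 O)) | exact: (comp_comp hd (comp_fst0 O)) | by comp_tac |].
  apply: comp_add; first exact: (comp_comp hn (comp_fst0 O)).
  by apply: comp_mul; comp_tac.
by apply: comp_iota; comp_tac.
Qed.

Lemma comp_zeval {O : set nat} {X : Type} {EX : Enc X} (nums : X -> seq int) (D : X -> nat) (f : X -> vpoly) :
  computable O nums -> computable O D -> computable O f -> computable O (fun x => zeval (nums x) (D x) (f x)).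
Proof.
move=> hn hD hf.
have hK : computable O (fun x => degree_bound (f x)).
  apply: comp_sumn; apply: (comp_map (G := fun _ a => size a.2)) => //.
  by apply: comp_size; comp_tac.
apply: (comp_foldr (F := fun x a r =>
  (a.1 * zprod (nums x) a.2 * Posz (D x ^ (degree_bound (f x) - size a.2)) + r)%R)) => //; last exact: comp_const.
apply: comp_addz; last by comp_tac.
apply: comp_mulz; first apply: comp_mulz; first by comp_tac.
  have hz : computable O (fun z : seq int * seq nat => zprod z.1 z.2).
    apply: (comp_foldr (F := fun (z : seq int * seq nat) j r => (nth 0 z.1 j * r)%R)).
    - by apply: comp_mulz; [apply: comp_nth |]; comp_tac.
    - exact: comp_const.
    - by comp_tac.
  apply: (comp_comp (f := fun z : X * (int * seq nat * int) => (nums z.1, z.2.1.2)) hz).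
  by apply: comp_pair; [exact: (comp_comp hn (comp_fst0 O)) | comp_tac].
apply: comp_Posz; apply: comp_exp; first exact: (comp_comp hD (comp_fst0 O)).
apply: comp_sub; first exact: (comp_comp hK (comp_fst0 O)).
by apply: comp_size; comp_tac.
Qed.

(** * The staged construction *)

(** A stage travels with its proof of validity but is coded by its data alone; the unbounded
    searches below are total on valid stages. *)
Definition enc_sig {T : Type} `{Enc T} (P : T -> Prop) (z0 : {x | P x}) : Enc {x | P x} :=
  {| enc := fun z => enc (sval z); dflt := z0 |}.

Lemma comp_qfun (O : set nat) (q : nat -> nat) : computable_fun q -> computable O q.
Proof. by move=> [p hp]; exists (unoracle p) => x; apply: sem_unoracle; exact: hp. Qed.

Section Construction.
Variables (R : realType) (W : set nat) (q : nat -> nat) (n0 : nat).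
Hypothesis W_prime : forall p, W p -> prime p.
Hypothesis q_comp : computable_fun q.
Hypothesis q_inj : injective q.
Hypothesis q_range : range q = W.
Hypothesis q_odd : forall i, n0 <= i -> odd (q i).

Let O := HTP (Zinv W).

Lemma enum_mem i : W (q i).
Proof. by rewrite -q_range; exists i. Qed.

Lemma enum_prime i : prime (q i).
Proof. exact/W_prime/enum_mem. Qed.

Definition qprod (J : seq nat) := foldr (fun j r => q j * r) 1 J.

Lemma qprodE J : qprod J = \prod_(p <- [seq q j | j <- J]) p.
Proof. by elim: J => [|j J IH]; rewrite ?big_nil //= big_cons -IH. Qed.

Lemma qprod_gt0 J : 0 < qprod J.
Proof. by elim: J => //= j J IH; rewrite muln_gt0 IH prime_gt0 ?enum_prime. Qed.

Lemma qprod_cat J K : qprod (J ++ K) = qprod J * qprod K.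
Proof. by elim: J => [|j J IH]; rewrite ?mul1n //= IH mulnA. Qed.

Lemma enum_seq (s : seq nat) (T : set nat) : T `<=` W -> (forall p, p \in s -> T p) ->
  exists2 J, s = [seq q j | j <- J] & forall j, j \in J -> T (q j).
Proof.
move=> TW; elim: s => [|p s IH] sT; first by exists [::].
have [|J sJ JT] := IH; first by move=> r rs; apply: sT; rewrite inE rs orbT.
have Tp := sT p (mem_head _ _); have := TW _ Tp; rewrite -q_range => -[j _ qj].
exists (j :: J); first by rewrite /= qj sJ.
by move=> i; rewrite inE => /orP[/eqP->|/JT//]; rewrite qj.
Qed.

Lemma common_qprod (T : set nat) (x : nat -> rat) (n : nat) : T `<=` W ->
  (forall i, i < n -> Zinv T (x i)) ->
  exists (J : seq nat) (a : nat -> int), (forall j, j \in J -> T (q j)) /\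
    forall i, i < n -> (x i = (a i)%:~R / (qprod J)%:R)%R.
Proof.
move=> TW; elim: n => [|n IH] xT; first by exists [::], (fun=> 0%R).
have [|J [a [JT xa]]] := IH; first by move=> i ni; apply: xT; exact: ltnW.
have [b [s [sT xn]]] := xT n (ltnSn n).
have [K sK KT] := enum_seq TW sT.
exists (J ++ K), (fun i : nat => (if (i < n)%N then a i * Posz (qprod K) else b * Posz (qprod J))%R).
split=> [j|i]; first by rewrite mem_cat => /orP[/JT|/KT].
have u0 L : ((qprod L)%:R != 0 :> rat)%R by rewrite pnatr_eq0 -lt0n qprod_gt0.
rewrite ltnS leq_eqVlt qprod_cat natrM => /orP[/eqP->|ni].
  rewrite ltnn xn sK -qprodE intrM -pmulrn; field; by rewrite !u0.
rewrite ni xa // intrM -pmulrn; field; by rewrite !u0.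
Qed.

(** A candidate c is a pair of lists: numerators, and indices of primes whose product is the common
    denominator. Naming the primes through q puts every candidate in Z[W^-1] although W is only
    enumerated. *)
Definition solution_test (A : seq nat) (e c : nat) : bool :=
  all (fun j => q j \notin A) (CodeSeq.decode (psnd c)) &&
  (zeval [seq int_of_nat k | k <- CodeSeq.decode (pfst c)]
     (qprod (CodeSeq.decode (psnd c))) (of_index e) == 0%R).

Lemma solution_test_exists (A : seq nat) (e : nat) :
  HTP (Zinv (W `\` [set` A])) e -> exists c, solution_test A e c.
Proof.
move=> /HTP_veval[x [xW xe]].
have [|J [a [JA xa]]] := common_qprod _ xW; first by move=> p [].
exists (pcode (CodeSeq.code [seq nat_of_int (a i) | i <- iota 0 (index_nvars e)]) (CodeSeq.code J)).
rewrite /solution_test pcodeK1 pcodeK2 !CodeSeq.codeK; apply/andP; split.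
  by apply/allP => j /JA[_ /= jA]; apply/negP.
have D0 := qprod_gt0 J; rewrite -(intr_eq0 rat) zevalE //.
rewrite (eq_veval (y := x) (vbounded_of_index e)) ?xe ?mul0r // => i ie.
by rewrite -map_comp (nth_map 0) ?size_iota // nth_iota //= nat_of_intK xa.
Qed.

(** S need only retain the primes of the denominator that was found; this leaves later stages free
    to exclude the others. *)
Lemma solution_test_sound (A : seq nat) (S : set nat) (e c : nat) : solution_test A e c ->
  (forall j, q j \notin A -> j \in CodeSeq.decode (psnd c) -> S (q j)) -> HTP (Zinv S) e.
Proof.
move=> /andP[/allP JA ze] JS; apply/HTP_veval; set J := CodeSeq.decode _ in JA ze JS.
set nums := map _ _ in ze; exists (fun i => (nth 0 nums i)%:~R / (qprod J)%:R)%R; split.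
  move=> i _; exists (nth 0%R nums i), [seq q j | j <- J]; split; last by rewrite -qprodE.
  by move=> p /mapP[j jJ ->]; apply: JS => //; exact: JA.
have D0 := qprod_gt0 J; move: ze; rewrite -(intr_eq0 rat) zevalE // mulf_eq0 => /orP[/eqP//|].
by rewrite expf_eq0 pnatr_eq0 gtn_eqF ?andbF.
Qed.

(** The stage number, the excluded primes, and an index beyond theirs. *)
Definition stage : Type := (nat * (seq nat * nat))%type.

Definition valid_stage (z : stage) : Prop :=
  [/\ uniq z.2.1, z.2.1 != [::], n0 <= z.2.2
    & forall p, p \in z.2.1 -> exists2 i, n0 <= i < z.2.2 & p = q i].

Definition vstage := {z | valid_stage z}.

(** One odd prime is excluded at the outset because the reduction takes a nonempty A: its primes are
    what makes P a nonsquare. *)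
Lemma valid_stage0 : valid_stage (0, ([:: q n0], n0.+1)).
Proof. by split=> //= p; rewrite inE => /eqP ->; exists n0; rewrite ?leqnn ?ltnSn. Qed.

Definition stage0 : vstage := exist _ _ valid_stage0.

#[local] Instance enc_vstage : Enc vstage := enc_sig stage0.

Definition excluded (z : vstage) := (sval z).2.1.
Definition bound (z : vstage) := (sval z).2.2.

Lemma excluded_odd_prime (z : vstage) p : p \in excluded z -> prime p /\ odd p.
Proof.
have [_ _ _ h] := svalP z => /h[i /andP[ni _] ->].
by split; [exact: enum_prime | exact: q_odd].
Qed.

Lemma nonresidue_exists (z : vstage) : exists d, nonresidue_test (excluded z) d.
Proof.
have [uA nA _ _] := svalP z.
have [|||d [dp d4 dA]] := @prime_with_legendre R (excluded z) (fun=> (-1)%R) uA.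
- by move=> p /excluded_odd_prime.
- by move=> p _; right.
- by move: nA; rewrite -/(excluded z); case: (excluded z) => // p A _; exists p; rewrite ?mem_head.
exists d; rewrite /nonresidue_test trial_primeE dp d4 eqxx /=; apply/allP => p pA.
by have [pp op] := excluded_odd_prime pA; rewrite legendre_euler // dA.
Qed.

Definition nonresidue (z : vstage) : nat := ex_minn (nonresidue_exists z).

Lemma nonresidueP (z : vstage) : [/\ prime (nonresidue z), nonresidue z %% 4 = 1
  & forall p, p \in excluded z -> legendre p (nonresidue z) = (-1)%R].
Proof.
rewrite /nonresidue; case: ex_minnP => d /and3P[dp /eqP d4 /allP dA] _.
split=> // [|p pA]; first by rewrite -trial_primeE.
by have [pp op] := excluded_odd_prime pA; apply/eqP; rewrite -legendre_euler // dA.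
Qed.

Definition query_index (z : vstage) : nat :=
  reduced_index (foldr muln 1 (excluded z)) (nonresidue z) (sval z).1.

Lemma query_indexP (z : vstage) :
  O (query_index z) <-> HTP (Zinv (W `\` [set` excluded z])) (sval z).1.
Proof.
have [uA nA _ _] := svalP z; have [dp d4 dA] := nonresidueP z.
have -> : query_index z = reduced_index (\prod_(p <- excluded z) p) (nonresidue z) (sval z).1.
  rewrite /query_index; congr reduced_index.
  by elim: (excluded z) => [|p A IH]; rewrite ?big_nil // big_cons -IH.
exact: (HTP_reduced_index R (sval z).1 W_prime uA nA (@excluded_odd_prime z) dp d4 dA).
Qed.

Definition answer (z : vstage) : bool := `[< O (query_index z) >].

(** The disjunction lets the search halt after a negative answer too, with least value 0, which
    reads as two empty lists. *)
Lemma witness_exists (z : vstage) :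
  exists c, ~~ answer z || solution_test (excluded z) (sval z).1 c.
Proof.
have [az|_] := boolP (answer z); last by exists 0.
exact/solution_test_exists/query_indexP/asboolP.
Qed.

Definition witness (z : vstage) : nat := ex_minn (witness_exists z).

(** It exceeds every index excluded so far and, since a sum bounds its terms, every index in the
    denominator found; the successor makes it positive. *)
Definition cutoff (z : vstage) : nat := (bound z + sumn (CodeSeq.decode (psnd (witness z)))).+1.

Definition next_raw (z : vstage) : stage :=
  let: N := cutoff z in let: k := (sval z).1 in
  (k.+1, (excluded z ++ [seq q i | i <- iota N (k.+1 * N)], N + k.+1 * N)).

Lemma next_valid (z : vstage) : valid_stage (next_raw z).
Proof.
have [] := svalP z; rewrite -/(excluded z) -/(bound z) => uA nA nN hA; have cb : bound z <= cutoff z by rewrite ltnW // ltnS leq_addr.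
rewrite /next_raw; set N := cutoff z in cb *; set M := (_ * N)%N; clearbody M; clearbody N; split=> /=.
- rewrite cat_uniq uA map_inj_uniq // iota_uniq andbT /=; apply/hasPn => p /mapP[i].
  rewrite mem_iota => /andP[ci _] ->; apply/negP => /hA[j /andP[_ jN] /q_inj ij].
  by move: (leq_trans jN cb); rewrite ltnNge -ij ci.
- by case: (excluded z) nA.
- by apply: leq_trans (leq_trans nN cb) (leq_addr _ _).
- move=> p; rewrite mem_cat => /orP[/hA[i /andP[ni iN] ->]|/mapP[i]].
    by exists i; rewrite // ni (leq_trans iN) // (leq_trans cb) // leq_addr.
  rewrite mem_iota => /andP[ci ic] ->; exists i => //.
  by rewrite ic andbT (leq_trans (leq_trans nN cb)).
Qed.

Definition next (z : vstage) : vstage := exist _ _ (next_valid z).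

Lemma excluded_next z : excluded (next z) =
  excluded z ++ [seq q i | i <- iota (cutoff z) ((sval z).1.+1 * cutoff z)].
Proof. by []. Qed.

Lemma bound_next z : bound (next z) = cutoff z + (sval z).1.+1 * cutoff z.
Proof. by []. Qed.

Definition nth_stage (k : nat) : vstage := iter k next stage0.

Lemma nth_stage_num k : (sval (nth_stage k)).1 = k.
Proof. by elim: k => //= k ->. Qed.

Definition survivors : set nat := [set p | W p /\ forall k, p \notin excluded (nth_stage k)].

Lemma bound_cutoff z : bound z <= cutoff z.
Proof. by rewrite ltnW // ltnS leq_addr. Qed.

Lemma bound_mono k l : k <= l -> bound (nth_stage k) <= bound (nth_stage l).
Proof.
move=> /subnKC <-; elim: (l - k) => [|m IH]; first by rewrite addn0.
rewrite addnS; apply: leq_trans IH _; rewrite bound_next.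
exact: leq_trans (bound_cutoff _) (leq_addr _ _).
Qed.

Lemma excluded_later k l p : k < l -> p \in excluded (nth_stage l) ->
  p \in excluded (nth_stage k) \/ exists2 i, cutoff (nth_stage k) <= i & p = q i.
Proof.
move=> /subnKC <-; elim: (l - k.+1) => [|m IH].
  rewrite addn0 excluded_next mem_cat => /orP[|/mapP[i]]; first by left.
  by rewrite mem_iota => /andP[ci _] ->; right; exists i.
rewrite addnS excluded_next mem_cat => /orP[/IH//|/mapP[i]].
rewrite mem_iota => /andP[ci _] ->; right; exists i => //; apply: leq_trans ci.
have h : bound (nth_stage k.+1) <= bound (nth_stage (k.+1 + m)) by apply: bound_mono; rewrite leq_addr.
by apply: leq_trans (leq_trans h (bound_cutoff _)); rewrite bound_next leq_addr.
Qed.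

Lemma excluded_mono k l p : k <= l -> p \in excluded (nth_stage k) -> p \in excluded (nth_stage l).
Proof.
move=> /subnKC <-; elim: (l - k) => [|m IH]; first by rewrite addn0.
by move=> /IH h; rewrite addnS excluded_next mem_cat h.
Qed.

(** A zero found at stage e persists: its denominators avoid the primes excluded until then, and
    later exclusions begin at or beyond [cutoff]. Conversely the survivors avoid what is excluded at
    stage e, so their zeros count there. *)
Lemma answerP e : answer (nth_stage e) <-> HTP (Zinv survivors) e.
Proof.
split=> [ae|].
  have : solution_test (excluded (nth_stage e)) (sval (nth_stage e)).1 (witness (nth_stage e)).
    by rewrite /witness; case: ex_minnP => c; rewrite ae.
  rewrite nth_stage_num => /solution_test_sound; apply=> j je jw; split; first exact: enum_mem.
  move=> k; apply/negP => jk; have [ke|ek] := leqP k e.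
    by move: je; rewrite (excluded_mono ke jk).
  have [jA|[i ci /q_inj ji]] := excluded_later ek jk; first by rewrite jA in je.
  move: ci; rewrite -ji /cutoff ltnNge => /negP; apply; apply: leq_trans (leq_addl _ _).
  by rewrite sumnE (big_rem j) //= leq_addr.
move=> [v [vS ve]]; apply/asboolP/query_indexP; rewrite nth_stage_num.
exists v; split=> // i; apply: Zinv_subset (vS i) => p [Wp np]; split=> //=.
by apply/negP/np.
Qed.

Lemma survivors_gaps s : exists2 N, 0 < N &
  forall i, N <= i < N + s.+1 * N -> ~ survivors (q i).
Proof.
exists (cutoff (nth_stage s)) => // i ci [_ /(_ s.+1)].
by rewrite excluded_next nth_stage_num mem_cat (map_f q) ?orbT // mem_iota.
Qed.

(** * Computability of the stages relative to the oracle *)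

Local Notation computable := (computable O).

Lemma comp_orb {X : Type} {EX : Enc X} (b c : X -> bool) : computable b -> computable c -> computable (fun x => b x || c x).
Proof.
by move=> hb hc; apply: comp_ext (comp_if hb (comp_const O true) hc).
Qed.

Lemma comp_pfst {X : Type} {EX : Enc X} (f : X -> nat) : computable f -> computable (fun x => pfst (f x)).
Proof. exact: (comp_lift1 (g := pfst) (raw1_pfst O) (fun=> erefl)). Qed.

Lemma comp_psnd {X : Type} {EX : Enc X} (f : X -> nat) : computable f -> computable (fun x => psnd (f x)).
Proof. exact: (comp_lift1 (g := psnd) (raw1_psnd O) (fun=> erefl)). Qed.

Lemma comp_enum {X : Type} {EX : Enc X} (f : X -> nat) : computable f -> computable (fun x => q (f x)).
Proof. exact: (comp_comp (comp_qfun O q_comp)). Qed.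

Lemma comp_qprod {X : Type} {EX : Enc X} (J : X -> seq nat) : computable J -> computable (fun x => qprod (J x)).
Proof.
move=> hJ; apply: (comp_foldr (F := fun _ j r => q j * r)) => //; last exact: comp_const.
by apply: comp_mul; [apply: comp_enum|]; comp_tac.
Qed.

Lemma comp_solution_test {X : Type} {EX : Enc X} (A : X -> seq nat) (e c : X -> nat) :
  computable A -> computable e -> computable c -> computable (fun x => solution_test (A x) (e x) (c x)).
Proof.
move=> hA he hc; apply: comp_and.
  apply: (comp_all (P := fun x j => q j \notin A x)); last exact/comp_decode/comp_psnd.
  apply: comp_not; apply: comp_mem; first by apply: comp_enum; comp_tac.
  by apply: (comp_comp hA); comp_tac.
apply: comp_eqz0; apply: comp_zeval; last exact: comp_of_index.
  apply: (comp_map (G := fun _ k => int_of_nat k)); last exact/comp_decode/comp_pfst.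
  by apply: comp_int_of_nat; comp_tac.
exact/comp_qprod/comp_decode/comp_psnd.
Qed.

Lemma comp_sval : computable (fun z : vstage => sval z).
Proof. by exists (PProj 0). Qed.

Lemma comp_excluded : computable excluded.
Proof. exact: (comp_fst (comp_snd comp_sval)). Qed.

Lemma comp_bound : computable bound.
Proof. exact: (comp_snd (comp_snd comp_sval)). Qed.

Lemma comp_nonresidue : computable nonresidue.
Proof.
apply: (comp_mu (P := fun z d => nonresidue_test (excluded z) d)).
- by apply: comp_nonresidue_test; comp_tac; apply: (comp_comp comp_excluded); comp_tac.
- by move=> z; rewrite /nonresidue; case: ex_minnP.
move=> z k; rewrite /nonresidue; case: ex_minnP => m _ h km.
by apply: contraTN km => /h; rewrite leqNgt.
Qed.

Lemma comp_answer : computable answer.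
Proof.
apply: comp_oracle; apply: comp_reduced_index.
- apply: (comp_foldr (F := fun _ p r => p * r)); first by apply: comp_mul; comp_tac.
    exact: comp_const.
  exact: comp_excluded.
- exact: comp_nonresidue.
- exact: (comp_fst comp_sval).
Qed.

Lemma comp_witness : computable witness.
Proof.
apply: (comp_mu (P := fun z c => ~~ answer z || solution_test (excluded z) (sval z).1 c)).
- apply: comp_orb; first by apply: comp_not; apply: (comp_comp comp_answer); comp_tac.
  have hv : computable (fun z : vstage * nat => sval z.1) := comp_comp comp_sval (comp_fst0 O).
  apply: (comp_solution_test (A := fun z => excluded z.1) (e := fun z => (sval z.1).1) (c := snd)).
  - exact: (comp_comp comp_excluded (comp_fst0 O)).
  - exact: (comp_fst (hv _)).
  - exact: comp_snd0.
- by move=> z; rewrite /witness; case: ex_minnP.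
move=> z k; rewrite /witness; case: ex_minnP => m _ h km.
by apply: contraTN km => /h; rewrite leqNgt.
Qed.

Lemma comp_cutoff : computable cutoff.
Proof.
apply: comp_S; apply: comp_add; first exact: comp_bound.
exact/comp_sumn/comp_decode/comp_psnd/comp_witness.
Qed.

Lemma comp_next_raw : computable next_raw.
Proof.
have hn := comp_S (comp_fst comp_sval); have hm := comp_mul hn comp_cutoff.
rewrite /next_raw; refine (comp_pair hn (comp_pair (comp_cat comp_excluded _) (comp_add comp_cutoff hm))).
apply: (comp_map (G := fun _ i => q i)).
  by apply: comp_enum; comp_tac.
exact: comp_iota comp_cutoff hm.
Qed.

Lemma comp_next : computable next.
Proof. by have [p hp] := comp_next_raw; exists p. Qed.

Lemma reducible_survivors : turing_reducible (HTP (Zinv survivors)) O.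
Proof.
have hn : computable nth_stage.
  apply: (comp_iter (F := fun _ => next)); [exact: comp_id| |exact: comp_const].
  by apply: (comp_comp comp_next); comp_tac.
have [p hp] := comp_comp comp_answer hn.
exists p => e; have -> : `[< HTP (Zinv survivors) e >] = answer (nth_stage e); last exact: hp.
by apply/idP/idP => [/asboolP/answerP//|/answerP/asboolP].
Qed.
End Construction.

(** * Density of a sequence with long gaps *)

Import numFieldNormedType.Exports.
Local Open Scope ring_scope.

Lemma rel_freqE (R : realType) (q : nat -> nat) (T : set nat) (n : nat) : injective q ->
  rel_freq R q T n = (count (fun i => `[< T (q i) >]) (iota 0 n))%:R / n%:R.
Proof.
move=> q_inj; rewrite /rel_freq; congr (_%:R / _).
set s := [seq i <- iota 0 n | `[< T (q i) >]].
have -> : T `&` q @` `I_n = [set` [fset x in [seq q i | i <- s]]%fset].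
  apply/seteqP; split=> [p [/[swap] -[i /= ni <-] Tp]|p /=].
    by rewrite inE map_f // mem_filter asboolT // mem_iota.
  rewrite inE => /mapP[i]; rewrite mem_filter mem_iota => /andP[/asboolP Ti /= ni] ->.
  by split=> //; exists i.
by rewrite set_fsetK card_fseq undup_id ?size_map ?size_filter // map_inj_uniq // filter_uniq ?iota_uniq.
Qed.

Section Extremal.
Variables (R : realType) (u : nat -> R).
Hypothesis u01 : forall n, 0 <= u n <= 1.

(** Every tail infimum is already 0, so the limit is that of a constant sequence. *)
Lemma limn_inf_eq0 : (forall s, exists2 n, (s <= n)%N & u n <= s.+1%:R^-1) -> limn_inf u = 0.
Proof.
move=> us; suff e : infs u = (fun=> 0) by rewrite /limn_inf e; apply: lim_cst; exact: Rhausdorff.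
apply: funext => m /=.
have lb : lbound (sdrop u m) 0 by move=> _ [k _ <-]; case/andP: (u01 k).
have ne : sdrop u m !=set0 by exists (u m), m => /=.
apply/eqP; rewrite eq_le lb_le_inf // andbT leNgt; apply/negP => /ltr_add_invr[k].
rewrite add0r => hk; have [n kn un] := us (maxn m k).
have : inf (sdrop u m) <= u n.
  apply: ge_inf; first by exists 0.
  by exists n => //=; apply: leq_trans kn; rewrite leq_maxl.
move=> /le_trans/(_ un); rewrite leNgt => /negP; apply; apply: le_lt_trans hk.
by rewrite lef_pV2 ?posrE ?ltr0n // ler_nat ltnS leq_maxr.
Qed.

Lemma limn_sup_eq1 : (forall s, exists2 n, (s <= n)%N & 1 - s.+1%:R^-1 <= u n) -> limn_sup u = 1.
Proof.
move=> us; suff e : sups u = (fun=> 1) by rewrite /limn_sup e; apply: lim_cst; exact: Rhausdorff.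
apply: funext => m /=.
have ub : ubound (sdrop u m) 1 by move=> _ [k _ <-]; case/andP: (u01 k).
have ne : sdrop u m !=set0 by exists (u m), m => /=.
apply/eqP; rewrite eq_le ge_sup //= leNgt; apply/negP => /ltr_add_invr[k].
move=> hk; have [n kn un] := us (maxn m k).
have us1 : u n <= sup (sdrop u m).
  apply: ub_le_sup; first by exists 1.
  by exists n => //=; apply: leq_trans kn; rewrite leq_maxl.
have mk : (maxn m k).+1%:R^-1 <= k.+1%:R^-1 :> R.
  by rewrite lef_pV2 ?posrE ?ltr0n // ler_nat ltnS leq_maxr.
move: hk; rewrite -ltrBrDr ltNge => /negP; apply; apply: le_trans us1; apply: le_trans un.
by rewrite lerD2l lerN2.
Qed.
End Extremal.

Section Sparse.
Variables (R : realType) (q : nat -> nat) (S : set nat).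
Hypothesis q_inj : injective q.
Hypothesis S_gaps : forall s, exists2 N, (0 < N)%N &
  forall i, (N <= i < N + s.+1 * N)%N -> ~ S (q i).

(** n is the end of a gap: among n = (s + 2) N indices only the first N can survive. *)
Lemma count_gap (s : nat) : exists2 n, (s < n)%N &
  (count (fun i => `[< S (q i) >]) (iota 0 n) * s.+1 <= n)%N.
Proof.
have [N N0 gap] := S_gaps s; exists (N + s.+1 * N)%N; first by nia.
rewrite iotaD count_cat add0n (@eq_in_count _ _ pred0 (iota N _)) ?count_pred0 ?addn0.
  have := count_size (fun i => `[< S (q i) >]) (iota 0 N); rewrite size_iota; nia.
by move=> i; rewrite mem_iota => /gap h; apply/asboolP.
Qed.

Lemma rel_freq_bounds (T : set nat) n : 0 <= rel_freq R q T n <= 1.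
Proof.
rewrite rel_freqE // divr_ge0 ?ler0n //=; case: n => [|n]; first by rewrite invr0 mulr0 ler01.
rewrite ler_pdivrMr ?ltr0n // mul1r ler_nat.
by apply: leq_trans (count_size _ _) _; rewrite size_iota.
Qed.

Lemma sparse_lower_density : rel_lower_density R q S = 0.
Proof.
apply: limn_inf_eq0 => [n|s]; first exact: rel_freq_bounds.
have [n sn cn] := count_gap s; exists n; first exact: ltnW.
rewrite rel_freqE // ler_pdivrMr ?ltr0n ?(leq_ltn_trans _ sn) // mulrC.
by rewrite ler_pdivlMr ?ltr0n // -natrM ler_nat.
Qed.

Lemma cosparse_upper_density (W : set nat) : range q = W -> rel_upper_density R q (W `\` S) = 1.
Proof.
move=> qW; apply: limn_sup_eq1 => [n|s]; first exact: rel_freq_bounds.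
have [n sn cn] := count_gap s; exists n; first exact: ltnW.
have n0 : 0 < n%:R :> R by rewrite ltr0n (leq_ltn_trans _ sn).
rewrite rel_freqE // ler_pdivlMr // mulrBl mul1r lerBlDr -lerBlDl.
set c := count _ _ in cn; rewrite (_ : count _ _ = (n - c)%N); last first.
  rewrite -[X in (X - _)%N](size_iota 0) -(count_predC (fun i => `[< S (q i) >])) addKn.
  apply: eq_count => i /=; rewrite -asbool_neg; apply/asboolP/asboolP => [[]//|h].
  by split=> //; rewrite -qW; exists i.
have cn' : (c <= n)%N by rewrite -(size_iota 0 n) count_size.
rewrite natrB // opprB addrCA subrr addr0 mulrC ler_pdivlMr ?ltr0n //.
by rewrite -natrM ler_nat.
Qed.
End Sparse.

Lemma eventually_odd (q : nat -> nat) : injective q -> (forall i, prime (q i)) ->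
  exists n0, forall i, (n0 <= i)%N -> odd (q i).
Proof.
move=> q_inj qp; have [[j qj]|no2] := pselect (exists j, q j = 2).
  exists j.+1 => i ji; have [q2|//] := even_prime (qp i).
  by move: ji; rewrite (q_inj i j) ?ltnn // qj.
by exists 0%N => i _; have [q2|//] := even_prime (qp i); case: no2; exists i.
Qed.

Theorem theorem3p15 (R : realType) (W : set nat) (q : nat -> nat)
    (W_prime : forall p : nat, W p -> prime p)
    (W_infinite : infinite_set W)
    (W_ce : computably_enumerable W)
    (q_enum : computable_enumeration q W) :
  exists S : set nat,
    [/\ S `<=` W,
        rel_upper_density R q (W `\` S) = 1,
        turing_reducible (HTP (Zinv S)) (HTP (Zinv W))
      & rel_lower_density R q S = 0].
Proof.
have [q_comp q_inj qW] := q_enum.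
have q_prime i : prime (q i) by apply: W_prime; rewrite -qW; exists i.
have [n0 q_odd] := eventually_odd q_inj q_prime.
have gaps := survivors_gaps R W_prime q_inj qW q_odd.
exists (survivors R W_prime q_inj qW q_odd); split.
- by move=> p [].
- exact: cosparse_upper_density q_inj gaps _ qW.
- exact: reducible_survivors.
- exact: sparse_lower_density q_inj gaps.
Qed.
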